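(* Let $K$ be a $C^2_+$ convex body in $\mathbb{R}^n$ with centroid at the origin. Then (i) $$\lim_{p\to\infty}\left(\frac{\omega^p_{m,k,\vec{i}}(K)}{\omega^\infty_{m,k,\vec{i}}(K)}\right)^{n+p}=\exp\left(-\frac{n\,D_{KL}(P_K\|Q_K)}{\omega^\infty_{m,k,\vec{i}}(K)}\right).$$ (ii) $$\lim_{p\to 0}\left(\frac{\omega^p_{m,k,\vec{i}}(K^\circ)}{\omega^0_{m,k,\vec{i}}(K^\circ)}\right)^{\frac{n(n+p)}{p}}=\exp\left(-\frac{n\,D_{KL}(Q_{K^\circ}\|P_{K^\circ})}{\omega^0_{m,k,\vec{i}}(K^\circ)}\right).$$
   Context: A convex body is a compact convex subset of $\mathbb{R}^n$ ($n\ge 2$) with nonempty interior. It is $C^2_+$ if its boundary is twice continuously differentiable with strictly positive Gauss curvature everywhere. $K^\circ=\{y\in\mathbb{R}^n:\langle y,x\rangle\le 1\text{ for all }x\in K\}$ is the polar body. For $L=K$ or $L=K^\circ$ (both are $C^2_+$ with the origin in the interior) and $x\in\partial L$, $N(x)$ is the outer unit normal of $L$, $k_1(x),\dots,k_{n-1}(x)$ are the principal curvatures, and $H_j=\binom{n-1}{j}^{-1}\sum_{1\le i_1<\dots<i_j\le n-1}k_{i_1}\cdots k_{i_j}$ for $1\le j\le n-1$; in particular $H_{n-1}$ is the Gauss curvature. $\mathcal{H}^{n-1}$ is the surface area measure on $\partial L$. Fix integers $k,m\ge 0$ and a sequence $\vec{i}=\{i_j\}_{j=0}^{n-1}$ of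 nonnegative integers with $i_1+2i_2+\cdots+(n-1)i_{n-1}=m$. Let $\mu_{\vec{i}}$ be the measure on $\partial L$ with $d\mu_{\vec{i}}(x)=\langle x,N(x)\rangle^{m-k}\prod_{j=1}^{n-1}\left\{\binom{n-1}{j}^{i_j}H_j(x)^{i_j}\right\}d\mathcal{H}^{n-1}(x)$. For $p\in\mathbb{R}$, $p\neq -n$, $$\omega^p_{m,k,\vec{i}}(L)=\int_{\partial L}\frac{H_{n-1}(x)^{\frac{p}{n+p}}}{\langle x,N(x)\rangle^{\frac{n(p-1)}{n+p}}}\,d\mu_{\vec{i}}(x),\qquad \omega^\infty_{m,k,\vec{i}}(L)=\int_{\partial L}\frac{H_{n-1}(x)}{\langle x,N(x)\rangle^{n}}\,d\mu_{\vec{i}}(x).$$ In particular $\omega^0_{m,k,\vec{i}}(L)=\int_{\partial L}\langle x,N(x)\rangle\,d\mu_{\vec{i}}(x)$. $P_L$ and $Q_L$ are the measures on $\partial L$ with densities $p_L(x)=\frac{H_{n-1}(x)}{\langle x,N(x)\rangle^n}$ and $q_L(x)=\langle x,N(x)\rangle$ with respect to $\mu_{\vec{i}}$ (not normalized). For measures $P=p\,\mu$, $Q=q\,\mu$ on a measure space $(X,\mu)$, $D_{KL}(P\|Q)=\int_X p\log\frac{p}{q}\,d\mu$. *)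

(* Defs.v *)
(* R^n is 'rV[R]_n.  Its library norm is the sup norm, which induces the usual
   topology; lengths, angles and diameters below are the Euclidean ones given by
   [dot]. *)
From HB Require Import structures.
From mathcomp Require Export all_boot all_order all_algebra.
From mathcomp Require Export all_classical all_reals all_analysis.
Export Order.TTheory GRing.Theory Num.Theory.
Export numFieldNormedType.Exports.

Set Implicit Arguments.
Unset Strict Implicit.
Unset Printing Implicit Defensive.

Local Open Scope classical_set_scope.
Local Open Scope ring_scope.

Section euclidean.
Context {R : realType} {n : nat}.
Implicit Types (x y : 'rV[R]_n) (A : set 'rV[R]_n).

Definition dot x y : R := \sum_(i < n) x 0 i * y 0 i.

Definition enorm x : R := Num.sqrt (dot x x).

Definition ediam A : \bar R :=
  ereal_sup [set (enorm (xy.1 - xy.2))%:E | xy in A `*` A].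

Definition boundary A : set 'rV[R]_n := closure A `\` interior A.

End euclidean.

(* Outer measure obtained from a gauge by countable coverings. *)
Section covering_outer_measure.
Local Open Scope ereal_scope.

Definition cover_outer {R : realType} {T : Type} (gauge : set T -> \bar R)
    (A : set T) : \bar R :=
  ereal_inf [set \sum_(k <oo) gauge (F k) |
             F in [set F : (set T)^nat | A `<=` \bigcup_k F k]].

(* Carrier on which every set is measurable, so that the library's [mu_ext],
   whose coverings are by measurable sets, applies to an arbitrary gauge. *)
Definition discrete_alias (T : Type) : Type := T.

HB.instance Definition _ (T : pointedType) := Pointed.on (discrete_alias T).
HB.instance Definition _ (T : pointedType) :=
  @isMeasurable.Build default_measure_display (discrete_alias T)
    discrete_measurable discrete_measurable0
    discrete_measurableC discrete_measurableU.

Context {R : realType} {T : pointedType} (gauge : set T -> \bar R).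
Hypothesis gauge0 : gauge set0 = 0.
Hypothesis gauge_ge0 : forall A, 0 <= gauge A.

Lemma cover_outerE :
  cover_outer gauge = @mu_ext _ (discrete_alias T) R gauge.
Proof.
apply/funext => A; rewrite /cover_outer /mu_ext; congr ereal_inf.
by apply/seteqP; split => _ [F AF <-]; exists F => //; case: AF.
Qed.

Lemma cover_outer0 : cover_outer gauge set0 = 0.
Proof. by rewrite cover_outerE mu_ext0. Qed.

Lemma cover_outer_ge0 A : 0 <= cover_outer gauge A.
Proof. by rewrite cover_outerE mu_ext_ge0. Qed.

Lemma le_cover_outer : {homo cover_outer gauge : A B / A `<=` B >-> A <= B}.
Proof. by rewrite cover_outerE; exact: (@le_mu_ext _ (discrete_alias T)). Qed.

Lemma cover_outer_sigma_subadditive : sigma_subadditive (cover_outer gauge).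
Proof.
rewrite cover_outerE.
exact: (@mu_ext_sigma_subadditive _ (discrete_alias T)).
Qed.

End covering_outer_measure.

Definition caratheodory_measure {R : realType} {T : pointedType}
    (mu : {outer_measure set T -> \bar R}) :
  {measure set (caratheodory_type mu) -> \bar R} :=
  (mu : set (caratheodory_type mu) -> \bar R).

Section lebesgue.
Context (R : realType) (n : nat).
Local Open Scope ereal_scope.
Implicit Types A : set 'rV[R]_n.

Definition box (a b : 'rV[R]_n) : set 'rV[R]_n :=
  [set x | forall i, (a 0 i < x 0 i <= b 0 i)%R].

(* The volume of a box, and +oo on the sets that are not boxes.  The corners of
   a nonempty box are unique. *)
Definition box_gauge A : \bar R :=
  if A == set0 then 0 else
  ereal_inf [set (\prod_(i < n) (ab.2 0 i - ab.1 0 i))%:E |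
             ab in [set ab : 'rV[R]_n * 'rV[R]_n | A = box ab.1 ab.2]].

Lemma box_gauge0 : box_gauge set0 = 0.
Proof. by rewrite /box_gauge eqxx. Qed.

Lemma box_gauge_ge0 A : 0 <= box_gauge A.
Proof.
rewrite /box_gauge; case: eqP => // /eqP/set0P[x Ax].
apply: le_ereal_inf_tmp => _ [ab /= Aab <-]; rewrite lee_fin prodr_ge0// => i _.
move: Ax; rewrite Aab => /(_ i)/andP[ax xb].
by rewrite subr_ge0 (le_trans (ltW ax)).
Qed.

Definition lebesgue_outer : set 'rV[R]_n -> \bar R := cover_outer box_gauge.

HB.instance Definition _ := isOuterMeasure.Build R 'rV[R]_n lebesgue_outer
  (cover_outer0 box_gauge0 box_gauge_ge0) (cover_outer_ge0 box_gauge_ge0)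
  (@le_cover_outer R _ box_gauge)
  (cover_outer_sigma_subadditive box_gauge_ge0).

Definition lebesgueV :
  {measure set (caratheodory_type lebesgue_outer) -> \bar R} :=
  caratheodory_measure lebesgue_outer.

End lebesgue.

Section hausdorff.
Context (R : realType) (n : nat).
Local Open Scope ereal_scope.
Implicit Types A : set 'rV[R]_n.

(* Volume of the Euclidean unit ball of R^d: the normalization that makes the
   d-dimensional Hausdorff measure the d-dimensional area. *)
Fixpoint ball_volume (d : nat) : R :=
  match d with
  | 0 => 1
  | 1 => 2
  | d'.+2 => 2 * pi / d%:R * ball_volume d'
  end%R.

Lemma ball_volume_ge0 d : (0 <= ball_volume d)%R.
Proof.
have [m dm] := ubnP d; elim: m d dm => // m IH [|[|d]] dm //.
change (0 <= 2 * pi / d.+2%:R * ball_volume d)%R.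
by rewrite !mulr_ge0 ?pi_ge0 ?invr_ge0 ?ler0n// IH// -ltnS (ltn_trans _ dm).
Qed.

(* The value +oo excludes the coverings by sets of diameter > delta. *)
Definition hausdorff_gauge (d : nat) (delta : R) A : \bar R :=
  if A == set0 then 0
  else if ediam A <= delta%:E then
    (ball_volume d * (fine (ediam A) / 2) ^+ d)%:E
  else +oo.

Lemma hausdorff_gauge0 d delta : hausdorff_gauge d delta set0 = 0.
Proof. by rewrite /hausdorff_gauge eqxx. Qed.

Lemma hausdorff_gauge_ge0 d delta A : 0 <= hausdorff_gauge d delta A.
Proof.
rewrite /hausdorff_gauge; case: eqP => // /eqP/set0P[x Ax]; case: ifP => // _.
rewrite lee_fin mulr_ge0 ?ball_volume_ge0// exprn_ge0// divr_ge0// fine_ge0//.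
apply: ereal_sup_ge; exists (enorm (x - x))%:E; first by exists (x, x).
by rewrite lee_fin sqrtr_ge0.
Qed.

Definition hausdorff_pre (d : nat) (delta : R) : set 'rV[R]_n -> \bar R :=
  cover_outer (hausdorff_gauge d delta).

Definition hausdorff (d : nat) (A : set 'rV[R]_n) : \bar R :=
  ereal_sup [set hausdorff_pre d delta A | delta in [set e : R | (0 < e)%R]].

Lemma hausdorff_pre_le d delta A : (0 < delta)%R ->
  hausdorff_pre d delta A <= hausdorff d A.
Proof. by move=> d0; apply: ereal_sup_ubound; exists delta. Qed.

Lemma hausdorff_empty d : hausdorff d set0 = 0.
Proof.
have pre0 delta := cover_outer0 (hausdorff_gauge0 d delta)
  (hausdorff_gauge_ge0 d delta).
apply/eqP; rewrite eq_le; apply/andP; split.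
  by apply: ge_ereal_sup => _ [delta _ <-]; rewrite /hausdorff_pre pre0.
by apply: ereal_sup_ubound; exists 1%R; [exact: ltr01|exact: pre0].
Qed.

Lemma hausdorff_ge0 d A : 0 <= hausdorff d A.
Proof.
apply: le_trans (hausdorff_pre_le d A ltr01).
exact/cover_outer_ge0/hausdorff_gauge_ge0.
Qed.

Lemma le_hausdorff d : {homo hausdorff d : A B / A `<=` B >-> A <= B}.
Proof.
move=> A B AB; apply: ge_ereal_sup => _ [delta d0 <-].
by apply: le_trans (hausdorff_pre_le d B d0); exact: le_cover_outer.
Qed.

Lemma hausdorff_sigma_subadditive d : sigma_subadditive (hausdorff d).
Proof.
move=> F; apply: ge_ereal_sup => _ [delta d0 <-].
apply: le_trans (cover_outer_sigma_subadditive _ _) _.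
  exact: hausdorff_gauge_ge0.
apply: lee_nneseries => [i _ _|i _]; last exact: hausdorff_pre_le.
exact/cover_outer_ge0/hausdorff_gauge_ge0.
Qed.

HB.instance Definition _ (d : nat) := isOuterMeasure.Build R 'rV[R]_n
  (hausdorff d) (hausdorff_empty d) (hausdorff_ge0 d) (@le_hausdorff d)
  (@hausdorff_sigma_subadditive d).

Definition hausdorff_measure (d : nat) :
  {measure set (caratheodory_type (hausdorff d)) -> \bar R} :=
  caratheodory_measure (hausdorff d).

End hausdorff.

Section convex_bodies.
Context {R : realType} {n : nat}.
Implicit Types (K L : set 'rV[R]_n) (x y u : 'rV[R]_n).

Definition convex_body K : Prop :=
  [/\ compact K, convex_set K & interior K !=set0].

Definition polar K : set 'rV[R]_n := [set y | forall x, K x -> dot y x <= 1].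

Definition centroid K : 'rV[R]_n :=
  \row_(i < n) ((fine (lebesgueV R n K))^-1 *
                \int[lebesgueV R n]_(x in K) (x : 'rV[R]_n) 0 i).

Definition outer_unit_normals L x : set 'rV[R]_n :=
  [set u | enorm u = 1 /\ forall y, L y -> dot u (y - x) <= 0].

(* At a boundary point of a convex body with C^1 boundary there is exactly one
   outer unit normal. *)
Definition outer_normal L x : 'rV[R]_n := xget 0 (outer_unit_normals L x).

Definition C1_on (U : set 'rV[R]_n) (f : 'rV[R]_n -> R) : Prop :=
  forall i : 'I_n,
    (forall y, U y -> derivable f y (delta_mx 0 i)) /\
    (forall y, U y -> continuous_at y ('D_(delta_mx 0 i) f)).

Definition C2_on (U : set 'rV[R]_n) (f : 'rV[R]_n -> R) : Prop :=
  C1_on U f /\ forall i : 'I_n, C1_on U ('D_(delta_mx 0 i) f).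

Definition C2_hypersurface (S : set 'rV[R]_n) : Prop :=
  forall x, S x -> exists (U : set 'rV[R]_n) (f : 'rV[R]_n -> R),
    [/\ open U, U x, C2_on U f,
        forall y, U y -> exists i : 'I_n, 'D_(delta_mx 0 i) f y != 0
      & S `&` U = [set y | U y /\ f y = 0]].

(* W represents (acting on row vectors from the right) the differential at x of
   the Gauss map [outer_normal L] : boundary L -> S^(n-1); only its restriction to the
   tangent space, the Weingarten map, is determined by this condition. *)
Definition gauss_differential L x (W : 'M[R]_n) : Prop :=
  forall eps : R, 0 < eps ->
    \forall y \near within (boundary L) (nbhs x),
      `|outer_normal L y - outer_normal L x - (y - x) *m W| <= eps * `|y - x|.

(* k lists the eigenvalues of the Weingarten map, with multiplicity, along an
   orthonormal basis e of eigenvectors (principal directions) of the tangent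
   space, the orthogonal complement of the normal. *)
Definition is_principal_curvatures L x (k : 'rV[R]_n.-1) : Prop :=
  exists (W : 'M[R]_n) (e : 'I_n.-1 -> 'rV[R]_n),
    [/\ gauss_differential L x W,
        forall i j, dot (e i) (e j) = (i == j)%:R,
        forall i, dot (e i) (outer_normal L x) = 0
      & forall i, e i *m W = k 0 i *: e i].

(* Unique up to order, which the functions below do not see. *)
Definition principal_curvatures L x : 'rV[R]_n.-1 :=
  xget 0 [set k | is_principal_curvatures L x k].

Definition mean_curvature (j : nat) L x : R :=
  ('C(n.-1, j)%:R)^-1 *
  \sum_(A : {set 'I_n.-1} | #|A| == j)
     \prod_(l in A) principal_curvatures L x 0 l.

Definition gauss_curvature L x : R := mean_curvature n.-1 L x.

Definition C2_plus K : Prop :=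
  C2_hypersurface (boundary K) /\
  forall x, boundary K x -> 0 < gauss_curvature K x.

End convex_bodies.

(* D_KL (p mu || q mu) on the measure space (X, mu). *)
Definition kullback_leibler {R : realType} {d} {T : measurableType d}
    (mu : set T -> \bar R) (X : set T) (p q : T -> R) : R :=
  fine (\int[mu]_(x in X) (p x * ln (p x / q x))%:E)%E.

Section affine_surface_areas.
Context {R : realType} {n : nat} (m k : nat) (i_ : 'I_n -> nat).
Implicit Types (L : set 'rV[R]_n) (x : 'rV[R]_n) (p : R).

(* R^n with its sigma-algebra of H^(n-1)-measurable sets. *)
Definition surface_space : Type := caratheodory_type (@hausdorff R n n.-1).

Definition support_at L x : R := dot x (outer_normal L x).

Definition mu_density L x : R :=
  support_at L x ^ (m%:Z - k%:Z) *
  \prod_(j < n | (0 < j)%N)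
     ('C(n.-1, j)%:R ^+ i_ j * mean_curvature j L x ^+ i_ j).

Definition mu_i L (A : set surface_space) : \bar R :=
  (\int[hausdorff_measure R n n.-1]_(x in A `&` boundary L)
     (mu_density L x)%:E)%E.

Definition omega p L : R :=
  fine (\int[mu_i L]_(x in (boundary L : set surface_space))
    (gauss_curvature L x `^ (p / (n%:R + p)) /
     support_at L x `^ (n%:R * (p - 1) / (n%:R + p)))%:E)%E.

Definition density_P L x : R := gauss_curvature L x / support_at L x ^+ n.

Definition density_Q L x : R := support_at L x.

Definition omega_infty L : R :=
  fine (\int[mu_i L]_(x in (boundary L : set surface_space))
    (gauss_curvature L x / support_at L x ^+ n)%:E)%E.

Definition KL_PQ L : R :=
  kullback_leibler (mu_i L) (boundary L : set surface_space)
    (density_P L) (density_Q L).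

Definition KL_QP L : R :=
  kullback_leibler (mu_i L) (boundary L : set surface_space)
    (density_Q L) (density_P L).

End affine_surface_areas.

(* Main.v *)
From HB Require Import structures.
Require Import Defs.
From mathcomp Require finmap.
From mathcomp Require Import measurable_realfun ring lra.

(** Put P = H_(n-1) / <x,N>^n and Q = <x,N>. With t = n / (n + p) the integrand of
    omega^p is P^(1-t) Q^t = P exp (- t ln (P/Q)), so that, against a finite
    measure on which ln (P/Q) is bounded,
    omega^p = omega^oo - t D_KL(P||Q) + O(t^2). Raising omega^p / omega^oo to
    the power n + p = n / t gives the first limit, as t tends to 0 when p tends to
    infinity. For the second one exchange P and Q and take t = p / (n + p), which
    tends to 0 with p. This is the content of geometric_mean_limit,
    affine_integrand_P and affine_integrand_Q.

    It remains to see, for the body and for its polar, that the area of the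
    boundary is finite and positive and that the support function and all the
    mean curvatures are positive and continuous there.

    The geometric object that gives this for both bodies at once is the polar map
    phi x = N(x) / <x,N(x)>, from the boundary of L to that of its polar, together
    with the Hessian D of half the squared gauge of L, which is the derivative of
    phi along the boundary and satisfies x D = phi x. A body with continuous,
    symmetric and positive definite D (the record dual_map) has support function
    1 / |phi| and, as Weingarten map, the compression of D to the tangent space
    divided by |phi|; its mean curvatures are therefore positive, and continuous
    as coefficients of a characteristic polynomial (mean_curvature_gt0,
    mean_curvature_cvg). Polarity inverts phi and D (dual_map_of_polar), so no
    regularity of the polar body has to be established separately. For a body of
    class C^2_+ phi is locally grad f / <x, grad f>, f being a local equation of the
    boundary; this gives the continuity of D, while its symmetry and positivity
    come from the principal directions and the convexity
    (C2_plus_dual_map).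

    On the side of measure theory, Caratheodory's criterion for metric outer
    measures makes Borel sets measurable. The area of the boundary is finite,
    because the radial map is Lipschitz on the unit sphere of the sup norm, and
    positive, because the boundary projects onto a cube of a coordinate
    hyperplane. The hypothesis on the centroid serves to put the origin in the
    interior (centroid_interior). *)

Set Implicit Arguments.
Unset Strict Implicit.
Unset Printing Implicit Defensive.

Local Open Scope classical_set_scope.
Local Open Scope ring_scope.

(** * Euclidean algebra and continuity in R^n *)

Section dot_algebra.
Context {R : realType} {n : nat}.
Implicit Types (x y z : 'rV[R]_n).

Lemma dotC x y : dot x y = dot y x.
Proof. by apply: eq_bigr => i _; rewrite mulrC. Qed.

Lemma dotDl x y z : dot (x + y) z = dot x z + dot y z.
Proof. by rewrite /dot -big_split; apply: eq_bigr => i _; rewrite mxE mulrDl. Qed.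

Lemma dotZl a x y : dot (a *: x) y = a * dot x y.
Proof. by rewrite /dot big_distrr; apply: eq_bigr => i _ /=; rewrite mxE mulrA. Qed.

Lemma dotDr x y z : dot x (y + z) = dot x y + dot x z.
Proof. by rewrite !(dotC x) dotDl. Qed.

Lemma dotZr a x y : dot x (a *: y) = a * dot x y.
Proof. by rewrite !(dotC x) dotZl. Qed.

Lemma dotNl x y : dot (- x) y = - dot x y.
Proof. by rewrite -scaleN1r dotZl mulN1r. Qed.

Lemma dotNr x y : dot x (- y) = - dot x y.
Proof. by rewrite !(dotC x) dotNl. Qed.

Lemma dotBl x y z : dot (x - y) z = dot x z - dot y z.
Proof. by rewrite dotDl dotNl. Qed.

Lemma dotBr x y z : dot x (y - z) = dot x y - dot x z.
Proof. by rewrite dotDr dotNr. Qed.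

Lemma dot0l x : dot 0 x = 0.
Proof. by rewrite -(scale0r 0) dotZl mul0r. Qed.

Lemma dot0r x : dot x 0 = 0.
Proof. by rewrite dotC dot0l. Qed.

Lemma dot_suml I (r : seq I) (P : pred I) (F : I -> 'rV[R]_n) y :
  dot (\sum_(i <- r | P i) F i) y = \sum_(i <- r | P i) dot (F i) y.
Proof.
by elim/big_rec2: _ => [|i a b _ <-]; rewrite ?dot0l// dotDl.
Qed.

Lemma dot_ge0 x : 0 <= dot x x.
Proof. by apply: sumr_ge0 => i _; rewrite -expr2 sqr_ge0. Qed.

Lemma dot_eq0 x : (dot x x == 0) = (x == 0).
Proof.
apply/eqP/eqP => [|->]; last exact: dot0l.
move=> /eqP; rewrite psumr_eq0 => [/allP h|i _]; last by rewrite -expr2 sqr_ge0.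
apply/rowP => i; have := h i; rewrite mem_index_enum => /(_ isT)/=.
by rewrite -expr2 sqrf_eq0 mxE => /eqP.
Qed.

Lemma dot_gt0 x : x != 0 -> 0 < dot x x.
Proof. by rewrite lt_def dot_ge0 dot_eq0 andbT. Qed.

Lemma dot_mulmxE x y : x *m y^T = (dot x y)%:M.
Proof.
apply/matrixP => i j; rewrite !ord1 !mxE eqxx mulr1n.
by apply: eq_bigr => k _; rewrite !mxE.
Qed.

Lemma dot_ext x y : (forall z, dot x z = dot y z) -> x = y.
Proof.
by move=> h; apply/eqP; rewrite -subr_eq0 -dot_eq0 dotBl h subrr.
Qed.

Lemma dot_delta x i : dot x (delta_mx 0 i) = x 0 i.
Proof.
rewrite /dot (bigD1 i)//= big1 => [|j ji]; rewrite !mxE ?eqxx ?mulr1 ?addr0//.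
by rewrite (negbTE ji) mulr0.
Qed.

Lemma coord_le_norm x i : `|x 0 i| <= `|x|.
Proof.
rewrite [leRHS]/Num.norm /= mx_normrE; apply/bigmax_geP; right => /=.
by exists (0, i).
Qed.

Lemma norm_le_coord x (e : R) : 0 <= e -> (`|x| <= e) = [forall i, `|x 0 i| <= e].
Proof.
move=> e0; apply/idP/forallP => [xe i|h].
  exact: le_trans (coord_le_norm x i) xe.
rewrite [leLHS]/Num.norm /= mx_normrE; apply/bigmax_leP; split=> // -[i j] _ /=.
by rewrite ord1.
Qed.

Lemma normr_dot x y : `|dot x y| <= n%:R * `|x| * `|y|.
Proof.
apply: le_trans (ler_norm_sum _ _ _) _.
have -> : n%:R * `|x| * `|y| = \sum_(i < n) `|x| * `|y|.
  by rewrite sumr_const card_ord -mulrA mulr_natl.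
by apply: ler_sum => i _; rewrite normrM ler_pM ?coord_le_norm.
Qed.

Lemma sqr_norm_le_dot x : `|x| ^+ 2 <= dot x x.
Proof.
have [->|x0] := eqVneq x 0; first by rewrite normr0 dot0l expr0n.
have [|[i j] xij] := @mx_norm_neq0 R 1 n x.
  by rewrite -[mx_norm x]/`|x| normr_eq0.
have -> : `|x| = `|x 0 j| by rewrite -(ord1 i).
rewrite real_normK ?num_real// /dot (bigD1 j)//= -expr2 lerDl.
by apply: sumr_ge0 => k _; rewrite -expr2 sqr_ge0.
Qed.

Lemma enorm_ge0 x : 0 <= enorm x. Proof. exact: sqrtr_ge0. Qed.

Lemma sqr_enorm x : enorm x ^+ 2 = dot x x.
Proof. by rewrite sqr_sqrtr ?dot_ge0. Qed.

Lemma enorm_eq0 x : (enorm x == 0) = (x == 0).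
Proof. by rewrite -(sqrf_eq0 (enorm x)) sqr_enorm dot_eq0. Qed.

Lemma enorm_gt0 x : x != 0 -> 0 < enorm x.
Proof. by rewrite lt_def enorm_ge0 enorm_eq0 andbT. Qed.

Lemma enormZ a x : enorm (a *: x) = `|a| * enorm x.
Proof.
by rewrite /enorm dotZl dotZr mulrA -expr2 sqrtrM ?sqr_ge0// sqrtr_sqr.
Qed.

Lemma norm_le_enorm x : `|x| <= enorm x.
Proof. by rewrite -(@ler_pXn2r _ 2) ?nnegrE ?enorm_ge0// sqr_enorm sqr_norm_le_dot. Qed.

Lemma enorm_le_norm x : enorm x <= n%:R * `|x|.
Proof.
have [->|x0] := eqVneq x 0.
  by rewrite normr0 mulr0 /enorm dot0l sqrtr0.
have [n0|n0] := posnP n.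
  by move: x0; case/eqP; apply/rowP => -[i /[dup]]; rewrite {1}n0.
rewrite -(@ler_pXn2r _ 2) ?nnegrE ?enorm_ge0 ?mulr_ge0// sqr_enorm.
apply: (le_trans (ler_norm _)); apply: (le_trans (normr_dot x x)).
rewrite exprMn expr2 -!mulrA -expr2 ler_wpM2l// ler_peMl ?sqr_ge0//.
by rewrite ler1n.
Qed.

End dot_algebra.

Section matrices.
Context {R : realType}.

Lemma dot_mulmxr n m (x : 'rV[R]_n) (A : 'M[R]_(n, m)) y :
  dot (x *m A) y = dot x (y *m A^T).
Proof.
have: (x *m A) *m y^T = x *m (y *m A^T)^T by rewrite trmx_mul trmxK mulmxA.
by rewrite !dot_mulmxE => /matrixP/(_ 0 0); rewrite !mxE eqxx !mulr1n.
Qed.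

Lemma mulmx_rank1 n m (v u : 'rV[R]_n) (w : 'rV[R]_m) :
  v *m (u^T *m w) = dot v u *: w.
Proof. by rewrite mulmxA dot_mulmxE mul_scalar_mx. Qed.

Lemma mulmx_norm n m (A : 'M[R]_(n, m)) :
  exists2 c : R, 0 < c & forall x : 'rV[R]_n, `|x *m A| <= c * `|x|.
Proof.
exists (1 + \sum_i \sum_j `|A i j|).
  by rewrite ltr_wpDr// sumr_ge0// => i _; rewrite sumr_ge0.
move=> x; rewrite norm_le_coord; last first.
  by rewrite mulr_ge0// addr_ge0// sumr_ge0// => i _; rewrite sumr_ge0.
apply/forallP => j; rewrite mxE (le_trans (ler_norm_sum _ _ _))//.
rewrite mulrDl mul1r -[leLHS]add0r lerD// mulr_suml ler_sum// => i _.
rewrite normrM mulrC ler_pM ?coord_le_norm//.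
by rewrite (bigD1 j)//= lerDl sumr_ge0.
Qed.

End matrices.

Section continuity.
Context {R : realType} {T : Type} (F : set_system T) {FF : Filter F}.

Lemma cvg_mxP m n (f : T -> 'M[R]_(m, n)) (A : 'M[R]_(m, n)) :
  f @ F --> A <-> forall i j, (fun t => f t i j) @ F --> A i j.
Proof.
split=> [fA i j|h].
  exact: (@cvg_comp _ _ _ f (fun M : 'M[R]_(m, n) => M i j) _ _ _ fA
            (@coord_continuous R m n i j A)).
apply/cvgrPdist_le => e e0.
have : \forall t \near F, forall ij : 'I_m * 'I_n,
    `|A ij.1 ij.2 - f t ij.1 ij.2| <= e.
  apply: filter_forall => -[i j] /=.
  by move: (h i j) => /cvgrPdist_le /(_ _ e0).
apply: filterS => t ht.
rewrite [leLHS]/Num.norm /= mx_normrE; apply/bigmax_leP; split; first exact: ltW.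
by move=> ij _; rewrite !mxE.
Qed.

Lemma cvg_bigsum I (r : seq I) (P : pred I) (f : I -> T -> R) (a : I -> R) :
  (forall i, P i -> f i @ F --> a i) ->
  (fun t => \sum_(i <- r | P i) f i t) @ F --> \sum_(i <- r | P i) a i.
Proof.
move=> h; elim: r => [|i r IH].
  by rewrite big_nil; under eq_fun do rewrite big_nil; exact: cvg_cst.
rewrite big_cons; under eq_fun do rewrite big_cons.
by case: ifP => // Pi; apply: cvgD => //; exact: h.
Qed.

Lemma cvg_bigprod I (r : seq I) (P : pred I) (f : I -> T -> R) (a : I -> R) :
  (forall i, P i -> f i @ F --> a i) ->
  (fun t => \prod_(i <- r | P i) f i t) @ F --> \prod_(i <- r | P i) a i.
Proof.
move=> h; elim: r => [|i r IH].
  by rewrite big_nil; under eq_fun do rewrite big_nil; exact: cvg_cst.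
rewrite big_cons; under eq_fun do rewrite big_cons.
by case: ifP => // Pi; apply: cvgM => //; exact: h.
Qed.

Lemma cvg_mulmx m n p (f : T -> 'M[R]_(m, n)) (g : T -> 'M[R]_(n, p))
    (A : 'M[R]_(m, n)) (B : 'M[R]_(n, p)) :
  f @ F --> A -> g @ F --> B -> (fun t => f t *m g t) @ F --> A *m B.
Proof.
move=> /cvg_mxP fA /cvg_mxP gB; apply/cvg_mxP => i j; rewrite mxE.
under eq_fun do rewrite mxE.
by apply: cvg_bigsum => k _; apply: cvgM.
Qed.

Lemma cvg_trmx m n (f : T -> 'M[R]_(m, n)) (A : 'M[R]_(m, n)) :
  f @ F --> A -> (fun t => (f t)^T) @ F --> A^T.
Proof.
move=> /cvg_mxP fA; apply/cvg_mxP => i j; rewrite mxE.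
under eq_fun do rewrite mxE.
exact: fA.
Qed.

Lemma cvg_det n (f : T -> 'M[R]_n) (A : 'M[R]_n) :
  f @ F --> A -> (fun t => \det (f t)) @ F --> \det A.
Proof.
move=> /cvg_mxP fA; rewrite /determinant; apply: cvg_bigsum => s _; apply: cvgM; first exact: cvg_cst.
by apply: cvg_bigprod => i _.
Qed.

Lemma cvg_invmx n (f : T -> 'M[R]_n) (A : 'M[R]_n) : A \in unitmx ->
  f @ F --> A -> (fun t => invmx (f t)) @ F --> invmx A.
Proof.
move=> uA fA; rewrite {2}/invmx uA.
have dA : \det A != 0 by rewrite unitmxE unitfE in uA.
have h : (fun t => (\det (f t))^-1 *: \adj (f t)) @ F -->
    (\det A)^-1 *: \adj A.
  apply: cvgZ; first by apply: cvgV; [|exact: cvg_det].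
  apply/cvg_mxP => i j; rewrite mxE; under eq_fun do rewrite mxE.
  rewrite /cofactor; apply: cvgM; first exact: cvg_cst.
  apply: cvg_det; apply/cvg_mxP => k l; rewrite !mxE.
  under eq_fun do rewrite !mxE.
  by move/cvg_mxP : fA; exact.
apply: cvg_trans h; apply: near_eq_cvg.
have := cvg_det fA => /(cvgr_neq0 _)/(_ dA); apply: filterS => t dt.
by rewrite /invmx unitmxE unitfE dt.
Qed.

Lemma cvg_dot n (f g : T -> 'rV[R]_n) (a b : 'rV[R]_n) :
  f @ F --> a -> g @ F --> b -> (fun t => dot (f t) (g t)) @ F --> dot a b.
Proof.
move=> /cvg_mxP fa /cvg_mxP gb.
by rewrite /dot; apply: cvg_bigsum => i _; apply: cvgM.
Qed.

End continuity.

(** * Convex bodies containing the origin in their interior *)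

Section near_along.
Context {R : realType} {n : nat}.
Implicit Types (S : set 'rV[R]_n) (x : 'rV[R]_n).

Lemma nbhs_distP x (P : set 'rV[R]_n) :
  nbhs x P <-> exists2 d : R, 0 < d & forall y, `|y - x| < d -> P y.
Proof.
split=> [/nbhs_ballP[d d0 h]|[d d0 h]].
  by exists d => // y yx; apply: h; rewrite -ball_normE /= distrC.
by apply/nbhs_ballP; exists d => // y; rewrite -ball_normE /= distrC; exact: h.
Qed.

Lemma near_alongP S x (P : set 'rV[R]_n) :
  (\forall y \near within S (nbhs x), P y) <->
  exists2 d : R, 0 < d & forall y, S y -> `|y - x| < d -> P y.
Proof.
rewrite near_withinE; split => [/nbhs_distP[d d0 h]|[d d0 h]].
  by exists d => // y Sy yx; apply: h.
by apply/nbhs_distP; exists d => // y yx Sy; apply: h.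
Qed.

Lemma interior_distP S x :
  interior S x <-> exists2 d : R, 0 < d & forall y, `|y - x| < d -> S y.
Proof. exact: nbhs_distP. Qed.

Lemma open_distP S :
  open S <-> forall x, S x -> exists2 d : R, 0 < d & forall y, `|y - x| < d -> S y.
Proof.
rewrite openE; split=> h x Sx; first exact/nbhs_distP/h.
by apply/nbhs_distP/h.
Qed.

Lemma dot_continuous (u : 'rV[R]_n) : continuous (dot u).
Proof. move=> x; apply: (@cvg_dot R _ (nbhs x) _ n (fun=> u) id); last exact: cvg_id.
exact: cvg_cst. Qed.

Lemma closed_half_space (u : 'rV[R]_n) (c : R) : closed [set x | dot u x <= c].
Proof.
apply: (@preimage_closed _ _ (dot u) [set z | z <= c]); last exact: closed_le.
by move=> x _; exact: dot_continuous.
Qed.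

Lemma bounded_normP S :
  bounded_set S <-> exists2 M : R, 0 < M & forall x, S x -> `|x| <= M.
Proof.
split=> [[M [_ h]]|[M M0 h]].
  exists (`|M| + 1) => [|x Sx]; first by rewrite ltr_wpDl.
  by apply: h => //; rewrite (le_lt_trans (ler_norm _))// ltrDl.
exists M; split => [|c Mc x Sx]; first exact: num_real.
exact: le_trans (h _ Sx) (ltW Mc).
Qed.

Lemma compact_norm_bound S : compact S ->
  exists2 M : R, 0 < M & forall x, S x -> `|x| <= M.
Proof. by move=> /compact_bounded/bounded_normP. Qed.

End near_along.

Section convex_geometry.
Context {R : realType} {n : nat}.
Implicit Types (L : set 'rV[R]_n) (x y z u : 'rV[R]_n).

Lemma convex_setP L : convex_set L <->
  forall x y (t : R), L x -> L y -> 0 <= t <= 1 -> L (t *: x + (1 - t) *: y).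
Proof.
split=> [cL x y t Lx Ly t01|h x y l].
  have h : Itv.spec (@Itv.num_sem R) (Itv.Real `[0%Z, 1%Z]) t.
    by apply/andP; split; rewrite ?num_real//= in_itv.
  have := cL x y (Itv.Def h); rewrite !inE; exact.
rewrite !inE => Lx Ly; apply: h => //.
by rewrite ge0 le1.
Qed.

Lemma compact_closed_rV L : compact L -> closed L.
Proof. by apply: compact_closed; exact: norm_hausdorff. Qed.

Section supporting_hyperplane.
Variables (L : set 'rV[R]_n).
Hypotheses (cL : compact L) (vL : convex_set L) (L0 : L !=set0).

(** The nearest point p of L to z gives the separating direction z - p: moving
    from p towards y in L cannot decrease the distance to z to first order. *)
Lemma strict_separation z : ~ L z ->
  exists2 u, u != 0 & forall y, L y -> dot u y < dot u z.
Proof.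
move=> nLz.
have [p Lp hp] : exists2 p, L p & forall y, L y -> dot (z - p) (z - p) <= dot (z - y) (z - y).
  have [|p /[!inE] Lp hp] := @compact_EVT_min _ R (fun y => dot (z - y) (z - y)) L L0 cL.
    apply/subspace_continuousP => x _; apply: cvg_dot; apply: cvgB;
      by [exact: cvg_cst|exact: cvg_within].
  by exists p => // y Ly; apply: hp; rewrite inE.
have zp : z - p != 0 by apply/eqP => /subr0_eq zp; apply: nLz; rewrite zp.
exists (z - p) => // y Ly.
suff h : dot (z - p) (y - p) <= 0.
  have -> : y = (y - p) - (z - p) + z by rewrite opprB addrA subrK subrK.
  by rewrite dotDr dotBr gtrDr subr_lt0 (le_lt_trans h)// dot_gt0.
rewrite leNgt; apply/negP => h.
have h2 : 0 < dot (y - p) (y - p).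
  by rewrite dot_gt0//; apply: contraTneq h => ->; rewrite dot0r ltxx.
pose t := Num.min 1 (dot (z - p) (y - p) / dot (y - p) (y - p)).
have t0 : 0 < t by rewrite lt_min ltr01 divr_gt0.
have t1 : t <= 1 by rewrite ge_min lexx.
have th : t * dot (y - p) (y - p) <= dot (z - p) (y - p).
  by rewrite -ler_pdivlMr// ge_min lexx orbT.
have /convex_setP/(_ _ _ t Ly Lp) := vL; rewrite (ltW t0) t1 => /(_ isT)/hp.
have -> : z - (t *: y + (1 - t) *: p) = (z - p) - t *: (y - p).
  by rewrite scalerBl scale1r scalerBr; apply/rowP => i; rewrite !mxE; lra.
move: (z - p) (y - p) h h2 th => w d h h2 th.
rewrite dotBl !dotBr !dotZr !dotZl (dotC d w).
move=> *; nra.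
Qed.

End supporting_hyperplane.

(** The unit vectors separating L from points close to z, up to a small error,
    form a filter base on the compact unit sphere; a cluster point supports L
    at z. *)
Lemma supporting_hyperplane L z : compact L -> convex_set L -> L !=set0 ->
  ~ interior L z -> exists2 u, u != 0 & forall y, L y -> dot u y <= dot u z.
Proof.
move=> cL vL L0 nLz.
pose A (e : R) : set 'rV[R]_n :=
  [set u | `|u| = 1 /\ forall y, L y -> dot u y <= dot u z + e].
have A0 e : 0 < e -> A e !=set0.
  move=> e0.
  have [z' [zz' Lz']] : exists z', `|z' - z| < e / n.+1%:R /\ ~ L z'.
    apply: contrapT => h; apply: nLz; apply/interior_distP.
    exists (e / n.+1%:R); first by rewrite divr_gt0.
    by move=> y yz; apply: contrapT => Ly; apply: h; exists y.
  have [u u0 hu] := strict_separation cL vL L0 Lz'.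
  have nu : 0 < `|u| by rewrite normr_gt0.
  exists (`|u|^-1 *: u); split=> [|y Ly].
    by rewrite normrZ ger0_norm ?invr_ge0// mulVf// normr_eq0.
  rewrite !dotZl -(mulKf (lt0r_neq0 nu) e) -mulrDr ler_wpM2l ?invr_ge0//.
  rewrite (le_trans (ltW (hu _ Ly)))// -lerBlDl -dotBr.
  rewrite (le_trans (ler_norm _))// (le_trans (normr_dot _ _))//.
  rewrite -mulrA mulrCA ler_wpM2l//.
  apply: (@le_trans _ _ (n.+1%:R * (e / n.+1%:R))).
    by rewrite ler_pM// ?ler_nat// ltW.
  by rewrite mulrC divfK.
have FF : ProperFilter (filter_from [set e : R | 0 < e] A).
  apply: filter_from_proper => [|e]; last exact: A0.
  apply: filter_from_filter; first by exists 1 => /=.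
  move=> e f /= e0 f0; exists (Num.min e f); first by rewrite /= lt_min e0.
  move=> u [u1 hu]; split; split=> // y Ly;
    by rewrite (le_trans (hu _ Ly))// lerD2l ge_min lexx ?orbT.
have cS : compact [set u : 'rV[R]_n | `|u| = 1].
  apply: bounded_closed_compact.
    by apply/bounded_normP; exists 1 => // u ->.
  rewrite (_ : [set _ | _] = (fun u : 'rV[R]_n => `|u|) @^-1` [set 1])//.
  apply: preimage_closed; last exact: closed_eq.
  by move=> u _; exact: norm_continuous.
have [|u [u1 hu]] := cS _ FF; first by exists 1 => //= u [].
exists u => [|y Ly]; first by rewrite -normr_eq0 u1 oner_eq0.
apply/ler_addgt0Pr => e e0.
have : closure (A e) u.
  by move=> B uB; apply: hu => //; exists e.
have cl : closed [set u : 'rV[R]_n | dot (y - z) u <= e].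
  exact: closed_half_space.
rewrite closureE => /(_ _ (conj cl _)) /=; rewrite dotBl !(dotC u) lerBlDl; apply.
by move=> v [_ /(_ _ Ly)]; rewrite /= dotBl !(dotC v) lerBlDl.
Qed.

Definition body0 L : Prop := [/\ compact L, convex_set L & interior L 0].

Lemma body0_closed L : body0 L -> closed L.
Proof. by case=> cL _ _; exact: compact_closed_rV. Qed.

Lemma body0P L x : body0 L -> boundary L x <-> L x /\ ~ interior L x.
Proof. by move=> /body0_closed/closure_id hL; rewrite /boundary -hL. Qed.

Lemma boundary_sub L : body0 L -> boundary L `<=` L.
Proof. by move=> bL x /(body0P _ bL)[]. Qed.

Lemma body0_ball L : body0 L -> exists2 r : R, 0 < r & forall y, `|y| <= r -> L y.
Proof.
case=> _ _ /interior_distP[d d0 h]; exists (d / 2); first by rewrite divr_gt0.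
move=> y yd; apply: h; rewrite subr0 (le_lt_trans yd)//.
by rewrite ltr_pdivrMr// ltr_pMr// ltr1n.
Qed.

Lemma body0_contract L x (t : R) : body0 L -> L x -> 0 <= t < 1 ->
  interior L (t *: x).
Proof.
move=> bL Lx /andP[t0 t1]; have [r r0 hr] := body0_ball bL.
have [_ /convex_setP vL _] := bL.
have t1' : 0 < 1 - t by rewrite subr_gt0.
apply/interior_distP; exists ((1 - t) * r); first by rewrite mulr_gt0.
move=> y yx.
have -> : y = t *: x + (1 - t) *: ((1 - t)^-1 *: (y - t *: x)).
  by rewrite scalerA divff ?lt0r_neq0// scale1r addrCA subrr addr0.
apply: vL => //; last by rewrite t0 ltW.
apply: hr; rewrite normrZ gtr0_norm ?invr_gt0//.
by rewrite ler_pdivrMl// ltW.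
Qed.

Lemma boundary_neq0 L x : body0 L -> boundary L x -> x != 0.
Proof.
by move=> bL /(body0P _ bL)[_]; apply: contra_notN => /eqP ->; case: bL.
Qed.

Lemma boundary_compact L : body0 L -> compact (boundary L).
Proof.
move=> bL; have [cL _ _] := bL.
apply: (subclosed_compact _ cL); last exact: boundary_sub.
apply: closedI; first exact: closed_closure.
by apply: open_closedC; exact: open_interior.
Qed.

(** A half-line issued from L leaves it at the largest parameter t for which
    p + t v lies in L. *)
Lemma line_boundary L p v : compact L -> L p -> v != 0 ->
  exists2 t : R, 0 <= t & L (p + t *: v) /\ ~ interior L (p + t *: v).
Proof.
move=> cL Lp v0; have nv : 0 < `|v| by rewrite normr_gt0.
have [M M0 hM] := compact_norm_bound cL.
pose T : set R := [set t | L (p + t *: v)].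
have T0 : T 0 by rewrite /T /= scale0r addr0.
have ubT : ubound T ((M + `|p|) / `|v|).
  move=> t /hM h; rewrite ler_pdivlMr//.
  apply: (@le_trans _ _ `|t *: v|); first by rewrite normrZ ler_wpM2r// ler_norm.
  rewrite -[t *: v](addKr p) addrC (le_trans (ler_normB _ _))//.
  by rewrite lerD2r.
have sT : has_sup T by split; [exists 0|exists ((M + `|p|) / `|v|)].
have cT : closed T.
  apply: (@preimage_closed _ _ (fun t : R => p + t *: v) L).
    move=> t _; apply: cvgD; first exact: cvg_cst.
    by apply: cvgZr_tmp; exact: cvg_id.
  exact: compact_closed_rV.
have Ts : T (sup T) by apply: cT; apply: closure_sup; case: sT.
exists (sup T); first exact: ub_le_sup sT.2 _ T0.
split=> // /interior_distP[d d0 hd].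
have : T (sup T + d / 2 / `|v|).
  apply: hd; rewrite scalerDl addrA (addrC (p + _)) addrK normrZ.
  rewrite gtr0_norm ?divr_gt0// divfK ?lt0r_neq0//.
  by rewrite ltr_pdivrMr// ltr_pMr// ltr1n.
move/(ub_le_sup sT.2); rewrite gerDl leNgt divr_gt0//.
by rewrite divr_gt0.
Qed.

Lemma ray_boundary L z : body0 L -> z != 0 ->
  exists2 l : R, 0 < l & boundary L (l^-1 *: z).
Proof.
move=> bL z0; have [cL _ iL] := bL.
have [t t0 [Lt nLt]] := line_boundary cL (interior_subset iL) z0.
rewrite add0r in Lt nLt.
have tp : 0 < t.
  by rewrite lt_def t0 andbT; apply: contra_notN nLt => /eqP ->; rewrite scale0r.
exists t^-1; first by rewrite invr_gt0.
by rewrite invrK; exact: ((body0P _ bL).2 (conj Lt nLt)).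
Qed.

Lemma polar_bounded L : body0 L ->
  exists2 M : R, 0 < M & forall y, polar L y -> `|y| <= M.
Proof.
move=> bL; have [r r0 hr] := body0_ball bL.
exists r^-1; first by rewrite invr_gt0.
move=> y Ly; rewrite norm_le_coord ?invr_ge0 ?ltW//; apply/forallP => i.
rewrite -[leRHS]mul1r ler_pdivlMr//.
have h (c : R) : `|c| <= r -> y 0 i * c <= 1.
  move=> cr; rewrite -dot_delta mulrC -dotZr; apply: Ly; apply: hr.
  rewrite norm_le_coord ?ltW//; apply/forallP => j; rewrite !mxE eqxx/=.
  by case: eqP => _; rewrite ?mulr1 ?mulr0 ?normr0// ltW.
have [y0|y0] := ger0P (y 0 i).
  by apply: h; rewrite gtr0_norm.
by rewrite mulNr -mulrN h// normrN gtr0_norm.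
Qed.

Lemma polar_body0 L : body0 L -> body0 (polar L).
Proof.
move=> bL; split.
- apply: bounded_closed_compact; first exact/bounded_normP/polar_bounded.
  rewrite (_ : polar L = \bigcap_(x in L) [set y | dot x y <= 1]).
    by apply: closed_bigI => x _; exact: closed_half_space.
  by apply/seteqP; split=> y hy x Lx; [rewrite /= dotC|rewrite dotC]; exact: hy.
- apply/convex_setP => x y t hx hy /andP[t0 t1] z Lz.
  rewrite dotDl !dotZl.
  by have := hx _ Lz; have := hy _ Lz; nra.
- have [cL _ _] := bL; have [M M0 hM] := compact_norm_bound cL.
  apply/interior_distP; exists (n.+1%:R * M)^-1.
    by rewrite invr_gt0 mulr_gt0.
  move=> y; rewrite subr0 => yM x Lx.
  rewrite (le_trans (ler_norm _))// (le_trans (normr_dot _ _))//.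
  rewrite mulrAC (@le_trans _ _ (n.+1%:R * M * `|y|))//.
    by rewrite ler_wpM2r// ler_pM ?hM// ler_nat.
  by rewrite -ler_pdivlMl ?mulr_gt0// mulr1 ltW.
Qed.

End convex_geometry.

(** * Differentiability along a set *)

Section slopes.
Context {R : realType} {n m : nat}.
Implicit Types (S : set 'rV[R]_n) (f : 'rV[R]_n -> 'rV[R]_m).

(** A is determined only on the directions tangent to S at x. *)
Definition diff_along S f x (A : 'M[R]_(n, m)) : Prop :=
  forall eps : R, 0 < eps -> \forall y \near within S (nbhs x),
    `|f y - f x - (y - x) *m A| <= eps * `|y - x|.

(** Caratheodory's form of the derivative: it turns the rules of differential
    calculus into algebra together with continuity of the slope at x. The rank
    one matrix (y - x)^T r spreads the remainder r over the increment. *)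
Lemma diff_along_slope S f x A : diff_along S f x A ->
  exists Phi : 'rV[R]_n -> 'M[R]_(n, m),
    [/\ Phi x = A, Phi @ within S (nbhs x) --> A
      & forall y, f y - f x = (y - x) *m Phi y].
Proof.
move=> fA.
pose r y := f y - f x - (y - x) *m A.
pose Phi y := A + (dot (y - x) (y - x))^-1 *: ((y - x)^T *m r y).
exists Phi; split; first by rewrite /Phi subrr trmx0 mul0mx scaler0 addr0.
- rewrite -[X in _ --> X]addr0; apply: cvgD; first exact: cvg_cst.
  apply/cvg_mxP => i j; rewrite mxE.
  apply/cvgrPdist_le => e e0; have := fA _ e0; apply: filterS => y hy.
  rewrite sub0r normrN mxE mxE big_ord1 mxE.
  have [->|yx] := eqVneq y x; first by rewrite subrr mxE mul0r mulr0 normr0 ltW.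
  have d0 : 0 < dot (y - x) (y - x) by rewrite dot_gt0// subr_eq0.
  rewrite normrM gtr0_norm ?invr_gt0// ler_pdivrMl// normrM.
  apply: (@le_trans _ _ (`|y - x| * (e * `|y - x|))).
    by rewrite ler_pM ?coord_le_norm// (le_trans _ hy)// coord_le_norm.
  by rewrite mulrCA -expr2 mulrC ler_wpM2r ?sqr_norm_le_dot// ltW.
- move=> y; rewrite mulmxDr -scalemxAr mulmx_rank1 scalerA.
  have [->|yx] := eqVneq y x.
    by rewrite !subrr mul0mx dot0l mulr0 scale0r addr0.
  by rewrite mulVf ?dot_eq0 ?subr_eq0// scale1r [RHS]addrC /r subrK.
Qed.

Lemma slope_diff_along S f x (Phi : 'rV[R]_n -> 'M[R]_(n, m)) A :
  Phi @ within S (nbhs x) --> A ->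
  (\forall y \near within S (nbhs x), f y - f x = (y - x) *m Phi y) ->
  diff_along S f x A.
Proof.
move=> PA fP e e0.
pose c : R := (n * m).+1%:R.
have c0 : 0 < c by rewrite ltr0n.
have /cvgrPdist_le/(_ _ (divr_gt0 e0 c0)) := PA.
apply: filterS2 fP => y fP AP.
rewrite fP -mulmxBr norm_le_coord; last by rewrite mulr_ge0// ltW.
apply/forallP => j; rewrite mxE (le_trans (ler_norm_sum _ _ _))//.
have h i : `|(Phi y - A) i j| <= e / c.
  apply: le_trans AP; rewrite -opprB mxE normrN.
  rewrite [leRHS]/Num.norm /= mx_normrE; apply/bigmax_geP; right => /=.
  by exists (i, j).
apply: (@le_trans _ _ (\sum_(i < n) `|y - x| * (e / c))).
  by apply: ler_sum => i _; rewrite normrM ler_pM ?coord_le_norm.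
rewrite sumr_const card_ord -mulr_natr -mulrA mulrC ler_wpM2r//.
rewrite mulrAC ler_pdivrMr// ler_pM2l// ler_nat.
by have [j0|] := posnP m; [by case: j {h} => j; rewrite {1}j0|move=> m0; rewrite leqW// leq_pmulr].
Qed.

Lemma diff_along_cvg S f x A : diff_along S f x A ->
  f @ within S (nbhs x) --> f x.
Proof.
move=> /diff_along_slope[Phi [_ PA fP]].
have -> : f = fun y => f x + (y - x) *m Phi y.
  by apply/funext => y; rewrite -fP addrC subrK.
rewrite subrr mul0mx addr0 -[X in _ --> X]addr0.
apply: cvgD; first exact: cvg_cst.
rewrite -(mul0mx _ A) -(subrr x); apply: cvg_mulmx => //.
by apply: cvgB; [exact: cvg_within|exact: cvg_cst].
Qed.

Lemma diff_alongB S f g x A B : diff_along S f x A -> diff_along S g x B ->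
  diff_along S (fun y => f y - g y) x (A - B).
Proof.
move=> hf hg e e0; have e2 : 0 < e / 2 by rewrite divr_gt0.
apply: filterS2 (hf _ e2) (hg _ e2) => y fy gy.
rewrite mulmxBr (_ : _ - _ - _ = (f y - f x - (y - x) *m A) - (g y - g x - (y - x) *m B)).
  rewrite (le_trans (ler_normB _ _))// (le_trans (lerD fy gy))//.
  by rewrite -mulrDl -splitr.
by apply/rowP => i; rewrite !mxE; ring.
Qed.

End slopes.

Section c1_frechet.
Context {R : realType} {n : nat}.
Implicit Types (U : set 'rV[R]_n) (f : 'rV[R]_n -> R).

Lemma is_derive_line f (z v : 'rV[R]_n) (t : R) : derivable f (z + t *: v) v ->
  is_derive t 1 (fun s : R => f (z + s *: v)) ('D_v f (z + t *: v)).
Proof.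
move=> df.
have E : (fun h : R => h^-1 *: (((fun s : R => f (z + s *: v)) \o shift t) (h *: 1)
      - f (z + t *: v))) =
    (fun h : R => h^-1 *: ((f \o shift (z + t *: v)) (h *: v) - f (z + t *: v))).
  apply/funext => h /=; congr (_ *: (f _ - _)).
  by rewrite [h *: 1]mulr1 scalerDl addrCA.
by split; rewrite /derivable /derive E.
Qed.

Lemma mvt_signed (g dg : R -> R) (h : R) :
  (forall t : R, `|t| <= `|h| -> is_derive t 1 g (dg t)) ->
  exists2 c, `|c| <= `|h| & g h - g 0 = dg c * h.
Proof.
move=> H.
have cg (t : R) : `|t| <= `|h| -> {for t, continuous g}.
  move=> th; apply: differentiable_continuous; apply/derivable1_diffP.
  by have [] := H _ th.
have [h0|h0] := leP 0 h.
  have [t /[!in_itv]/= /andP[t0 th]||c /[!in_itv]/= /andP[c0 ch] ->] :=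
    @MVT_segment R g dg 0 h h0.
  - by apply: H; rewrite !ger0_norm// ltW.
  - apply: derivable_within_continuous => t /[!in_itv]/= /andP[t0 th].
    by have [|] := H t; rewrite ?ger0_norm.
  - by exists c; rewrite ?subr0// !ger0_norm.
have [t /[!in_itv]/= /andP[t0 th]||c /[!in_itv]/= /andP[c0 ch] E] :=
  @MVT_segment R g dg h 0 (ltW h0).
- by apply: H; rewrite !ltr0_norm// lerN2 ltW.
- apply: derivable_within_continuous => t /[!in_itv]/= /andP[t0 th].
  by have [|] := H t; rewrite ?ler0_norm ?lerN2// ltW.
- exists c; first by rewrite !ler0_norm ?lerN2// ltW.
  by rewrite -opprB E sub0r mulrN opprK.
Qed.

(** The increment of f from x to y is telescoped along the edges of a box, one
    coordinate at a time; on each edge the mean value theorem evaluates the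
    partial derivative at a point close to x. *)
Lemma C1_frechet U f x : open U -> U x -> C1_on U f ->
  diff_along setT (fun y => (f y)%:M : 'rV[R]_1) x
    (\col_i 'D_(delta_mx 0 i) f x).
Proof.
move=> oU Ux fC e e0.
have [d d0 hd] : exists2 d : R, 0 < d & forall y, `|y - x| < d -> U y /\
    forall i, `|'D_(delta_mx 0 i) f y - 'D_(delta_mx 0 i) f x| <= e / n.+1%:R.
  apply/nbhs_distP.
  have hi : \forall y \near nbhs x, forall i,
      `|'D_(delta_mx 0 i) f y - 'D_(delta_mx 0 i) f x| <= e / n.+1%:R.
    apply: filter_forall => i; have [_ /(_ _ Ux)] := fC i.
    move/cvgrPdist_le/(_ (e / n.+1%:R)); rewrite divr_gt0// => /(_ isT).
    by apply: filterS => y; rewrite distrC.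
  by apply: filterI hi; exact: open_nbhs_nbhs.
apply/near_alongP; exists d => // y _ yx.
have [h hE] : exists h, h = y - x by exists (y - x).
rewrite -hE in yx *.
pose z (k : nat) : 'rV[R]_n := \row_i (x 0 i + (i < k)%:R * h 0 i).
have zx k : `|z k - x| <= `|h|.
  rewrite norm_le_coord//; apply/forallP => i.
  rewrite !mxE addrAC subrr add0r normrM.
  case: (_ < _)%N; first by rewrite normr1 mul1r; exact: coord_le_norm.
  by rewrite normr0 mul0r.
have z0 : z 0%N = x by apply/rowP => i; rewrite mxE mul0r addr0.
have zn : z n = y.
  by apply/rowP => i; rewrite mxE ltn_ord mul1r hE !mxE addrCA subrr addr0.
have zS (k : 'I_n) : z k.+1 = z k + h 0 k *: delta_mx 0 k.
  apply/rowP => i; rewrite !mxE eqxx ltnS leq_eqVlt /=.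
  by rewrite -val_eqE /=; case: ltngtP => //= ik;
    rewrite ?mulr0 ?mul0r ?mul1r ?addr0// ?mulr1 ?(ord_inj ik).
have step (k : 'I_n) : `|f (z k.+1) - f (z k) - h 0 k * 'D_(delta_mx 0 k) f x|
    <= e / n.+1%:R * `|h|.
  have near t : `|t| <= `|h 0 k| -> `|z k + t *: delta_mx 0 k - x| <= `|h|.
    move=> th; rewrite norm_le_coord//; apply/forallP => i.
    rewrite !mxE eqxx/=; have [->|ik] := eqVneq i k.
      rewrite ltnn mul0r addr0 mulr1 addrAC subrr add0r (le_trans th)//.
      exact: coord_le_norm.
    rewrite mulr0 addr0 addrAC subrr add0r normrM.
    case: (_ < _)%N; first by rewrite normr1 mul1r; exact: coord_le_norm.
    by rewrite normr0 mul0r.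
  have [|c ch E] := @mvt_signed (fun t => f (z k + t *: delta_mx 0 k))
    (fun t => 'D_(delta_mx 0 k) f (z k + t *: delta_mx 0 k)) (h 0 k).
    move=> t /near tn; apply: is_derive_line; apply: (fC k).1.
    by apply: (hd _ _).1; apply: le_lt_trans tn yx.
  move: E; rewrite scale0r addr0 -zS => ->.
  rewrite mulrC -mulrBr normrM mulrC ler_pM ?coord_le_norm//.
  by apply: (hd _ _).2; exact: le_lt_trans (near _ ch) yx.
have -> : (f y)%:M - (f x)%:M - h *m \col_i 'D_(delta_mx 0 i) f x =
    (\sum_(k < n) (f (z k.+1) - f (z k) - h 0 k * 'D_(delta_mx 0 k) f x))%:M
    :> 'rV[R]_1.
  apply/matrixP => i j; rewrite !ord1 !mxE eqxx !mulr1n sumrB; congr (_ - _).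
    rewrite -(big_mkord xpredT (fun k => f (z k.+1) - f (z k))).
    by rewrite telescope_sumr// zn z0.
  by apply: eq_bigr => k _; rewrite !mxE.
rewrite norm_le_coord ?mulr_ge0 ?(ltW e0)//; apply/forallP => j.
rewrite ord1 mxE eqxx mulr1n (le_trans (ler_norm_sum _ _ _))//.
rewrite (le_trans (ler_sum _ (fun k _ => step k)))//.
rewrite sumr_const card_ord -[_ *+ n]mulr_natr mulrAC ler_wpM2r//.
by rewrite mulrAC ler_pdivrMr// ler_pM2l// ler_nat.
Qed.

Definition gradient f (x : 'rV[R]_n) : 'rV[R]_n :=
  \row_i 'D_(delta_mx 0 i) f x.

Definition hessian f (x : 'rV[R]_n) : 'M[R]_n :=
  \matrix_(i, j) 'D_(delta_mx 0 i) ('D_(delta_mx 0 j) f) x.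

Lemma gradient_diff U f x : open U -> U x -> C2_on U f ->
  diff_along setT (gradient f) x (hessian f x).
Proof.
move=> oU Ux [_ fC] e e0.
have : \forall y \near within setT (nbhs x), forall j,
  `|('D_(delta_mx 0 j) f y)%:M - ('D_(delta_mx 0 j) f x)%:M -
    (y - x) *m (\col_i 'D_(delta_mx 0 i) ('D_(delta_mx 0 j) f) x) : 'rV[R]_1|
  <= e * `|y - x|.
  apply: filter_forall => j; exact: (C1_frechet oU Ux (fC j)).
apply: filterS => y hy.
rewrite norm_le_coord ?mulr_ge0 ?(ltW e0)//; apply/forallP => j.
apply: le_trans (hy j); apply: le_trans (coord_le_norm _ 0).
rewrite !mxE eqxx !mulr1n; rewrite le_eqVlt; apply/orP; left; apply/eqP.
by congr (`|_ - _|); apply: eq_bigr => i _; rewrite !mxE.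
Qed.

End c1_frechet.

(** * The boundary of a body through its polar points *)

Section polar_map.
Context {R : realType} {n : nat}.
Implicit Types (x y v u : 'rV[R]_n).

(** phi x = N(x) / <x, N(x)> is the point of the boundary of the polar body dual
    to x; it carries the normal, of direction phi x, and the support function,
    whose value is the inverse of |phi x|. *)
Record polar_map (L : set 'rV[R]_n) (phi : 'rV[R]_n -> 'rV[R]_n) : Prop := {
  polar_map_in : forall x, boundary L x -> polar L (phi x) ;
  polar_map1 : forall x, boundary L x -> dot (phi x) x = 1 ;
  polar_map_cvg : forall x, boundary L x ->
    phi @ within (boundary L) (nbhs x) --> phi x }.

Variables (L : set 'rV[R]_n) (phi : 'rV[R]_n -> 'rV[R]_n).
Hypotheses (bL : body0 L) (pL : polar_map L phi).

Lemma polar_map_le x y : boundary L x -> L y -> dot (phi x) y <= 1.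
Proof. by move=> /(polar_map_in pL); exact. Qed.

Lemma polar_map_neq0 x : boundary L x -> phi x != 0.
Proof.
move=> /(polar_map1 pL); apply: contra_eq_neq => ->.
by rewrite dot0l eq_sym oner_eq0.
Qed.

(** Push x + t v radially to the boundary. As phi x and the polar point of the
    resulting point both take values at most 1 on L, the dilation factor l
    satisfies 0 <= l - 1 <= t <phi y - phi x, v>, which is o(t). *)
Lemma tangent_curve x v (e : R) : boundary L x -> dot (phi x) v = 0 -> 0 < e ->
  exists2 t0 : R, 0 < t0 & forall t, 0 < t < t0 ->
    exists2 y, boundary L y & `|y - x - t *: v| <= e * t.
Proof.
move=> Lx xv e0; have [cL _ _] := bL.
have [M M0 hM] := compact_norm_bound cL; have [C C0 hC] := polar_bounded bL.
pose c : R := n.+1%:R * (`|v| + 1) * M.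
have v1 : 0 < `|v| + 1 by rewrite ltr_wpDl.
have c0 : 0 < c by rewrite !mulr_gt0.
have nc : n%:R * `|v| * M <= c.
  by rewrite ler_wpM2r ?(ltW M0)// ler_pM// ?ler_nat// lerDl.
have /cvgrPdist_le/(_ _ (divr_gt0 e0 c0)) := polar_map_cvg pL Lx.
move=> /near_alongP[d d0 hd].
pose c' : R := (`|v| + 1) + c * (C + C).
have c'0 : 0 < c' by rewrite addr_gt0// mulr_gt0// addr_gt0.
exists (d / c') => [|t /andP[t0 td]]; first exact: divr_gt0.
have xz : dot (phi x) (x + t *: v) = 1.
  by rewrite dotDr (polar_map1 pL Lx) dotZr xv mulr0 addr0.
have z0 : x + t *: v != 0.
  by apply: contra_eq_neq xz => ->; rewrite dot0r eq_sym oner_eq0.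
have [l l0 Ly] := ray_boundary bL z0.
set y := l^-1 *: _ in Ly.
have zy : x + t *: v = l *: y by rewrite scalerA divff ?lt0r_neq0// scale1r.
have yM : `|y| <= M by apply: hM; exact: (boundary_sub bL Ly).
have l1 : 1 <= l.
  rewrite -xz zy dotZr -[leRHS]mulr1 ler_wpM2l ?(ltW l0)//.
  by apply: polar_map_le => //; exact: (boundary_sub bL Ly).
have lt1 : l - 1 <= t * dot (phi y - phi x) v.
  have : dot (phi y) (l *: y) <= 1 + t * dot (phi y) v.
    rewrite -zy dotDr dotZr lerD2r; apply: polar_map_le => //.
    exact: (boundary_sub bL Lx).
  by rewrite dotZr (polar_map1 pL Ly) mulr1 dotBl xv subr0 lerBlDl.
have yx : y - x - t *: v = (1 - l) *: y.
  by rewrite -addrA -opprD zy scalerBl scale1r.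
have nyx : `|y - x - t *: v| <= t * (c * `|phi y - phi x|).
  rewrite yx normrZ distrC ger0_norm ?subr_ge0//.
  apply: (@le_trans _ _ (t * (n%:R * `|phi y - phi x| * `|v|) * M)).
    rewrite ler_pM ?subr_ge0// (le_trans lt1)// ler_wpM2l ?(ltW t0)//.
    by rewrite (le_trans (ler_norm _))// normr_dot.
  rewrite -mulrA ler_wpM2l ?(ltW t0)//.
  rewrite (_ : _ * M = n%:R * `|v| * M * `|phi y - phi x|); last by ring.
  by rewrite ler_wpM2r.
exists y => //; apply: (le_trans nyx).
rewrite mulrC ler_wpM2r ?(ltW t0)// -ler_pdivlMl// mulrC distrC.
apply: hd => //.
have -> : y - x = (y - x - t *: v) + t *: v by rewrite subrK.
rewrite (le_lt_trans (ler_normD _ _))// (le_lt_trans (lerD nyx (lexx _)))//.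
rewrite normrZ gtr0_norm// -mulrDr.
apply: (@le_lt_trans _ _ (t * c')); last by rewrite -ltr_pdivlMr.
rewrite ler_wpM2l ?(ltW t0)// addrC lerD ?lerDl// ler_wpM2l ?(ltW c0)//.
by rewrite (le_trans (ler_normB _ _))// lerD ?hC//; exact: polar_map_in.
Qed.

(** A derivative along the boundary is determined on tangent vectors, since all
    of them are velocities of boundary points. *)
Lemma diff_along_unique m (f : 'rV[R]_n -> 'rV[R]_m) x A B v :
  boundary L x -> diff_along (boundary L) f x A ->
  diff_along (boundary L) f x B -> dot (phi x) v = 0 -> v *m A = v *m B.
Proof.
move=> Lx fA fB xv; apply/eqP; rewrite -subr_eq0 -mulmxBr -normr_eq0.
have [//|e0] := eqVneq `|v *m (A - B)| 0.
have {}e0 : 0 < `|v *m (A - B)| by rewrite lt_def e0 normr_ge0.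
set e := `|_| in e0 *; exfalso.
have [c c0 hc] := mulmx_norm (A - B).
pose k := 2 * (`|v| + 1) + c.
have v1 : 0 < `|v| + 1 by rewrite ltr_wpDl.
have k0 : 0 < k by rewrite addr_gt0// mulr_gt0.
pose eta := Num.min 1 (e / (2 * k)).
have eta0 : 0 < eta by rewrite lt_min ltr01 divr_gt0// mulr_gt0.
have eta1 : eta <= 1 by rewrite ge_min lexx.
have etak : eta * k <= e / 2.
  by rewrite -ler_pdivlMr// -mulrA -invfM ge_min lexx orbT.
have [t0 t00 ht] := tangent_curve Lx xv eta0.
have [d d0 hd] :=
  (near_alongP _ _ _).1 (filterI (fA _ eta0) (fB _ eta0)).
pose t := Num.min (t0 / 2) (d / (2 * (`|v| + 1))).
have tp : 0 < t by rewrite lt_min !divr_gt0// mulr_gt0.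
have tt0 : t < t0.
  rewrite (@le_lt_trans _ _ (t0 / 2)) ?ge_min ?lexx//.
  by rewrite ltr_pdivrMr// ltr_pMr// ltr1n.
have td : t * (`|v| + 1) <= d / 2.
  by rewrite -ler_pdivlMr// -mulrA -invfM ge_min lexx orbT.
have [|y Ly hy] := ht t; first by rewrite tp.
have yx : `|y - x| <= t * (`|v| + 1).
  have -> : y - x = (y - x - t *: v) + t *: v by rewrite subrK.
  rewrite (le_trans (ler_normD _ _))// addrC mulrDr mulr1 lerD//.
    by rewrite normrZ gtr0_norm.
  by rewrite (le_trans hy)// ler_piMl// ltW.
have [|fAy fBy] := hd y Ly.
  by rewrite (le_lt_trans yx)// (le_lt_trans td)// ltr_pdivrMr// ltr_pMr// ltr1n.
have : t * e <= 2 * (eta * `|y - x|) + c * (eta * t).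
  rewrite /e -{1}(gtr0_norm tp) -normrZ scalemxAl.
  have -> : (t *: v) *m (A - B) =
     ((f y - f x - (y - x) *m B) - (f y - f x - (y - x) *m A)) -
     (y - x - t *: v) *m (A - B).
    rewrite [X in _ = _ - X]mulmxBl [X in _ = _ - (X - _)]mulmxBr.
    move: ((y - x) *m A) ((y - x) *m B) ((t *: v) *m (A - B)) => a b w.
    by apply/rowP => i; rewrite !mxE; ring.
  rewrite (le_trans (ler_normB _ _))// lerD//.
    rewrite (le_trans (ler_normB _ _))//.
    by rewrite mulr_natl mulr2n lerD.
  by rewrite (le_trans (hc _))// ler_wpM2l// ltW.
apply/negP; rewrite -ltNge.
apply: (@le_lt_trans _ _ (t * (eta * k))).
  rewrite /k mulrDr mulrDr lerD//; last first.
    by rewrite (_ : c * (eta * t) = t * (eta * c))//; ring.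
  rewrite [leRHS](_ : _ = 2 * (eta * (t * (`|v| + 1)))); last by ring.
  by rewrite ler_wpM2l// ler_wpM2l// ltW.
by rewrite ltr_pM2l// (le_lt_trans etak)// ltr_pdivrMr// ltr_pMr// ltr1n.
Qed.

(** A normal u at x satisfies <u, v> <= 0 for every v orthogonal to phi x, all of
    them being velocities of boundary points; as v and -v both qualify, u is a
    multiple of phi x. *)
Lemma outer_unit_normalsE x : boundary L x ->
  outer_unit_normals L x = [set (enorm (phi x))^-1 *: phi x].
Proof.
move=> Lx; have px := polar_map_neq0 Lx; have nx := enorm_gt0 px.
apply/seteqP; split=> u /=; last first.
  move=> ->; split=> [|y Ly].
    by rewrite enormZ gtr0_norm ?invr_gt0// mulVf ?lt0r_neq0.
  rewrite dotZl pmulr_rle0 ?invr_gt0// dotBr (polar_map1 pL Lx) subr_le0.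
  exact: polar_map_le.
move=> [u1 hu].
have [cL _ _] := bL.
have tan v : dot (phi x) v = 0 -> dot u v <= 0.
  move=> xv; apply/ler_addgt0Pr => e e0; rewrite add0r.
  pose c : R := n.+1%:R * (`|u| + 1).
  have c0 : 0 < c by rewrite mulr_gt0// ltr_wpDl.
  have [t0 t00 ht] := tangent_curve Lx xv (divr_gt0 e0 c0).
  have tp : 0 < t0 / 2 by rewrite divr_gt0.
  have [|y Ly hy] := ht (t0 / 2).
    by rewrite tp ltr_pdivrMr// ltr_pMr// ltr1n.
  rewrite -(ler_pM2l tp) -dotZr.
  have -> : (t0 / 2) *: v = (y - x) - (y - x - (t0 / 2) *: v).
    by rewrite opprB addrC subrK.
  rewrite dotBr -[leRHS]add0r lerD//.
    by apply: hu; exact: (boundary_sub bL Ly).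
  rewrite (le_trans (ler_norm _))// normrN (le_trans (normr_dot _ _))//.
  apply: (@le_trans _ _ (c * (e / c * (t0 / 2)))).
    by rewrite ler_pM// ?mulr_ge0// ler_pM// ?ler_nat// lerDl.
  by rewrite (_ : _ * (_ * _) = t0 / 2 * e)//; field; rewrite lt0r_neq0.
pose v := u - (dot u (phi x) / dot (phi x) (phi x)) *: phi x.
have pp := dot_gt0 px.
have xv : dot (phi x) v = 0.
  by rewrite dotBr dotZr divfK ?lt0r_neq0// dotC subrr.
have v0 : v = 0.
  apply/eqP; rewrite -dot_eq0 eq_le dot_ge0 andbT.
  by rewrite {1}/v dotBl dotZl xv mulr0 subr0 tan.
have {v0} uE : u = (dot u (phi x) / dot (phi x) (phi x)) *: phi x.
  by apply/eqP; rewrite -subr_eq0 -/v v0.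
move: uE; set a := _ / _ => uE.
have a0 : 0 <= a.
  have : dot u (0 - x) <= 0 by case: bL => _ _ /interior_subset; exact: hu.
  by rewrite sub0r dotNr uE dotZl (polar_map1 pL Lx) mulr1 oppr_le0.
rewrite uE; congr (_ *: _); move: u1; rewrite uE enormZ ger0_norm// => h.
by apply: (mulIf (lt0r_neq0 nx)); rewrite h mulVf ?lt0r_neq0.
Qed.

Lemma outer_normalE x : boundary L x ->
  outer_normal L x = (enorm (phi x))^-1 *: phi x.
Proof.
move=> Lx; apply: (@xget_unique _ 0 (outer_unit_normals L x)).
  by rewrite outer_unit_normalsE.
by move=> u; rewrite outer_unit_normalsE.
Qed.

Lemma support_atE x : boundary L x -> support_at L x = (enorm (phi x))^-1.
Proof.
move=> Lx; rewrite /support_at outer_normalE// dotZr dotC.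
by rewrite (polar_map1 pL Lx) mulr1.
Qed.

End polar_map.

(** * Symmetric matrices: eigenbases and elementary symmetric functions *)

Section spectral.
Context {R : realType} {n : nat}.
Variables (S : 'M[R]_n) (N : 'rV[R]_n).
Hypothesis S_sym : S^T = S.

Lemma sym_dot v w : dot (v *m S) w = dot v (w *m S).
Proof. by rewrite dot_mulmxr S_sym. Qed.

Hypothesis NS : N *m S = 0.

Let orthonormal_eigen r (e : nat -> 'rV[R]_n) (k : nat -> R) : Prop :=
  (forall i, (i < r)%N -> dot (e i) N = 0 /\ e i *m S = k i *: e i) /\
  (forall i j, (i < r)%N -> (j < r)%N -> dot (e i) (e j) = (i == j)%:R).

(** The next eigenvector maximizes the Rayleigh quotient on the unit vectors
    orthogonal to N and to the eigenvectors already found; this orthogonal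
    complement is invariant because S is symmetric. *)
Lemma rayleigh_step r e k : (r.+1 < n)%N -> orthonormal_eigen r e k ->
  exists e' k', orthonormal_eigen r.+1 e' k'.
Proof.
move=> rn [he ho].
pose P v := dot N v = 0 /\ forall i, (i < r)%N -> dot (e i) v = 0.
have PD v w : P v -> P w -> P (v + w).
  by move=> [v1 v2] [w1 w2]; split=> [|i ir]; rewrite dotDr ?v1 ?w1 ?v2 ?w2 ?addr0.
have PZ a v : P v -> P (a *: v).
  by move=> [v1 v2]; split=> [|i ir]; rewrite dotZr ?v1 ?v2 ?mulr0.
have PS v : P v -> P (v *m S).
  move=> [v1 v2]; split=> [|i ir]; first by rewrite -sym_dot NS dot0l.
  by rewrite -sym_dot (he i ir).2 dotZl v2 ?mulr0.
pose X : set 'rV[R]_n := [set v | dot v v = 1] `&` ([set v | dot N v = 0] `&`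
  \bigcap_(i in [set i | (i < r)%N]) [set v | dot (e i) v = 0]).
have XP v : X v <-> dot v v = 1 /\ P v.
  by split=> [[v1 [v2 v3]]|[v1 [v2 v3]]].
have X0 : X !=set0.
  pose B := \matrix_(i < n, j < r.+1) (if (j < r)%N then e j else N) 0 i.
  have kB : kermx B != 0.
    rewrite -mxrank_eq0 mxrank_ker subn_eq0 -ltnNge.
    by rewrite (leq_ltn_trans (rank_leq_col _)).
  pose v := nz_row (kermx B).
  have v0 : v != 0 by rewrite nz_row_eq0.
  have vB : v *m B = 0 by apply/sub_kermxP; exact: nz_row_sub.
  have vj (j : 'I_r.+1) : dot (if (j < r)%N then e j else N) v = 0.
    have := congr1 (fun M : 'rV_r.+1 => M 0 j) vB; rewrite !mxE => <-.
    by rewrite dotC; apply: eq_bigr => i _; rewrite !mxE.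
  have Pv : P v.
    split=> [|i ir]; first by have := vj ord_max; rewrite /= ltnn.
    by have := vj (Ordinal (ltnW ir : (i < r.+1)%N)); rewrite /= ir.
  exists ((enorm v)^-1 *: v); apply/XP; split; last exact: PZ.
  rewrite dotZl dotZr -sqr_enorm mulrA -expr2 -exprMn mulVf ?expr1n//.
  by rewrite enorm_eq0.
have cX : compact X.
  apply: bounded_closed_compact.
    apply/bounded_normP; exists 1 => // v /XP[v1 _].
    by rewrite (le_trans (norm_le_enorm v))// /enorm v1 sqrtr1.
  have cl u : closed [set v : 'rV[R]_n | dot u v = 0].
    apply: (@preimage_closed _ _ (dot u) [set 0]); last exact: closed_eq.
    by move=> v _; exact: dot_continuous.
  apply: closedI; last by apply: closedI => //; apply: closed_bigI => i _.
  apply: (@preimage_closed _ _ (fun v : 'rV[R]_n => dot v v) [set 1]).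
    by move=> v _; apply: (@cvg_dot R _ (nbhs v) _ n id id); exact: cvg_id.
  exact: closed_eq.
have [|v /[!inE] /XP[v1 Pv] hv] :=
    @compact_EVT_max _ R (fun v : 'rV[R]_n => dot (v *m S) v) X X0 cX.
  apply/subspace_continuousP => v _; apply: cvg_dot; last exact: cvg_within.
  by apply: cvg_mulmx; [exact: cvg_within|exact: cvg_cst].
set l := dot (v *m S) v in hv.
have hl w : P w -> dot (w *m S) w <= l * dot w w.
  move=> Pw; have [->|w0] := eqVneq w 0; first by rewrite !dot0r mulr0.
  have nw := enorm_gt0 w0.
  have /hv : (enorm w)^-1 *: w \in X.
    rewrite inE; apply/XP; split; last exact: PZ.
    rewrite dotZl dotZr -sqr_enorm mulrA -expr2 -exprMn mulVf ?expr1n//.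
    exact: lt0r_neq0.
  rewrite -scalemxAl dotZl dotZr mulrA -expr2 exprVn ler_pdivrMl ?exprn_gt0//.
  by rewrite sqr_enorm mulrC.
have orth u : P u -> dot (v *m S - l *: v) u = 0.
  move=> Pu; rewrite dotBl dotZl.
  set a := dot (v *m S) u - l * dot v u.
  have ht (t : R) : 2 * t * a + t ^+ 2 * (dot (u *m S) u - l * dot u u) <= 0.
    have := hl _ (PD _ _ Pv (PZ t _ Pu)).
    rewrite mulmxDl -scalemxAl !dotDl !dotDr !dotZl !dotZr -/l v1.
    rewrite (sym_dot u v) (dotC u (v *m S)) (dotC u v) /a.
    move: (dot (v *m S) u) (dot v u) (dot (u *m S) u) (dot u u) => p q s z h.
    rewrite [leLHS](_ : _ = (l + t * p + (t * p + t * (t * s))) -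
      l * (1 + t * q + (t * q + t * (t * z)))); first by rewrite subr_le0.
    by ring.
  set b := dot (u *m S) u - l * dot u u in ht.
  apply/eqP/negPn/negP => a0.
  have aa : 0 < a ^+ 2 by rewrite exprn_even_gt0.
  pose c := 1 + `|b|.
  have c0 : 0 < c by rewrite ltr_wpDr.
  have := ht (a / c); rewrite leNgt => /negP; apply.
  have -> : 2 * (a / c) * a + (a / c) ^+ 2 * b = a ^+ 2 / c ^+ 2 * (2 * c + b).
    by field; rewrite lt0r_neq0.
  rewrite (mulr_gt0 (divr_gt0 aa _)) ?exprn_gt0// /c.
  have := ler_norm (- b); have := normr_ge0 b; rewrite normrN.
  by move: `|b| => z z0 bz; lra.
have eig : v *m S = l *: v.
  apply/eqP; rewrite -subr_eq0 -dot_eq0 orth//.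
  by apply: PD; [exact: PS|rewrite -scaleNr; exact: PZ].
exists (fun i => if i == r then v else e i), (fun i => if i == r then l else k i).
split=> [i|i j]; rewrite ltnS leq_eqVlt.
  by case: eqP => [_ _|_ /= ir]; [rewrite dotC Pv.1|exact: he].
move=> ir; rewrite ltnS leq_eqVlt => jr; move: ir jr.
case: eqP => [->|ir]; case: eqP => [->|jr] //=; rewrite ?eqxx// => hi hj.
- by rewrite dotC Pv.2// gtn_eqF.
- by rewrite Pv.2// ltn_eqF.
- exact: ho.
Qed.

Lemma symmetric_eigenbasis : exists (e : 'I_n.-1 -> 'rV[R]_n) (k : 'rV[R]_n.-1),
  [/\ forall i j, dot (e i) (e j) = (i == j)%:R,
      forall i, dot (e i) N = 0 & forall i, e i *m S = k 0 i *: e i].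
Proof.
have H r : (r <= n.-1)%N -> exists e k, orthonormal_eigen r e k.
  elim: r => [_|r IH rn]; first by exists (fun=> 0), (fun=> 0).
  have [e [k hek]] := IH (ltnW rn).
  by apply: rayleigh_step hek; move: rn; case: (n).
have [e [k [he ho]]] := H _ (leqnn _).
exists (fun i => e i), (\row_i k i); split=> [i j|i|i].
- by rewrite ho.
- by rewrite (he i (ltn_ord i)).1.
- by rewrite (he i (ltn_ord i)).2 mxE.
Qed.

End spectral.

Section elementary_symmetric.
Context {R : realType}.

(** det(1 + X S): its coefficients are the elementary symmetric functions of the
    eigenvalues of S. *)
Definition det_poly n (S : 'M[R]_n) : {poly R} :=
  \det (1%:M + 'X *: map_mx polyC S).

Lemma coef_prod_1MX n (k : 'I_n -> R) j :
  (\prod_i (1 + (k i) *: 'X) : {poly R})`_j =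
  \sum_(A : {set 'I_n} | #|A| == j) \prod_(l in A) k l.
Proof.
under eq_bigr do rewrite addrC.
rewrite bigA_distr coef_sum [RHS]big_mkcond /=; apply: eq_bigr => A _.
rewrite -big_mkcond /= scaler_prod prodr_const coefZ coefXn.
by rewrite eq_sym; case: eqP => _; rewrite ?mulr1 ?mulr0.
Qed.

Lemma frame_orthogonal n (N : 'rV[R]_n.+1) (e : 'I_n -> 'rV[R]_n.+1) :
  dot N N = 1 -> (forall i j, dot (e i) (e j) = (i == j)%:R) ->
  (forall i, dot (e i) N = 0) ->
  (col_mx N (\matrix_i e i) : 'M[R]_(1 + n)) *m (col_mx N (\matrix_i e i))^T = 1%:M.
Proof.
move=> N1 ho hN.
rewrite tr_col_mx mul_col_row dot_mulmxE N1 [RHS]scalar_mx_block.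
congr block_mx.
- apply/matrixP => i j; rewrite !mxE ord1; under eq_bigr do rewrite !mxE.
  by have := hN j; rewrite dotC.
- apply/matrixP => i j; rewrite !mxE ord1; under eq_bigr do rewrite !mxE.
  exact: hN.
- apply/matrixP => i j; rewrite !mxE; under eq_bigr do rewrite !mxE.
  exact: ho.
Qed.

Lemma frame_expand n (N : 'rV[R]_n) (e : 'I_n.-1 -> 'rV[R]_n) w :
  dot N N = 1 -> (forall i j, dot (e i) (e j) = (i == j)%:R) ->
  (forall i, dot (e i) N = 0) -> dot N w = 0 ->
  w = \sum_i dot w (e i) *: e i.
Proof.
case: n N e w => [|n] N e w N1 ho hN wN.
  by move: N1; rewrite /dot big_ord0 => /eqP; rewrite eq_sym oner_eq0.
have := frame_orthogonal N1 ho hN => /mulmx1C.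
rewrite tr_col_mx mul_row_col => /(congr1 (mulmx w)).
rewrite mulmx1 mulmxDr mulmx_rank1 dotC wN scale0r add0r => {1}<-.
rewrite mulmxA mulmx_sum_row; apply: eq_bigr => i _.
rewrite rowK; congr (_ *: _); rewrite mxE.
by apply: eq_bigr => j _; rewrite !mxE.
Qed.

(** In the orthonormal frame N, e_1, ..., S is diagonal, with eigenvalue 0 on N. *)
Lemma det_poly_eigen n (S : 'M[R]_n.+1) (N : 'rV[R]_n.+1)
    (e : 'I_n -> 'rV[R]_n.+1) (k : 'I_n -> R) :
  dot N N = 1 -> N *m S = 0 ->
  (forall i j, dot (e i) (e j) = (i == j)%:R) ->
  (forall i, dot (e i) N = 0) -> (forall i, e i *m S = k i *: e i) ->
  det_poly S = \prod_i (1 + (k i) *: 'X).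
Proof.
move=> N1 NS ho hN hS.
pose Q : 'M[R]_(1 + n) := col_mx N (\matrix_i e i).
pose d : 'rV[R]_(1 + n) := row_mx 0 (\row_i k i).
have QQ : Q *m Q^T = 1%:M by exact: frame_orthogonal.
have QS : Q *m S = diag_mx d *m Q.
  rewrite mul_col_mx NS diag_mx_row mul_block_col !mul0mx !addr0 !add0r.
  rewrite raddf0 mul0mx; congr col_mx; apply/row_matrixP => i.
  rewrite row_mul rowK hS; apply/rowP => j.
  by rewrite mul_diag_mx !mxE.
pose Qp := map_mx polyC Q.
have dQ : \det Qp != 0.
  rewrite det_map_mx polyC_eq0; have /mulmx1_unit[+ _] := QQ.
  by rewrite unitmxE unitfE.
pose dp : 'rV[{poly R}]_(1 + n) := \row_i (1 + d 0 i *: 'X).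
have E : Qp *m (1%:M + 'X *: map_mx polyC S) = diag_mx dp *m Qp.
  rewrite mulmxDr mulmx1 -scalemxAr -map_mxM QS map_mxM.
  have -> : diag_mx dp = 1%:M + 'X *: map_mx polyC (diag_mx d).
    apply/matrixP => i j; rewrite !mxE; case: eqP => [->|_] /=.
      by rewrite !mulr1n -mul_polyC commr_polyX.
    by rewrite !mulr0n polyC0 mulr0 addr0.
  by rewrite mulmxDl mul1mx -scalemxAl.
apply: (mulfI dQ); rewrite /det_poly -det_mulmx E det_mulmx mulrC det_diag.
congr (_ * _); rewrite big_split_ord /= big_ord1 mxE {1}/d row_mxEl mxE.
rewrite scale0r addr0 mul1r.
by apply: eq_bigr => i _; rewrite mxE /d row_mxEr mxE.
Qed.

Section continuity.
Context {T : Type} (F : set_system T) {FF : Filter F}.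

Let pcvg (f : T -> {poly R}) (p : {poly R}) :=
  forall j, (fun t => (f t)`_j) @ F --> p`_j.

Let pcvg_cst p : pcvg (fun=> p) p. Proof. by move=> j; exact: cvg_cst. Qed.

Let pcvgD f g p q : pcvg f p -> pcvg g q -> pcvg (fun t => f t + g t) (p + q).
Proof.
move=> fp gq j; rewrite coefD; under eq_fun do rewrite coefD.
by apply: cvgD; [exact: fp|exact: gq].
Qed.

Let pcvgM f g p q : pcvg f p -> pcvg g q -> pcvg (fun t => f t * g t) (p * q).
Proof.
move=> fp gq j; rewrite coefM; under eq_fun do rewrite coefM.
by apply: cvg_bigsum => i _; apply: cvgM; [exact: fp|exact: gq].
Qed.

Lemma cvg_coef_det_poly n (S : T -> 'M[R]_n) (A : 'M[R]_n) j :
  S @ F --> A -> (fun t => (det_poly (S t))`_j) @ F --> (det_poly A)`_j.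
Proof.
move=> /cvg_mxP SA; move: j; rewrite -/(pcvg _ _) /det_poly /determinant.
have e i k : pcvg (fun t => (1%:M + 'X *: map_mx polyC (S t)) i k)
    ((1%:M + 'X *: map_mx polyC A) i k).
  have -> : (fun t => (1%:M + 'X *: map_mx polyC (S t)) i k) =
      (fun t => (1%:M : 'M[{poly R}]_n) i k + 'X * (S t i k)%:P).
    by apply/funext => t; rewrite !mxE.
  have -> : (1%:M + 'X *: map_mx polyC A) i k =
      (1%:M : 'M[{poly R}]_n) i k + 'X * (A i k)%:P by rewrite !mxE.
  apply: pcvgD; first exact: pcvg_cst.
  apply: pcvgM; first exact: pcvg_cst.
  move=> j; rewrite coefC; under eq_fun do rewrite coefC.
  by case: ifP => _; [exact: SA|exact: cvg_cst].
have sumP (I : finType) (f : I -> T -> {poly R}) p : (forall i, pcvg (f i) (p i)) ->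
    pcvg (fun t => \sum_i f i t) (\sum_i p i).
  move=> h; elim: (index_enum I) => [|i r IH].
    by rewrite big_nil; under eq_fun do rewrite big_nil; exact: pcvg_cst.
  by rewrite big_cons; under eq_fun do rewrite big_cons; exact: pcvgD.
have prodP (I : finType) (f : I -> T -> {poly R}) p : (forall i, pcvg (f i) (p i)) ->
    pcvg (fun t => \prod_i f i t) (\prod_i p i).
  move=> h; elim: (index_enum I) => [|i r IH].
    by rewrite big_nil; under eq_fun do rewrite big_nil; exact: pcvg_cst.
  by rewrite big_cons; under eq_fun do rewrite big_cons; exact: pcvgM.
apply: sumP => s; apply: pcvgM; first exact: pcvg_cst.
exact: prodP.
Qed.

End continuity.

End elementary_symmetric.

(** * Bodies with a nondegenerate dual map *)

Section dual_map_def.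
Context {R : realType} {n : nat}.

(** D x is the Hessian at x of half the squared gauge of L, whose gradient extends
    the polar map phi to a map homogeneous of degree 1: on tangent vectors D x is
    the derivative of phi along the boundary, and x D x = phi x. Symmetry and
    positivity of D x are those of the second fundamental form. In this form the
    passage to the polar body consists in inverting phi and D. *)
Record dual_map (L : set 'rV[R]_n) (phi : 'rV[R]_n -> 'rV[R]_n)
    (D : 'rV[R]_n -> 'M[R]_n) : Prop := {
  dual_map_polar : polar_map L phi ;
  dual_map_sym : forall x, boundary L x -> (D x)^T = D x ;
  dual_map_pos : forall x v, boundary L x -> v != 0 -> 0 < dot (v *m D x) v ;
  dual_map_hom : forall x, boundary L x -> x *m D x = phi x ;
  dual_map_diff : forall x, boundary L x -> diff_along (boundary L) phi x (D x) ;
  dual_map_cvg : forall x, boundary L x ->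
    D @ within (boundary L) (nbhs x) --> D x }.

End dual_map_def.

Section polar_duality.
Context {R : realType} {n : nat}.
Variables (L : set 'rV[R]_n) (phi : 'rV[R]_n -> 'rV[R]_n).
Variable D : 'rV[R]_n -> 'M[R]_n.
Hypotheses (bL : body0 L) (dL : dual_map L phi D).
Implicit Types (x y z : 'rV[R]_n).

Let pL := dual_map_polar dL.

Lemma dual_map_unit x : boundary L x -> D x \in unitmx.
Proof.
move=> Lx; rewrite -row_free_unit -kermx_eq0; apply/negPn/negP => k0.
have v0 : nz_row (kermx (D x)) != 0 by rewrite nz_row_eq0.
have := dual_map_pos dL Lx v0.
have /sub_kermxP -> := nz_row_sub (kermx (D x)).
by rewrite dot0l ltxx.
Qed.

Lemma boundary_dot1 z p : L z -> polar L p -> dot p z = 1 -> boundary L z.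
Proof.
move=> Lz Lp pz; apply/(body0P _ bL); split=> // /interior_distP[d d0 hd].
have z0 : z != 0 by apply: contra_eq_neq pz => ->; rewrite dot0r eq_sym oner_eq0.
have nz : 0 < `|z| by rewrite normr_gt0.
have : L ((1 + d / 2 / `|z|) *: z).
  apply: hd; rewrite scalerDl scale1r addrAC subrr add0r normrZ.
  rewrite gtr0_norm ?divr_gt0// divfK ?lt0r_neq0//.
  by rewrite ltr_pdivrMr// ltr_pMr// ltr1n.
move=> /Lp; rewrite dotZr pz mulr1 gerDl leNgt divr_gt0//.
by rewrite divr_gt0.
Qed.

(** The normalization of such a p is an outer unit normal at z, and there is only
    one. *)
Lemma dual_point_unique z p : boundary L z -> polar L p -> dot p z = 1 -> p = phi z.
Proof.
move=> Lz Lp pz.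
have p0 : p != 0 by apply: contra_eq_neq pz => ->; rewrite dot0l eq_sym oner_eq0.
have np := enorm_gt0 p0.
have : outer_unit_normals L z ((enorm p)^-1 *: p).
  split=> [|y Ly]; first by rewrite enormZ gtr0_norm ?invr_gt0// mulVf ?lt0r_neq0.
  by rewrite dotZl pmulr_rle0 ?invr_gt0// dotBr pz subr_le0 Lp.
rewrite (outer_unit_normalsE bL pL Lz) /= => E.
have Ep : (enorm p)^-1 = (enorm (phi z))^-1.
  have := congr1 (fun u => dot u z) E.
  by rewrite /= !dotZl pz (polar_map1 pL Lz) !mulr1.
move: E; rewrite Ep => /(congr1 (fun u => enorm (phi z) *: u)).
by rewrite /= !scalerA mulfV ?scale1r// enorm_eq0 (polar_map_neq0 pL Lz).
Qed.

(** A boundary point y of the polar body attains its maximum over L at the point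
    x with phi x = y; a maximum below 1 would put y in the interior. *)
Lemma dual_map_surj y : boundary (polar L) y -> exists2 x, boundary L x & phi x = y.
Proof.
move=> Py; have bP := polar_body0 bL; have [Ly nLy] := (body0P _ bP).1 Py.
have [cL _ _] := bL.
have L0 : L !=set0 by exists 0; case: bL => _ _ /interior_subset.
have y0 := boundary_neq0 bP Py; have ny : 0 < `|y| by rewrite normr_gt0.
have [|x /[!inE] Lx hx] := @compact_EVT_max _ R (dot y) L L0 cL.
  by apply: continuous_subspaceT => z; exact: dot_continuous.
have m0 : 0 < dot y x.
  have [r r0 hr] := body0_ball bL.
  have Lr : L ((r / `|y|) *: y).
    by apply: hr; rewrite normrZ gtr0_norm ?divr_gt0// divfK// lt0r_neq0.
  have := hx _ (mem_set Lr); apply: lt_le_trans.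
  by rewrite dotZr mulr_gt0 ?divr_gt0// dot_gt0.
suff m1 : dot y x = 1.
  have Lxb := boundary_dot1 Lx Ly m1.
  by exists x => //; rewrite -(dual_point_unique Lxb Ly m1).
apply/eqP; rewrite eq_le (Ly _ Lx) leNgt; apply/negP => m1; apply: nLy.
have -> : y = dot y x *: ((dot y x)^-1 *: y).
  by rewrite scalerA mulfV ?scale1r// lt0r_neq0.
apply: (body0_contract bP); last by rewrite m1 ltW.
move=> z Lz; rewrite dotZl ler_pdivrMl// mulr1; apply: hx.
exact: mem_set.
Qed.

(** If phi took the same value at both ends of a segment, the segment would lie in
    the boundary and phi would be constant on it, against the nondegeneracy of
    its derivative. *)
Lemma dual_map_inj x x' : boundary L x -> boundary L x' -> phi x = phi x' -> x = x'.
Proof.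
move=> Lx Lx' pxx'; apply/eqP; rewrite eq_sym -subr_eq0; apply/negPn/negP => v0.
set v := x' - x in v0.
have Lt t : 0 <= t <= 1 -> boundary L (x + t *: v) /\ phi (x + t *: v) = phi x.
  move=> t01; have Lz : L (x + t *: v).
    have -> : x + t *: v = t *: x' + (1 - t) *: x.
      by apply/rowP => i; rewrite !mxE; ring.
    have [_ /convex_setP vL _] := bL; apply: vL => //; exact: (boundary_sub bL).
  have pz : dot (phi x) (x + t *: v) = 1.
    by rewrite dotDr dotZr dotBr {2}pxx' !(polar_map1 pL)// subrr mulr0 addr0.
  have Lp := polar_map_in pL Lx.
  have Lzb := boundary_dot1 Lz Lp pz.
  by split=> //; rewrite -(dual_point_unique Lzb Lp pz).
have vD : 0 < `|v *m D x|.
  rewrite normr_gt0; apply/eqP => vD.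
  by have := dual_map_pos dL Lx v0; rewrite vD dot0l ltxx.
have nv : 0 < `|v| by rewrite normr_gt0.
have e0 : 0 < `|v *m D x| / (2 * `|v|) by rewrite divr_gt0// mulr_gt0.
have /near_alongP[d d0 hd] := dual_map_diff dL Lx e0.
pose t := Num.min 1 (d / 2 / `|v|).
have t0 : 0 < t by rewrite lt_min ltr01 !divr_gt0.
have t1 : t <= 1 by rewrite ge_min lexx.
have [|Lz pz] := Lt t; first by rewrite (ltW t0) t1.
have E : x + t *: v - x = t *: v by rewrite addrAC subrr add0r.
have := hd _ Lz; rewrite pz E subrr sub0r normrN -scalemxAl !normrZ (gtr0_norm t0).
have td : t * `|v| < d.
  apply: (@le_lt_trans _ _ (d / 2)).
    by rewrite -ler_pdivlMr// ge_min lexx orbT.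
  by rewrite ltr_pdivrMr// ltr_pMr// ltr1n.
move=> /(_ td); rewrite mulrCA ler_pM2l// invfM mulrA divfK ?lt0r_neq0//.
by rewrite leNgt ltr_pdivrMr// ltr_pMr// ltr1n.
Qed.

Definition dual_inv y : 'rV[R]_n := xget 0 [set x | boundary L x /\ phi x = y].

Lemma dual_invP y : boundary (polar L) y ->
  boundary L (dual_inv y) /\ phi (dual_inv y) = y.
Proof.
move=> /dual_map_surj[x Lx xy].
by apply: (@xgetPex _ 0 [set x | boundary L x /\ phi x = y]); exists x.
Qed.

(** The inverse of a continuous injection of a compact set is continuous. *)
Lemma dual_inv_cvg y : boundary (polar L) y ->
  dual_inv @ within (boundary (polar L)) (nbhs y) -->
  within (boundary L) (nbhs (dual_inv y)).
Proof.
move=> Py; have [Lx xy] := dual_invP Py; set x := dual_inv y in Lx xy *.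
suff H (e : R) : 0 < e -> exists2 d : R, 0 < d & forall z, boundary L z ->
    `|phi z - y| < d -> `|z - x| < e.
  move=> P /near_alongP[e e0 he]; have [d d0 hd] := H e e0.
  apply/near_alongP; exists d => // z Pz zy.
  by have [Lz pz] := dual_invP Pz; apply: he => //; apply: hd => //; rewrite pz.
move=> e0.
pose C := boundary L `&` [set z | e <= `|z - x|].
have cC : compact C.
  apply: compact_closedI; first exact: boundary_compact.
  apply: (@preimage_closed _ _ (fun z : 'rV[R]_n => `|z - x|) [set t | e <= t]).
    move=> z _; have h : (fun w : 'rV[R]_n => w - x) @ nbhs z --> z - x.
      by apply: cvgB; [exact: cvg_id|exact: cvg_cst].
    exact: cvg_norm h.
  exact: closed_ge.
have [C0|/set0P C0] := eqVneq C set0.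
  exists 1 => // z Lz _; rewrite ltNge; apply/negP => h.
  by have : C z by []; rewrite C0.
have [|z0 /[!inE] -[Lz0 hz0] hmin] :=
    @compact_EVT_min _ R (fun z => `|phi z - y|) C C0 cC.
  apply/subspace_continuousP => z [Lz _]; apply: cvg_norm.
  apply: cvgB; last exact: cvg_cst.
  apply: cvg_trans (polar_map_cvg pL Lz); apply: cvg_app.
  by apply: within_subset => w [].
exists `|phi z0 - y|.
  rewrite normr_gt0 subr_eq0; apply/eqP => h.
  have zx : z0 = x by apply: dual_map_inj => //; rewrite h.
  by move: hz0; rewrite /= zx subrr normr0 leNgt e0.
move=> z Lz zy; rewrite ltNge; apply/negP => h.
have : z \in C by rewrite inE.
by move=> /hmin; rewrite leNgt zy.
Qed.

(** The polar map of the polar body is the inverse of phi, and the Hessians are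
    inverse to each other: along the boundary the slope of the inverse of phi is
    the inverse of the slope of phi. *)
Lemma dual_map_of_polar :
  dual_map (polar L) dual_inv (fun y => invmx (D (dual_inv y))).
Proof.
have D_sym x : boundary L x -> (invmx (D x))^T = invmx (D x).
  by move=> Lx; rewrite trmx_inv (dual_map_sym dL Lx).
have diffP y : boundary (polar L) y ->
    diff_along (boundary (polar L)) dual_inv y (invmx (D (dual_inv y))).
  move=> Py; have [Lx xy] := dual_invP Py; have cy := dual_inv_cvg Py.
  have [Phi [_ PhiD hPhi]] := diff_along_slope (dual_map_diff dL Lx).
  have PD : (Phi \o dual_inv) @ within (boundary (polar L)) (nbhs y) -->
      D (dual_inv y) by exact: cvg_comp cy PhiD.
  have uD := dual_map_unit Lx.
  apply: (@slope_diff_along _ _ _ _ _ _ (invmx \o (Phi \o dual_inv))).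
    exact: cvg_invmx.
  have nz : \forall z \near within (boundary (polar L)) (nbhs y),
      \det ((Phi \o dual_inv) z) != 0.
    apply: (cvgr_neq0 _ (cvg_det PD)).
    by rewrite unitmxE unitfE in uD.
  apply: filterS2 nz (withinT _ _) => z dz Pz.
  have [_ zz] := dual_invP Pz.
  have := hPhi (dual_inv z); rewrite zz xy /= => ->.
  by rewrite mulmxK// unitmxE unitfE.
split=> //; first split.
- move=> y Py x Px; rewrite dotC; have [Lx _] := dual_invP Py.
  exact: Px (boundary_sub bL Lx).
- move=> y Py; have [Lx {2}<-] := dual_invP Py.
  by rewrite dotC (polar_map1 pL).
- move=> y Py; exact: diff_along_cvg (diffP y Py).
- by move=> y /dual_invP[Lx _]; exact: D_sym.
- move=> y v /dual_invP[Lx _] v0; have uD := dual_map_unit Lx.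
  rewrite -[X in dot _ X](mulmxKV uD) -[X in dot _ (_ *m X)](dual_map_sym dL Lx).
  rewrite -dot_mulmxr; apply: (dual_map_pos dL Lx).
  by apply: contra_neq v0 => h; rewrite -(mulmxKV uD v) h mul0mx.
- move=> y /dual_invP[Lx xy].
  by rewrite -{1}xy -(dual_map_hom dL Lx) mulmxK// dual_map_unit.
- move=> y Py; have [Lx _] := dual_invP Py.
  apply: cvg_invmx; first exact: dual_map_unit.
  exact: cvg_comp (dual_inv_cvg Py) (dual_map_cvg dL Lx).
Qed.

End polar_duality.

(** * Curvatures of a body with a nondegenerate dual map *)

Section curvatures.
Context {R : realType} {n : nat}.
Variables (L : set 'rV[R]_n) (phi : 'rV[R]_n -> 'rV[R]_n).
Variable D : 'rV[R]_n -> 'M[R]_n.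
Hypotheses (bL : body0 L) (dL : dual_map L phi D).
Implicit Types (x y v : 'rV[R]_n).

Let pL := dual_map_polar dL.
Let N x : 'rV[R]_n := (enorm (phi x))^-1 *: phi x.
Let proj x : 'M[R]_n := 1%:M - (N x)^T *m N x.

Let ne x : boundary L x -> 0 < enorm (phi x).
Proof. by move=> Lx; exact: enorm_gt0 (polar_map_neq0 pL Lx). Qed.

Let N1 x : boundary L x -> dot (N x) (N x) = 1.
Proof.
move=> Lx; rewrite dotZl dotZr -sqr_enorm mulrA -expr2 -exprMn.
by rewrite mulVf ?expr1n// lt0r_neq0// ne.
Qed.

Let mulN_proj x v : v *m proj x = v - dot v (N x) *: N x.
Proof. by rewrite mulmxBr mulmx1 mulmx_rank1. Qed.

Let proj_tangent x v : dot (phi x) v = 0 -> v *m proj x = v.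
Proof. by move=> xv; rewrite mulN_proj dotZr dotC xv mulr0 scale0r subr0. Qed.

Let proj_sym x : (proj x)^T = proj x.
Proof. by rewrite /proj linearB /= trmx1 trmx_mul trmxK. Qed.

(** The matrix of the Weingarten map, extended by 0 to the normal direction. *)
Definition shape_matrix x : 'M[R]_n :=
  (enorm (phi x))^-1 *: (proj x *m D x *m proj x).

Lemma shape_matrix_sym x : boundary L x -> (shape_matrix x)^T = shape_matrix x.
Proof.
move=> Lx; rewrite /shape_matrix linearZ /= !trmx_mul proj_sym.
by rewrite (dual_map_sym dL Lx) mulmxA.
Qed.

Lemma shape_matrix_normal x : boundary L x -> N x *m shape_matrix x = 0.
Proof.
move=> Lx; rewrite -scalemxAr !mulmxA (mulN_proj x (N x)) N1// scale1r subrr.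
by rewrite !mul0mx scaler0.
Qed.

Lemma shape_matrix_pos x v : boundary L x -> v != 0 -> dot (phi x) v = 0 ->
  0 < dot (v *m shape_matrix x) v.
Proof.
move=> Lx v0 xv; rewrite -scalemxAr dotZl mulr_gt0 ?invr_gt0 ?ne//.
rewrite !mulmxA (proj_tangent xv) dot_mulmxr proj_sym (proj_tangent xv).
exact: (dual_map_pos dL Lx v0).
Qed.

Let cvg_phi x : boundary L x -> phi @ within (boundary L) (nbhs x) --> phi x.
Proof. exact: (polar_map_cvg pL). Qed.

Let cvg_enorm_phi x : boundary L x ->
  (fun y => enorm (phi y)) @ within (boundary L) (nbhs x) --> enorm (phi x).
Proof.
move=> Lx; apply: (@cvg_comp _ _ _ (fun y => dot (phi y) (phi y)) Num.sqrt).
  by apply: cvg_dot; exact: cvg_phi.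
exact: sqrt_continuous.
Qed.

Let cvg_invnorm x : boundary L x ->
  (fun y => (enorm (phi y))^-1) @ within (boundary L) (nbhs x) -->
  (enorm (phi x))^-1.
Proof. by move=> Lx; apply: cvgV; [rewrite lt0r_neq0// ne|exact: cvg_enorm_phi]. Qed.

Let cvg_N x : boundary L x -> N @ within (boundary L) (nbhs x) --> N x.
Proof. by move=> Lx; apply: cvgZ; [exact: cvg_invnorm|exact: cvg_phi]. Qed.

Lemma shape_matrix_cvg x : boundary L x ->
  shape_matrix @ within (boundary L) (nbhs x) --> shape_matrix x.
Proof.
move=> Lx; have cp : proj @ within (boundary L) (nbhs x) --> proj x.
  apply: cvgB; first exact: cvg_cst.
  by apply: cvg_mulmx; [apply: cvg_trmx|]; exact: cvg_N.
apply: cvgZ; first exact: cvg_invnorm.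
by apply: cvg_mulmx => //; apply: cvg_mulmx => //; exact: (dual_map_cvg dL Lx).
Qed.

(** Differentiate phi / |phi|; the slope of 1/|phi| comes from
    |phi y|^2 - |phi x|^2 = <phi y - phi x, phi y + phi x>. *)
Lemma gauss_differential_dual x : boundary L x ->
  gauss_differential L x ((enorm (phi x))^-1 *: (D x *m proj x)).
Proof.
move=> Lx; have [Phi [_ PhiD hPhi]] := diff_along_slope (dual_map_diff dL Lx).
pose a y := enorm (phi y).
pose Psi y := (a y)^-1 *: (Phi y) -
  (a x * a y * (a x + a y))^-1 *: (Phi y *m ((phi y + phi x)^T *m phi x)).
have ax := ne Lx.
apply: (@slope_diff_along _ _ _ _ _ _ Psi).
  have -> : (enorm (phi x))^-1 *: (D x *m proj x) = (a x)^-1 *: (D x) -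
     (a x * a x * (a x + a x))^-1 *: (D x *m ((phi x + phi x)^T *m phi x)).
    rewrite /proj mulmxBr mulmx1 scalerBr; congr (_ - _).
    have -> : (N x)^T *m N x = ((a x)^-1 * (a x)^-1) *: ((phi x)^T *m phi x).
      by rewrite /N [(_ *: _)^T]linearZ /= -scalemxAl -scalemxAr scalerA.
    have -> : (phi x + phi x)^T *m phi x = 2 *: ((phi x)^T *m phi x).
      by rewrite linearD /= mulmxDl scaler_nat mulr2n.
    rewrite -!scalemxAr !scalerA; congr (_ *: _); rewrite -/(a x).
    by field; rewrite !lt0r_neq0// addr_gt0.
  apply: cvgB; apply: cvgZ => //; first exact: cvg_invnorm.
    apply: cvgV; first by rewrite lt0r_neq0// !mulr_gt0// addr_gt0.
    by apply: cvgM; [apply: cvgM|apply: cvgD];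
      by [exact: cvg_cst|exact: cvg_enorm_phi].
  apply: cvg_mulmx => //; apply: cvg_mulmx; last exact: cvg_cst.
  by apply: cvg_trmx; apply: cvgD; [exact: cvg_phi|exact: cvg_cst].
apply: (filterS _ (@withinT _ (nbhs x) (boundary L) _)) => y Ly.
have ay := ne Ly.
rewrite !(outer_normalE bL pL)// mulmxBr -!scalemxAr !mulmxA -hPhi.
rewrite -mulmxA mulmx_rank1 scalerA.
have -> : dot (phi y - phi x) (phi y + phi x) = (a y - a x) * (a y + a x).
  rewrite -subr_sqr !sqr_enorm dotBl !dotDr (dotC (phi x) (phi y)); ring.
have -> : (a x * a y * (a x + a y))^-1 * ((a y - a x) * (a y + a x)) =
    (a x)^-1 - (a y)^-1.
  by rewrite /a; field; rewrite !lt0r_neq0// addr_gt0.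
by rewrite scalerBl scalerBr -/(a x) -/(a y); apply/rowP => i; rewrite !mxE; ring.
Qed.

(** Every admissible choice of principal directions diagonalizes the shape
    matrix, the normal completing them to an orthonormal eigenbasis. *)
Lemma principal_curvaturesE x k : boundary L x ->
  is_principal_curvatures L x k ->
  (forall i, 0 < k 0 i) /\
  forall j, \sum_(A : {set 'I_n.-1} | #|A| == j) \prod_(l in A) k 0 l =
    (det_poly (shape_matrix x))`_j.
Proof.
move=> Lx [W [e [hW ho hN he]]].
have eN i : dot (e i) (N x) = 0 by rewrite /N -(outer_normalE bL pL Lx).
have xe i : dot (phi x) (e i) = 0.
  have := eN i; rewrite dotZr dotC => /eqP; rewrite mulf_eq0 invr_eq0.
  by rewrite (negbTE (lt0r_neq0 (ne Lx))) => /eqP.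
have eS i : e i *m shape_matrix x = k 0 i *: e i.
  rewrite -he -scalemxAr !mulmxA (proj_tangent (xe i)).
  have := diff_along_unique bL pL Lx hW (gauss_differential_dual Lx) (xe i).
  by rewrite -scalemxAr mulmxA.
split=> [i|j].
  have e0 : e i != 0.
    by apply: contra_eq_neq (ho i i) => ->; rewrite dot0l eqxx eq_sym oner_eq0.
  have := shape_matrix_pos Lx e0 (xe i).
  by rewrite eS dotZl ho eqxx mulr1.
rewrite -coef_prod_1MX; congr (_`_j); congr polyseq.
have {ho hN he xe} := (ho, eN, eS, N1 Lx, shape_matrix_normal Lx).
move: (N x) (shape_matrix x) e k {hW eN eS} => M S e k.
case: n M S e k => [|n'] M S e k [[[[ho hN] hS] M1] MS].
  by move: M1; rewrite /dot big_ord0 => /eqP; rewrite eq_sym oner_eq0.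
exact/esym/(det_poly_eigen M1 MS ho hN hS).
Qed.

Lemma is_principal_curvatures_neq0 x : boundary L x ->
  [set k | is_principal_curvatures L x k] !=set0.
Proof.
move=> Lx; have [e [k [ho hN he]]] := symmetric_eigenbasis
  (shape_matrix_sym Lx) (shape_matrix_normal Lx).
exists k, ((enorm (phi x))^-1 *: (D x *m proj x)), e.
have xe i : dot (phi x) (e i) = 0.
  have := hN i; rewrite dotZr dotC => /eqP; rewrite mulf_eq0 invr_eq0.
  by rewrite (negbTE (lt0r_neq0 (ne Lx))) => /eqP.
split=> // [|i|i]; first exact: gauss_differential_dual.
  by rewrite (outer_normalE bL pL Lx).
by rewrite -he -!scalemxAr !mulmxA (proj_tangent (xe i)).
Qed.

Lemma mean_curvatureE j x : boundary L x ->
  mean_curvature j L x = ('C(n.-1, j)%:R)^-1 * (det_poly (shape_matrix x))`_j.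
Proof.
move=> Lx; rewrite /mean_curvature; congr (_ * _).
by apply: (principal_curvaturesE Lx _).2; exact: (xgetPex 0 (is_principal_curvatures_neq0 Lx)).
Qed.

Lemma mean_curvature_gt0 j x : (j <= n.-1)%N -> boundary L x ->
  0 < mean_curvature j L x.
Proof.
move=> jn Lx; rewrite /mean_curvature mulr_gt0 ?invr_gt0 ?ltr0n ?bin_gt0//.
have [k0 _] := principal_curvaturesE Lx
  (xgetPex 0 (is_principal_curvatures_neq0 Lx)).
have hp (A : {set 'I_n.-1}) : 0 < \prod_(l in A) principal_curvatures L x 0 l.
  by apply: prodr_gt0 => i _; exact: k0.
have : (0 < #|[set A : {set 'I_n.-1} | #|A| == j]%SET|)%N.
  by rewrite card_draws card_ord bin_gt0.
move=> /card_gt0P[A]; rewrite inE => Aj.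
rewrite (bigD1 A)//= ltr_wpDr// sumr_ge0// => B _.
exact: ltW.
Qed.

Lemma mean_curvature_cvg j x : boundary L x ->
  mean_curvature j L @ within (boundary L) (nbhs x) --> mean_curvature j L x.
Proof.
move=> Lx; rewrite mean_curvatureE//.
have h : (fun y => ('C(n.-1, j)%:R)^-1 * (det_poly (shape_matrix y))`_j)
    @ within (boundary L) (nbhs x) -->
    ('C(n.-1, j)%:R)^-1 * (det_poly (shape_matrix x))`_j.
  apply: cvgM; first exact: cvg_cst.
  by apply: cvg_coef_det_poly; exact: shape_matrix_cvg.
apply: cvg_trans h; apply: near_eq_cvg.
apply: (filterS _ (@withinT _ (nbhs x) (boundary L) _)) => y Ly.
by rewrite mean_curvatureE.
Qed.

Lemma support_at_gt0 x : boundary L x -> 0 < support_at L x.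
Proof. by move=> Lx; rewrite (support_atE bL pL Lx) invr_gt0 ne. Qed.

Lemma support_at_cvg x : boundary L x ->
  support_at L @ within (boundary L) (nbhs x) --> support_at L x.
Proof.
move=> Lx; rewrite (support_atE bL pL Lx).
apply: cvg_trans (cvg_invnorm Lx); apply: near_eq_cvg.
apply: (filterS _ (@withinT _ (nbhs x) (boundary L) _)) => y Ly.
by rewrite (support_atE bL pL Ly).
Qed.

End curvatures.

(** * The dual map of a body of class C^2_+ *)

Section tangent_sequences.
Context {R : realType} {n : nat}.
Variables (L : set 'rV[R]_n) (phi : 'rV[R]_n -> 'rV[R]_n).
Hypotheses (bL : body0 L) (pL : polar_map L phi).

Lemma tangent_seq x v : boundary L x -> dot (phi x) v = 0 ->
  exists (y : nat -> 'rV[R]_n) (t : nat -> R),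
    [/\ forall k, 0 < t k, forall k, boundary L (y k),
        (fun k => (t k)^-1 *: (y k - x)) @ \oo --> v &
        y @ \oo --> within (boundary L) (nbhs x)].
Proof.
move=> Lx xv; have h0 k : 0 < @harmonic R k by rewrite /harmonic invr_gt0.
have /choice[y hy] k : exists yt : 'rV[R]_n * R, [/\ 0 < yt.2,
    yt.2 <= @harmonic R k, boundary L yt.1 &
    `|yt.1 - x - yt.2 *: v| <= @harmonic R k * yt.2].
  have [t0 t00 ht] := tangent_curve bL pL Lx xv (h0 k).
  pose t := Num.min (t0 / 2) (@harmonic R k).
  have tp : 0 < t by rewrite lt_min divr_gt0 ?h0.
  have tt0 : t < t0.
    rewrite (@le_lt_trans _ _ (t0 / 2)) ?ge_min ?lexx//.
    by rewrite ltr_pdivrMr// ltr_pMr// ltr1n.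
  have [|z Lz hz] := ht t; first by rewrite tp.
  by exists (z, t); split=> //=; rewrite ge_min lexx orbT.
have lim : (fun k => ((y k).2)^-1 *: ((y k).1 - x)) @ \oo --> v.
  apply/cvgrPdist_le => e e0.
  have /cvgrPdist_le/(_ _ e0) := @cvg_harmonic R.
  apply: filterS => k; rewrite sub0r normrN gtr0_norm ?h0// => hk.
  have [tp _ _ hz] := hy k.
  have -> : v - ((y k).2)^-1 *: ((y k).1 - x) =
      - (((y k).2)^-1 *: ((y k).1 - x - (y k).2 *: v)).
    by rewrite [in RHS]scalerBr scalerA mulVf ?lt0r_neq0// scale1r opprB.
  rewrite normrN normrZ gtr0_norm ?invr_gt0// ler_pdivrMl// mulrC.
  by rewrite (le_trans hz)// ler_wpM2r// ltW.
exists (fun k => (y k).1), (fun k => (y k).2); split=> //.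
- by move=> k; have [] := hy k.
- by move=> k; have [] := hy k.
have t0 : (fun k => (y k).2) @ \oo --> (0 : R).
  apply: (@squeeze_cvgr _ _ _ _ (fun=> 0) (@harmonic R)).
  - by apply: nearW => k; have [tp th _ _] := hy k; rewrite th ltW.
  - exact: cvg_cst.
  - exact: cvg_harmonic.
have yx : (fun k => (y k).1) @ \oo --> x.
  have -> : (fun k => (y k).1) =
      (fun k => x + (y k).2 *: (((y k).2)^-1 *: ((y k).1 - x))).
    apply/funext => k; have [tp _ _ _] := hy k.
    by rewrite scalerA mulfV ?lt0r_neq0// scale1r addrC subrK.
  rewrite -[X in _ --> X]addr0 -(scale0r v).
  by apply: cvgD; [exact: cvg_cst|exact: cvgZ].
move=> P hP.
have h : \forall k \near \oo, boundary L (y k).1 -> P (y k).1 by exact: (yx _ hP).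
suff : \forall k \near \oo, P (y k).1 by [].
by apply: filterS h => k; apply; have [] := hy k.
Qed.

(** phi is monotone: <phi y - phi x, y - x> = 2 - <phi y, x> - <phi x, y> >= 0. *)
Lemma tangent_monotone x (D : 'M[R]_n) v : boundary L x ->
  diff_along (boundary L) phi x D -> dot (phi x) v = 0 -> 0 <= dot (v *m D) v.
Proof.
move=> Lx dD xv; have [y [t [tp Ly lim yx]]] := tangent_seq Lx xv.
have [Phi [_ PhiD hPhi]] := diff_along_slope dD.
pose w k := (t k)^-1 *: (y k - x).
have cw : (fun k => dot (w k *m Phi (y k)) (w k)) @ \oo --> dot (v *m D) v.
  apply: cvg_dot => //; apply: cvg_mulmx => //.
  exact: (@cvg_comp _ _ _ y Phi _ _ _ yx PhiD).
apply: (@closed_cvg _ _ _ _ _ [set z : R | 0 <= z] _ _ _ cw).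
  exact: closed_ge.
apply: nearW => k /=.
rewrite /w -scalemxAl -hPhi dotZl dotZr !mulr_ge0 ?invr_ge0 ?(ltW (tp k))//.
rewrite dotBl !dotBr !(polar_map1 pL)// opprB.
have := polar_map_le pL (Ly k) (boundary_sub bL Lx).
have := polar_map_le pL Lx (boundary_sub bL (Ly k)).
by lra.
Qed.

(** Differentiate <phi y, y> = 1 along the boundary. *)
Lemma diff_polar_position x (D : 'M[R]_n) v : boundary L x ->
  diff_along (boundary L) phi x D -> dot (phi x) v = 0 -> dot (v *m D) x = 0.
Proof.
move=> Lx dD xv; have [Phi [_ PhiD hPhi]] := diff_along_slope dD.
pose f (y : 'rV[R]_n) : 'rV[R]_1 := (dot (phi y) y)%:M.
have f1 : diff_along (boundary L) f x (D *m x^T + (phi x)^T).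
  apply: (@slope_diff_along _ _ _ _ _ _ (fun y => Phi y *m y^T + (phi x)^T)).
    apply: cvgD; last exact: cvg_cst.
    by apply: cvg_mulmx => //; apply: cvg_trmx; exact: cvg_within.
  apply: nearW => y; rewrite mulmxDr mulmxA -hPhi !dot_mulmxE /f -raddfD -raddfB /=.
  by congr (_%:M); rewrite dotBl dotBl (dotC y) (dotC x); ring.
have f2 : diff_along (boundary L) f x 0.
  move=> e e0; apply: (filterS _ (@withinT _ (nbhs x) (boundary L) _)) => y Ly.
  by rewrite /f !(polar_map1 pL)// subrr mulmx0 subr0 normr0 mulr_ge0// ltW.
have := diff_along_unique bL pL Lx f1 f2 xv.
rewrite mulmx0 mulmxDr mulmxA !dot_mulmxE dotC (dotC v) xv => /matrixP/(_ 0 0).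
by rewrite !mxE eqxx !mulr1n addr0 dotC.
Qed.

End tangent_sequences.

Section smooth_body.
Context {R : realType} {n : nat}.
Variable K : set 'rV[R]_n.
Hypotheses (bK : body0 K) (hC : C2_plus K).
Implicit Types (x y u v : 'rV[R]_n).

Lemma outer_unit_normal_exists x : boundary K x -> outer_unit_normals K x !=set0.
Proof.
move=> Kx; have [cK vK iK] := bK; have [_ nKx] := (body0P x bK).1 Kx.
have [|u u0 hu] := supporting_hyperplane cK vK _ nKx.
  by exists 0; exact: interior_subset.
have nu := enorm_gt0 u0.
exists ((enorm u)^-1 *: u); split=> [|y Ky].
  by rewrite enormZ gtr0_norm ?invr_gt0// mulVf ?lt0r_neq0.
by rewrite dotZl pmulr_rle0 ?invr_gt0// dotBr subr_le0 hu.
Qed.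

Lemma outer_unit_normal_gt0 x u : outer_unit_normals K x u -> 0 < dot u x.
Proof.
move=> [u1 hu]; have [r r0 hr] := body0_ball bK.
have u0 : u != 0.
  by apply: contra_eq_neq u1 => ->; rewrite /enorm dot0l sqrtr0 eq_sym oner_eq0.
have nu : 0 < `|u| by rewrite normr_gt0.
have := hu ((r / `|u|) *: u); rewrite dotBr subr_le0 dotZr => h.
apply: (@lt_le_trans _ _ (r / `|u| * dot u u)).
  by rewrite mulr_gt0 ?divr_gt0// dot_gt0.
by apply: h; apply: hr; rewrite normrZ gtr0_norm ?divr_gt0// divfK// lt0r_neq0.
Qed.

Section chart.
Variables (U : set 'rV[R]_n) (f : 'rV[R]_n -> R).
Hypotheses (oU : open U) (fC : C2_on U f).
Hypothesis f_reg : forall y, U y -> exists i : 'I_n, 'D_(delta_mx 0 i) f y != 0.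
Hypothesis KU : boundary K `&` U = [set y | U y /\ f y = 0].

Let G := gradient f.

Lemma C1_taylor x (e : R) : U x -> 0 < e ->
  exists2 d : R, 0 < d & forall y, `|y - x| < d ->
    U y /\ `|f y - f x - dot (y - x) (G x)| <= e * `|y - x|.
Proof.
move=> Ux e0; apply/nbhs_distP.
apply: filterI; first exact: open_nbhs_nbhs.
have := C1_frechet oU Ux fC.1 e0; rewrite withinET; apply: filterS => y.
apply: le_trans; apply: le_trans (coord_le_norm _ 0).
rewrite !mxE eqxx !mulr1n le_eqVlt; apply/orP; left; apply/eqP.
by congr (`|_ - _|); apply: eq_bigr => i _; rewrite !mxE.
Qed.

Lemma chart_continuous x : U x -> {for x, continuous f}.
Proof.
move=> Ux; have := diff_along_cvg (C1_frechet oU Ux fC.1).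
rewrite withinET => /cvg_mxP/(_ 0 0).
by under eq_fun do rewrite mxE eqxx mulr1n; rewrite mxE eqxx mulr1n.
Qed.

Lemma gradient_neq0 x : U x -> G x != 0.
Proof.
move=> /f_reg[i]; apply: contra_neq => /rowP/(_ i).
by rewrite !mxE.
Qed.

(** f changes sign along G x, so by the intermediate value theorem every tangent
    direction v at x is the velocity of points x + t v + s (G x), s = o(t), of
    the boundary; hence an outer normal is orthogonal to all of them. *)
Lemma outer_normal_gradient x u : boundary K x -> U x -> outer_unit_normals K x u ->
  exists c : R, u = c *: G x.
Proof.
move=> Kx Ux [u1 hu].
have fx0 : f x = 0.
  have : (boundary K `&` U) x by [].
  by rewrite KU => -[].
have g0 := dot_gt0 (gradient_neq0 Ux); set g := dot (G x) (G x) in g0.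
have tan v : dot v (G x) = 0 -> dot u v <= 0.
  move=> vG; apply/ler_addgt0Pr => a a0; rewrite add0r.
  have b1 : 0 < `|dot u (G x)| + 1 by rewrite ltr_wpDl.
  pose eta := a / (`|dot u (G x)| + 1).
  have eta0 : 0 < eta by rewrite divr_gt0.
  pose M := `|v| + eta * `|G x| + 1.
  have M0 : 0 < M by rewrite ltr_wpDl// addr_ge0// mulr_ge0// ltW.
  have e0 : 0 < eta * g / M by rewrite divr_gt0// mulr_gt0.
  have [d d0 hd] := C1_taylor Ux e0.
  have [t tE] : exists t, t = d / (2 * M) by exists (d / (2 * M)).
  have t0 : 0 < t by rewrite tE divr_gt0// mulr_gt0.
  pose p s := x + t *: v + s *: G x.
  have px s : p s - x = t *: v + s *: G x
    by rewrite /p -(addrA x) (addrC x) addrK.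
  have pn s : - (eta * t) <= s <= eta * t -> `|p s - x| <= t * (M - 1).
    rewrite -ler_norml => hs.
    rewrite px (le_trans (ler_normD _ _))//.
    rewrite !normrZ (gtr0_norm t0) /M addrK mulrDr lerD//.
    by rewrite mulrCA mulrA ler_wpM2r.
  have M1 : t * (M - 1) < t * M by rewrite ltr_pM2l// ltrBlDr ltrDl.
  have tM : t * M < d.
    rewrite tE invfM mulrA mulfVK ?lt0r_neq0//.
    by rewrite ltr_pdivrMr// ltr_pMr// ltr1n.
  have pd s : - (eta * t) <= s <= eta * t -> `|p s - x| < d.
    by move=> /pn h; rewrite (le_lt_trans h)// (lt_trans M1).
  have fp s : - (eta * t) <= s <= eta * t -> `|f (p s) - s * g| < eta * g * t.
    move=> hs; have [_] := hd _ (pd _ hs).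
    rewrite fx0 subr0 {1}px dotDl !dotZl vG mulr0 add0r.
    move=> h; apply: (le_lt_trans h).
    rewrite -[ltLHS]mulrA ltr_pM2l ?mulr_gt0// ltr_pdivrMl// mulrC.
    by rewrite (le_lt_trans (pn _ hs)).
  have et : 0 < eta * t by rewrite mulr_gt0.
  have et2 : - (eta * t) <= eta * t by lra.
  have fpos : 0 < f (p (eta * t)).
    have := fp (eta * t); rewrite lexx andbT et2 => /(_ isT); rewrite ltr_norml => /andP[h _].
    by move: h; rewrite mulrAC ltrBrDl subrr.
  have fneg : f (p (- (eta * t))) < 0.
    have := fp (- (eta * t)); rewrite lexx /= et2 => /(_ isT); rewrite ltr_norml => /andP[_].
    by rewrite mulNr opprK (mulrAC eta t) gtrDr.
  have [|||s /[!in_itv]/= hs fs0] :=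
      @IVT R (f \o p) (- (eta * t)) (eta * t) 0.
  - exact: et2.
  - apply/subspace_continuousP => s /=; rewrite in_itv/= => hs.
    apply: (@cvg_comp _ _ _ p f); last first.
      by apply: chart_continuous; exact: (hd _ (pd _ hs)).1.
    apply: cvgD; first exact: cvg_cst.
    by apply: cvgZr_tmp; exact: cvg_within.
  - rewrite minElt maxElt /= (lt_trans fneg fpos).
    by rewrite (ltW fneg) (ltW fpos).
  have Kp : K (p s).
    apply: (boundary_sub bK).
    suff [] : (boundary K `&` U) (p s) by [].
    by rewrite KU; split=> //; exact: (hd _ (pd _ hs)).1.
  have := hu _ Kp; rewrite px dotDr !dotZr -lerBrDr sub0r => h.
  have : t * dot u v <= t * a.
    apply: (le_trans h); rewrite (le_trans (ler_norm _))// normrN normrM.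
    move: hs; rewrite -ler_norml => hs.
    apply: (@le_trans _ _ (eta * t * (`|dot u (G x)| + 1))).
      by rewrite ler_pM// lerDl.
    by rewrite mulrAC /eta divfK ?lt0r_neq0// mulrC.
  by rewrite ler_pM2l.
pose w := u - (dot u (G x) / g) *: G x.
have wG : dot w (G x) = 0 by rewrite dotBl dotZl divfK ?subrr// lt0r_neq0.
exists (dot u (G x) / g); apply/eqP; rewrite -subr_eq0 -/w -dot_eq0.
rewrite eq_le dot_ge0 andbT {1}/w dotBl dotZl (dotC (G x)) wG mulr0 subr0.
exact: tan.
Qed.

Let q x := dot x (G x).

(** The polar point of x is the gradient normalized by its value at x; this does
    not depend on the sign of f. *)
Lemma polar_point_chart x u : boundary K x -> U x -> outer_unit_normals K x u ->
  q x != 0 /\ (dot u x)^-1 *: u = (q x)^-1 *: G x.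
Proof.
move=> Kx Ux hu; have ux := outer_unit_normal_gt0 hu.
have [c uE] := outer_normal_gradient Kx Ux hu.
move: ux; rewrite uE dotZl dotC -/(q x) => cq.
have [c0 q0] : c != 0 /\ q x != 0.
  by apply/andP; rewrite -negb_or -mulf_eq0 lt0r_neq0.
by split=> //; rewrite scalerA invfM mulrAC mulVf// mul1r.
Qed.

(** The derivative of x |-> G x / <x, G x>, by the quotient rule. *)
Definition chart_diff x : 'M[R]_n :=
  (q x)^-1 *: hessian f x -
  (q x * q x)^-1 *: (((G x)^T + hessian f x *m x^T) *m G x).

Lemma chart_diffP S x : U x -> q x != 0 ->
  diff_along S (fun y => (q y)^-1 *: G y) x (chart_diff x).
Proof.
move=> Ux qx0.
suff h : diff_along setT (fun y => (q y)^-1 *: G y) x (chart_diff x).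
  move=> e e0; have := h e e0; rewrite withinET.
  exact: (@cvg_within _ (nbhs x) _ S).
have [Phi [_ PhiH hPhi]] := diff_along_slope (gradient_diff oU Ux fC).
have cG := diff_along_cvg (gradient_diff oU Ux fC).
rewrite -/G in hPhi cG.
have cq : q @ within setT (nbhs x) --> q x by apply: cvg_dot => //; exact: cvg_within.
have cx : (id : 'rV[R]_n -> _) @ within setT (nbhs x) --> x by exact: cvg_within.
apply: (@slope_diff_along _ _ _ _ _ _ (fun y => (q y)^-1 *: Phi y -
    (q x * q y)^-1 *: (((G y)^T + Phi y *m x^T) *m G x))).
  apply: cvgB; apply: cvgZ.
  - exact: cvgV.
  - exact: PhiH.
  - apply: cvgV; first by rewrite mulf_neq0.
    by apply: cvgM => //; exact: cvg_cst.
  - apply: cvg_mulmx; last exact: cvg_cst.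
    apply: cvgD; first exact: cvg_trmx.
    by apply: cvg_mulmx => //; exact: cvg_cst.
apply: (filterS _ (cvgr_neq0 _ cq qx0)) => y qy0.
rewrite mulmxBr -!scalemxAr !mulmxA mulmxDr !mulmxA -hPhi !dot_mulmxE.
rewrite -raddfD mul_scalar_mx scalerA /=.
have -> : dot (y - x) (G y) + dot (G y - G x) x = q y - q x.
  by rewrite !dotBl (dotC _ x) (dotC _ x) /q; ring.
have -> : (q x * q y)^-1 * (q y - q x) = (q x)^-1 - (q y)^-1 by field; rewrite ?qx0 ?qy0.
by rewrite scalerBl scalerBr; apply/rowP => i; rewrite !mxE; ring.
Qed.

Lemma chart_diff_cvg x : U x -> q x != 0 -> chart_diff @ nbhs x --> chart_diff x.
Proof.
move=> Ux qx0.
have cG : G @ nbhs x --> G x.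
  by have := diff_along_cvg (gradient_diff oU Ux fC); rewrite withinET.
have cq : q @ nbhs x --> q x.
  by apply: (@cvg_dot R _ (nbhs x) _ n id G) => //; exact: cvg_id.
have cH : hessian f @ nbhs x --> hessian f x.
  have E i j : (fun y => hessian f y i j) = 'D_(delta_mx 0 i) ('D_(delta_mx 0 j) f).
    by apply/funext => y; rewrite mxE.
  by apply/cvg_mxP => i j; rewrite [X in _ --> X]mxE E; exact: (fC.2 j i).2.
apply: cvgB; apply: cvgZ => //; first exact: cvgV.
  by apply: cvgV; [rewrite mulf_neq0|apply: cvgM].
apply: cvg_mulmx => //; apply: cvgD; first exact: cvg_trmx.
by apply: cvg_mulmx => //; apply: (@cvg_trmx R _ (nbhs x) _ _ _ id); exact: cvg_id.
Qed.

End chart.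

Lemma outer_normalP x : boundary K x -> outer_unit_normals K x (outer_normal K x).
Proof. by move=> /outer_unit_normal_exists h; exact: (xgetPex 0 h). Qed.

Definition normal_polar x : 'rV[R]_n := (support_at K x)^-1 *: outer_normal K x.
Let phi := normal_polar.

Lemma normal_polar_local x : boundary K x ->
  exists (U : set 'rV[R]_n) (A : 'rV[R]_n -> 'M[R]_n),
    [/\ open U, U x, A @ nbhs x --> A x &
        forall y, boundary K y -> U y -> diff_along (boundary K) phi y (A y)].
Proof.
move=> Kx; have [U [f [oU Ux fC freg KU]]] := hC.1 _ Kx.
exists U, (chart_diff f).
have phiE y : boundary K y -> U y ->
    dot y (gradient f y) != 0 /\ phi y = (dot y (gradient f y))^-1 *: gradient f y.
  move=> Ky Uy; have hN := outer_normalP Ky.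
  have [q0 <-] := polar_point_chart oU fC freg KU Ky Uy hN.
  by split=> //; rewrite /phi /normal_polar /support_at dotC.
split=> //; first exact: (chart_diff_cvg oU fC Ux (phiE _ Kx Ux).1).
move=> y Ky Uy e e0.
have := chart_diffP oU fC (boundary K) Uy (phiE _ Ky Uy).1 e0.
have UF : within (boundary K) (nbhs y) U.
  by apply: (@cvg_within _ (nbhs y) _ (boundary K)); exact: (open_nbhs_nbhs (conj oU Uy)).
apply: filterS3 UF (@withinT _ (nbhs y) (boundary K) _) => z Uz Kz.
by rewrite -(phiE _ Kz Uz).2 -(phiE _ Ky Uy).2.
Qed.

Lemma normal_polar_map : polar_map K phi.
Proof.
split=> x Kx.
- have hN := outer_normalP Kx; have s0 := outer_unit_normal_gt0 hN.
  move=> y Ky; rewrite dotZl /support_at dotC ler_pdivrMl ?mulr1//.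
  by rewrite -subr_le0 -dotBr; exact: hN.2.
- have hN := outer_normalP Kx; have s0 := outer_unit_normal_gt0 hN.
  by rewrite dotZl /support_at (dotC x) mulVf// lt0r_neq0.
- have [U [A [_ Ux _ dA]]] := normal_polar_local Kx.
  exact: diff_along_cvg (dA x Kx Ux).
Qed.

Let pK := normal_polar_map.

(** On the boundary <phi x, y - x> = o(|y - x|): it and <phi y, x - y> are
    nonpositive, with sum <phi x - phi y, y - x>. Hence a matrix (phi x)^T w can be
    added to a derivative along the boundary. *)
Lemma dot_increment_diff x (w : 'rV[R]_n) : boundary K x ->
  diff_along (boundary K) (fun=> 0 : 'rV[R]_n) x ((phi x)^T *m w).
Proof.
move=> Kx e e0.
pose c : R := n.+1%:R * (`|w| + 1).
have w1 : 0 < `|w| + 1 by rewrite ltr_wpDl.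
have c0 : 0 < c by rewrite mulr_gt0.
have /cvgrPdist_le/(_ _ (divr_gt0 e0 c0)) := polar_map_cvg pK Kx.
apply: filterS2 (@withinT _ (nbhs x) (boundary K) _) => y Ky hy.
rewrite subr0 sub0r normrN mulmx_rank1 normrZ distrC in hy *.
have yx : `|dot (y - x) (phi x)| <= n%:R * `|y - x| * `|phi y - phi x|.
  rewrite dotC dotBr (polar_map1 pK Kx) ler0_norm; last first.
    by rewrite subr_le0; exact: (polar_map_le pK Kx (boundary_sub bK Ky)).
  apply: le_trans (normr_dot _ _); apply: le_trans (ler_norm _).
  rewrite !dotBl !dotBr (dotC y) (dotC x) (dotC y) (dotC x) !(polar_map1 pK)//.
  have := polar_map_le pK Ky (boundary_sub bK Kx); lra.
apply: (@le_trans _ _ (n.+1%:R * `|y - x| * (e / c) * (`|w| + 1))).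
  rewrite ler_pM// ?lerDl// (le_trans yx)// ler_pM// ?mulr_ge0//.
  by rewrite ler_wpM2r// ler_nat.
rewrite le_eqVlt; apply/orP; left; apply/eqP; rewrite /c.
by field; rewrite (lt0r_neq0 w1) addrC natr1 pnatr_eq0.
Qed.

Let tangent_part x v : boundary K x ->
  dot (phi x) (v - dot v (phi x) *: x) = 0.
Proof. by move=> Kx; rewrite dotBr dotZr (polar_map1 pK Kx) mulr1 dotC subrr. Qed.

Let hessian_spec x (D : 'M[R]_n) :=
  diff_along (boundary K) phi x D /\ x *m D = phi x.

Let hessian_unique x D D' : boundary K x ->
  hessian_spec x D -> hessian_spec x D' -> D = D'.
Proof.
move=> Kx [dD xD] [dD' xD']; apply/row_matrixP => i; rewrite !rowE.
set v : 'rV[R]_n := delta_mx 0 i.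
rewrite -[v](subrK (dot v (phi x) *: x)) (mulmxDl _ _ D) (mulmxDl _ _ D').
rewrite -!scalemxAl xD xD'.
congr (_ + _); exact: (diff_along_unique bK pK Kx dD dD' (tangent_part v Kx)).
Qed.

(** The correction of A in the radial direction for which x D = phi x. *)
Let hessian_of x (A : 'M[R]_n) := A - (phi x)^T *m (x *m A - phi x).

Let hessian_ofP x A : boundary K x -> diff_along (boundary K) phi x A ->
  hessian_spec x (hessian_of x A).
Proof.
move=> Kx dA; split; last first.
  by rewrite mulmxBr mulmx_rank1 dotC (polar_map1 pK Kx) scale1r opprB addrC subrK.
have := diff_alongB dA (dot_increment_diff (x *m A - phi x) Kx).
by under eq_fun do rewrite subr0.
Qed.

(** Characterized by its derivative property along the boundary and by homogeneity,
    it does not depend on the local equation. *)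
Definition gauge_hessian x : 'M[R]_n := xget 0 [set D | hessian_spec x D].

Let gauge_hessianE x A : boundary K x -> diff_along (boundary K) phi x A ->
  gauge_hessian x = hessian_of x A.
Proof.
move=> Kx dA; have h := hessian_ofP Kx dA.
exact: (hessian_unique Kx (xgetPex 0 (ex_intro _ _ h)) h).
Qed.

Let gauge_hessianP x : boundary K x -> hessian_spec x (gauge_hessian x).
Proof.
move=> Kx; have [U [A [_ Ux _ dA]]] := normal_polar_local Kx.
by rewrite (gauge_hessianE Kx (dA x Kx Ux)); apply: hessian_ofP => //; exact: dA.
Qed.

Let gauge_hessian_cvg x : boundary K x ->
  gauge_hessian @ within (boundary K) (nbhs x) --> gauge_hessian x.
Proof.
move=> Kx; have [U [A [oU Ux cA dA]]] := normal_polar_local Kx.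
rewrite (gauge_hessianE Kx (dA x Kx Ux)).
have cA' : A @ within (boundary K) (nbhs x) --> A x.
  by apply: cvg_trans cA; apply: cvg_app; exact: cvg_within.
have cp := polar_map_cvg pK Kx.
have h : (fun y => hessian_of y (A y)) @ within (boundary K) (nbhs x) -->
    hessian_of x (A x).
  apply: cvgB => //; apply: cvg_mulmx; first exact: cvg_trmx.
  by apply: cvgB => //; apply: cvg_mulmx => //; exact: cvg_within.
apply: cvg_trans h; apply: near_eq_cvg.
have UF : within (boundary K) (nbhs x) U.
  by apply: (@cvg_within _ (nbhs x) _ (boundary K)); exact: (open_nbhs_nbhs (conj oU Ux)).
apply: filterS2 UF (@withinT _ (nbhs x) (boundary K) _) => y Uy Ky.
by rewrite (gauge_hessianE Ky (dA y Ky Uy)).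
Qed.

Lemma gauss_curvature_prod x :
  gauss_curvature K x = \prod_i principal_curvatures K x 0 i.
Proof.
rewrite /gauss_curvature /mean_curvature binn invr1 mul1r.
rewrite (bigD1 [set: 'I_n.-1]%SET) /=; last by rewrite cardsT card_ord.
rewrite [X in _ + X]big1 ?addr0; first by apply: eq_bigl => i; rewrite inE.
move=> A /andP[/eqP cA /eqP nA].
by case: nA; apply/eqP; rewrite eqEcard finset.subsetT cardsT card_ord cA leqnn.
Qed.

Hypothesis n2 : (2 <= n)%N.

(** Both the given principal directions and D compute the derivative of the normal
    N = <x,N> phi, so that <e_i D, e_j> = k_i delta_ij / <x,N>. *)
Lemma principal_frame x : boundary K x ->
  exists (e : 'I_n.-1 -> 'rV[R]_n) (c : 'I_n.-1 -> R),
    [/\ forall i j, dot (e i) (e j) = (i == j)%:R,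
        forall i, dot (e i) (outer_normal K x) = 0,
        forall i, 0 < c i &
        forall i j, dot (e i *m gauge_hessian x) (e j) = c i * (i == j)%:R].
Proof.
move=> Kx; have [hD _] := gauge_hessianP Kx; set D := gauge_hessian x in hD *.
have hN := outer_normalP Kx; have s0 := outer_unit_normal_gt0 hN.
have sx : 0 < support_at K x by rewrite /support_at dotC.
set k := principal_curvatures K x.
have gk := hC.2 _ Kx; rewrite gauss_curvature_prod -/k in gk.
(* As n - 1 > 0, the Gauss curvature of the default value 0 of the principal
   curvatures is 0; being positive, it comes from actual principal curvatures. *)
have kn0 i : k 0 i != 0.
  by apply: contraTneq gk => k0; rewrite (bigD1 i)//= k0 mul0r ltxx.
have [W [e [hW ho heN he]]] : is_principal_curvatures K x k.
  apply: contrapT => h; have i : 'I_n.-1 by exists 0%N; rewrite -ltnS prednK// ltnW.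
  have := kn0 i; rewrite /k /principal_curvatures xgetPN ?mxE ?eqxx// => z hz.
  have := xgetPex 0 (ex_intro _ z hz : [set k | is_principal_curvatures K x k] !=set0).
  exact: h.
have xe i : dot (phi x) (e i) = 0 by rewrite dotZl dotC heN mulr0.
have NE y : boundary K y -> outer_normal K y = support_at K y *: phi y.
  move=> Ky; have := outer_unit_normal_gt0 (outer_normalP Ky) => sy.
  by rewrite scalerA mulfV ?scale1r// lt0r_neq0// /support_at dotC.
have [Phi [_ PhiD hPhi]] := diff_along_slope hD.
have cs : support_at K @ within (boundary K) (nbhs x) --> support_at K x.
  have ne : 0 < enorm (phi x) by exact: enorm_gt0 (polar_map_neq0 pK Kx).
  have h : (fun y => (enorm (phi y))^-1) @ within (boundary K) (nbhs x) -->
      (enorm (phi x))^-1.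
    apply: cvgV; first exact: lt0r_neq0.
    apply: (@cvg_comp _ _ _ (fun y => dot (phi y) (phi y)) Num.sqrt).
      by apply: cvg_dot; exact: (polar_map_cvg pK Kx).
    exact: sqrt_continuous.
  rewrite (support_atE bK pK Kx); apply: cvg_trans h; apply: near_eq_cvg.
  apply: (filterS _ (@withinT _ (nbhs x) (boundary K) _)) => y Ky.
  by rewrite (support_atE bK pK Ky).
have key i j : support_at K x * dot (e i *m D) (e j) = k 0 i * (i == j)%:R.
  pose f (y : 'rV[R]_n) : 'rV[R]_1 := (dot (outer_normal K y) (e j))%:M.
  have f1 : diff_along (boundary K) f x (W *m (e j)^T).
    have [Psi [_ PsiW hPsi]] := diff_along_slope hW.
    apply: (@slope_diff_along _ _ _ _ _ _ (fun y => Psi y *m (e j)^T)).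
      by apply: cvg_mulmx => //; exact: cvg_cst.
    by apply: nearW => y; rewrite mulmxA -hPsi dot_mulmxE /f -raddfB -dotBl.
  have f2 : diff_along (boundary K) f x (support_at K x *: (D *m (e j)^T)).
    apply: (@slope_diff_along _ _ _ _ _ _
        (fun y => support_at K y *: (Phi y *m (e j)^T))).
      by apply: cvgZ => //; apply: cvg_mulmx => //; exact: cvg_cst.
    apply: (filterS _ (@withinT _ (nbhs x) (boundary K) _)) => y Ky.
    rewrite -scalemxAr mulmxA -hPhi dot_mulmxE /f -raddfB !NE// scale_scalar_mx.
    congr (_%:M); rewrite (dotZl _ (phi y)) (dotZl _ (phi x)) dotBl !xe.
    by rewrite mulr0 !subr0.
  have := diff_along_unique bK pK Kx f1 f2 (xe i).
  rewrite -scalemxAr !mulmxA he !dot_mulmxE scale_scalar_mx dotZl ho.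
  by move=> /matrixP/(_ 0 0); rewrite !mxE eqxx !mulr1n.
exists e, (fun i => k 0 i / support_at K x); split=> // [i|i j].
  rewrite divr_gt0// lt_def kn0 /=.
  have := key i i; rewrite eqxx mulr1 => <-.
  by rewrite mulr_ge0 ?(ltW sx)//; exact: (tangent_monotone bK pK Kx hD (xe i)).
by rewrite mulrAC -key mulrC mulKf// lt0r_neq0.
Qed.

(** In the frame x, e_1, ..., e_(n-1) of principal_frame, D is diagonal with the
    positive entries 1, c_1, ..., c_(n-1). *)
Lemma gauge_hessian_form x : boundary K x ->
  (forall v w, dot (v *m gauge_hessian x) w = dot (w *m gauge_hessian x) v) /\
  (forall v, v != 0 -> 0 < dot (v *m gauge_hessian x) v).
Proof.
move=> Kx; have [hD xD] := gauge_hessianP Kx.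
have [e [c [ho hN c0 hc]]] := principal_frame Kx.
set D := gauge_hessian x in hD xD hc *.
have hn := outer_normalP Kx.
have N1 : dot (outer_normal K x) (outer_normal K x) = 1.
  by rewrite -sqr_enorm hn.1 expr1n.
have tan v : dot (phi x) v = 0 -> dot (outer_normal K x) v = 0.
  have s0 := outer_unit_normal_gt0 hn.
  rewrite dotZl => /eqP; rewrite mulf_eq0 invr_eq0 /support_at dotC.
  by rewrite (gt_eqF s0) => /eqP.
pose t v := v - dot v (phi x) *: x.
have tv v : dot (phi x) (t v) = 0 by exact: tangent_part.
have te v : t v = \sum_i dot (t v) (e i) *: e i.
  by apply: (frame_expand N1) => //; exact: tan.
have formE v w : dot (v *m D) w = dot v (phi x) * dot w (phi x) +
    \sum_i c i * (dot (t v) (e i) * dot (t w) (e i)).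
  rewrite -{1}[v](subrK (dot v (phi x) *: x)) -{1}[w](subrK (dot w (phi x) *: x)).
  rewrite -/(t v) -/(t w) mulmxDl -scalemxAl xD (dotDl (t v *m D)) !(dotDr _ (t w)).
  rewrite !(dotZl _ (phi x)) (dotZr _ (t v *m D)) (dotZr _ (phi x)).
  rewrite (diff_polar_position bK pK Kx hD (tv v)) (tv w) (polar_map1 pK Kx).
  rewrite !mulr0 mulr1 addr0 add0r addrC; congr (_ + _).
  rewrite {1}(te v) mulmx_suml dot_suml; apply: eq_bigr => i _.
  rewrite -scalemxAl dotZl mulrCA; congr (_ * _).
  rewrite {1}(te w) dotC dot_suml (bigD1 i)//= dotZl (dotC (e i)) hc eqxx mulr1.
  rewrite big1 ?addr0 1?mulrC// => j ji.
  by rewrite dotZl (dotC (e j)) hc eq_sym (negbTE ji) !mulr0.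
split=> [v w|v v0].
  rewrite !formE mulrC; congr (_ + _); apply: eq_bigr => i _.
  by rewrite (mulrC (dot (t v) _)).
rewrite formE -expr2.
have S0 : 0 <= \sum_i c i * (dot (t v) (e i) * dot (t v) (e i)).
  by apply: sumr_ge0 => i _; rewrite mulr_ge0 ?(ltW (c0 i))// -expr2 sqr_ge0.
rewrite lt_def addr_ge0 ?sqr_ge0// andbT paddr_eq0 ?sqr_ge0//.
rewrite sqrf_eq0; apply/negP => /andP[/eqP vx].
rewrite psumr_eq0 => [/allP h|i _]; last first.
  by rewrite mulr_ge0 ?(ltW (c0 i))// -expr2 sqr_ge0.
move: v0; apply/negP/negPn; rewrite -[v](subrK (dot v (phi x) *: x)).
rewrite -/(t v) vx scale0r addr0 te big1// => i _.
have := h i; rewrite mem_index_enum => /(_ isT) /=.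
by rewrite mulf_eq0 (gt_eqF (c0 i)) -expr2 sqrf_eq0 => /eqP ->; rewrite scale0r.
Qed.

Lemma C2_plus_dual_map : dual_map K phi gauge_hessian.
Proof.
split.
- exact: pK.
- move=> x Kx; have [hs _] := gauge_hessian_form Kx.
  apply/row_matrixP => i; rewrite !rowE; apply: dot_ext => w.
  by rewrite dot_mulmxr trmxK dotC hs.
- by move=> x v Kx v0; exact: (gauge_hessian_form Kx).2.
- by move=> x /gauge_hessianP[].
- by move=> x /gauge_hessianP[].
- exact: gauge_hessian_cvg.
Qed.

End smooth_body.

(** * Caratheodory measurability of Borel sets *)

Section metric_outer_measure.
Local Open Scope ereal_scope.
Context {R : realType} {T : Type} (mu : {outer_measure set T -> \bar R}).
Variable f : T -> R.
Hypothesis mu_sep : forall (A B : set T) (e : R), (0 < e)%R ->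
  (forall x y, A x -> B y -> (f x + e <= f y)%R) -> mu A + mu B <= mu (A `|` B).

Variables (a : R) (A : set T).
Let H : set T := [set x | (f x <= a)%R].
Let r (k : nat) : R := (a + k.+1%:R^-1)%R.
Let E k : set T := A `&` [set x | (r k <= f x)%R].
Let ring k : set T := A `&` [set x | (r k.+1 <= f x < r k)%R].

Let r_lt k l : (k < l)%N -> (r l < r k)%R.
Proof. by move=> kl; rewrite ltrD2l ltf_pV2 ?posrE// ltr_nat ltnS. Qed.

Let r_le k l : (k <= l)%N -> (r l <= r k)%R.
Proof. by rewrite leq_eqVlt => /predU1P[->//|/r_lt/ltW]. Qed.

Let above_cover k : A `&` ~` H `<=` E k `|` \bigcup_j ring (k + j)%N.
Proof.
move=> x [Ax /negP]; rewrite -ltNge => ax.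
have [N hN] : exists N, (r N <= f x)%R.
  exists (Num.truncn (f x - a)^-1)%R.
  rewrite /r -lerBrDl -[leRHS]invrK lef_pV2 ?posrE ?invr_gt0 ?subr_gt0//.
  by rewrite ltW// truncnS_gt.
case: (ex_minnP (ex_intro (fun N => r N <= f x)%R N hN)) => m hm mmin.
have [mk|km] := leqP m k; first by left; split=> //=; rewrite (le_trans (r_le mk)).
case: m hm mmin km => [//|m] hm mmin; rewrite ltnS => km.
right; exists (m - k)%N => //; rewrite subnKC//.
split=> //=; rewrite hm /= ltNge; apply/negP => /mmin.
by rewrite ltnn.
Qed.

(** Rings of the same parity are at positive distance from each other. *)
Let sum_parity c N : \sum_(j < N) mu (ring (j.*2 + c)) <= mu A.
Proof.
pose U M : set T := \big[setU/set0]_(j < M) ring (j.*2 + c).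
apply: (@le_trans _ _ (mu (U N))); last first.
  apply: le_outer_measure; rewrite /U.
  by elim/big_ind : _ => // [B C BA CA|i _]; [rewrite subUset|exact: subIsetl].
elim: N => [|N IH]; first by rewrite big_ord0 outer_measure_ge0.
rewrite big_ord_recr /= /U big_ord_recr /= -/(U N) addeC setUC.
apply: (@le_trans _ _ (mu (ring (N.*2 + c)) + mu (U N))); first by rewrite leeD2l.
case: N IH => [|N] IH.
  by rewrite /U big_ord0 setU0 outer_measure0 adde0.
apply: (@mu_sep _ _ (r (N.*2.+1 + c) - r (N.+1.*2 + c))%R).
  by rewrite subr_gt0 r_lt// ltn_add2r.
move=> x y [_ /= /andP[_ xr]] Uy.
have yr : (r (N.*2.+1 + c) <= f y)%R.
  move: Uy; rewrite /U -(bigcup_mkord N.+1 (fun j => ring (j.*2 + c)%N)) => -[j /= jN] [_ /= /andP[+ _]].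
  apply: le_trans; apply: r_le.
  by rewrite -addSn leq_add2r ltnS leq_double -ltnS.
rewrite (le_trans _ yr)// addrC -lerBrDr; move: xr; lra.
Qed.

Let sum_rings : \sum_(k <oo) mu (ring k) <= mu A + mu A.
Proof.
apply: lime_le.
  by apply: is_cvg_nneseries => k _ _; exact: outer_measure_ge0.
apply: nearW => N; rewrite big_mkord.
apply: (@le_trans _ _ (\sum_(k < N.*2) mu (ring k))).
  rewrite -!(big_mkord xpredT (fun k => mu (ring k))).
  have NN : (N <= N.*2)%N by rewrite -addnn leq_addr.
  rewrite [leRHS](big_cat_nat (leq0n N) NN)/= leeDl// sume_ge0// => k _.
  exact: outer_measure_ge0.
have -> : \sum_(k < N.*2) mu (ring k) =
    \sum_(j < N) mu (ring (j.*2 + 0)) + \sum_(j < N) mu (ring (j.*2 + 1)).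
  elim: N => [|N IH]; first by rewrite !big_ord0 adde0.
  rewrite doubleS !big_ord_recr /= IH addn0 addn1 -!addeA; congr (_ + _).
  by rewrite addeCA.
exact: leeD (sum_parity 0 N) (sum_parity 1 N).
Qed.

(** Caratheodory's criterion for a half-space H = {f <= a}: A \ H is exhausted by
    the sets E k at positive distance from H, and the rings left over have a
    summable measure. *)
Lemma metric_caratheodory_le : mu (A `&` H) + mu (A `&` ~` H) <= mu A.
Proof.
have [->|finA] := eqVneq (mu A) +oo; first exact: leey.
have {finA} : mu A < +oo by rewrite ltey.
move=> finA; apply/lee_addgt0Pr => e e0.
have tail := nneseries_tail_cvg (le_lt_trans sum_rings (lte_add_pinfty finA finA))
  (fun k _ => outer_measure_ge0 mu (ring k)).
have [k hk] : exists k, \sum_(k <= j <oo) mu (ring j) <= e%:E.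
  have e0' : (0 : \bar R) < e%:E by rewrite lte_fin.
  have : \forall k \near \oo, \sum_(k <= j <oo) mu (ring j) < e%:E.
    exact: (tail _ (open_ereal_lt' e0')).
  by move=> [k _ hk]; exists k; apply: ltW; apply: hk; exact: leqnn.
have h1 : mu (A `&` ~` H) <= mu (E k) + \sum_(k <= j <oo) mu (ring j).
  apply: (@le_trans _ _ (mu (E k) + \sum_(j <oo) mu (ring (k + j)%N))).
    apply: (le_trans (le_outer_measure mu _ _ (@above_cover k))).
    apply: (le_trans (outer_measureU2 _ _ _)); rewrite leeD2l//.
    exact: outer_measure_sigma_subadditive.
  rewrite leeD2l// -(nneseries_addn (f := fun j => mu (ring j)) k) => [|i].
    by rewrite le_eqVlt; apply/orP; left; apply/eqP; apply: eq_eseriesr => i _;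
      rewrite addnC.
  exact: outer_measure_ge0.
have h2 : mu (A `&` H) + mu (E k) <= mu A.
  apply: (@le_trans _ _ (mu ((A `&` H) `|` E k))); last first.
    by apply: le_outer_measure; rewrite subUset; split; exact: subIsetl.
  apply: (@mu_sep _ _ (k.+1%:R^-1)%R) => // x y [_ xa] [_ /= ry].
  by rewrite (le_trans _ ry)// lerD2r.
apply: (le_trans (leeD2l _ h1)); rewrite addeA.
by apply: leeD h2 hk.
Qed.

End metric_outer_measure.

(** * Borel sets are measurable for area and volume *)

Section split_cover.
Local Open Scope ereal_scope.
Context {R : realType} {T : Type} (gauge : set T -> \bar R).
Hypothesis gauge_ge0 : forall F, 0 <= gauge F.

Lemma le_cover_outer_series (F : nat -> set T) A : A `<=` \bigcup_k F k ->
  cover_outer gauge A <= \sum_(k <oo) gauge (F k).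
Proof. by move=> AF; apply: ereal_inf_lbound; exists F. Qed.

Lemma cover_outer_split (A B : set T) :
  (forall F, exists F12 : set T * set T, [/\ A `&` F `<=` F12.1,
     B `&` F `<=` F12.2 & gauge F12.1 + gauge F12.2 <= gauge F]) ->
  cover_outer gauge A + cover_outer gauge B <= cover_outer gauge (A `|` B).
Proof.
move=> /choice[s hs]; apply: le_ereal_inf_tmp => _ [F /= ABF <-].
apply: (@le_trans _ _ (\sum_(k <oo) gauge (s (F k)).1 +
                       \sum_(k <oo) gauge (s (F k)).2)).
  apply: leeD; apply: le_cover_outer_series => x Ax.
    have [|k _ Fx] := ABF x; first by left.
    by exists k => //; have [h _ _] := hs (F k); exact: h.
  have [|k _ Fx] := ABF x; first by right.
  by exists k => //; have [_ h _] := hs (F k); exact: h.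
rewrite -nneseriesD; [|by move=> *; exact: gauge_ge0|by move=> *; exact: gauge_ge0].
apply: lee_nneseries => [k _ _|k _]; first by rewrite adde_ge0.
by have [_ _] := hs (F k).
Qed.

End split_cover.

Section half_spaces.
Local Open Scope ereal_scope.
Context (R : realType) (n : nat).
Implicit Types (A B F : set 'rV[R]_n).

Lemma hausdorff_gauge_anti d (delta delta' : R) A : (delta <= delta')%R ->
  hausdorff_gauge d delta' A <= hausdorff_gauge d delta A.
Proof.
move=> dd; rewrite /hausdorff_gauge; case: ifP => // _.
case: ifPn => h1; case: ifPn => h2; rewrite ?leey//.
by case/negP: h1; rewrite (le_trans h2)// lee_fin.
Qed.

Lemma hausdorff_pre_anti d (delta delta' : R) A : (delta <= delta')%R ->
  hausdorff_pre d delta' A <= hausdorff_pre d delta A.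
Proof.
move=> dd; apply: le_ereal_inf_tmp => _ [F /= AF <-].
apply: (le_trans (le_cover_outer_series _ AF)).
apply: lee_nneseries => [k _ _|k _]; first exact: hausdorff_gauge_ge0.
exact: hausdorff_gauge_anti.
Qed.

Lemma ediam_ge A x y : A x -> A y -> (enorm (x - y))%:E <= ediam A.
Proof. by move=> Ax Ay; apply: ereal_sup_ubound; exists (x, y). Qed.

(** A covering set of diameter less than e cannot meet both A and B. *)
Lemma hausdorff_separated d i A B (e : R) : (0 < e)%R ->
  (forall x y, A x -> B y -> (x 0 i + e <= y 0 i)%R) ->
  hausdorff d A + hausdorff d B <= hausdorff d (A `|` B).
Proof.
move=> e0 AB.
have pre (delta : R) : (0 < delta)%R -> (delta < e)%R ->
    hausdorff_pre d delta A + hausdorff_pre d delta B <= hausdorff d (A `|` B).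
  move=> d0 de; apply: le_trans (hausdorff_pre_le d _ d0).
  apply: cover_outer_split => [F|F]; first exact: hausdorff_gauge_ge0.
  have [Finf|Ffin] := eqVneq (hausdorff_gauge d delta F) +oo.
    by exists (F, F); split=> /=; rewrite ?Finf ?leey//; exact: subIsetr.
  have [[x [Ax Fx]]|nA] := pselect ((A `&` F) !=set0); last first.
    exists (set0, F); split=> /=; first by move=> x AFx; apply: nA; exists x.
      exact: subIsetr.
    by rewrite hausdorff_gauge0 add0e.
  exists (F, set0); split=> /=; first exact: subIsetr; last first.
    by rewrite hausdorff_gauge0 adde0.
  move=> y [By Fy]; move: Ffin; rewrite /hausdorff_gauge.
  have [F0|_] := eqVneq F set0; first by move: Fx; rewrite F0.
  case: ifP => [diamF _|_]; last by rewrite eqxx.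
  have := le_trans (ediam_ge Fy Fx) diamF; rewrite lee_fin => xyd.
  have := coord_le_norm (y - x) i; rewrite leNgt => /negP; apply.
  apply: (le_lt_trans (norm_le_enorm _)); apply: (le_lt_trans xyd).
  rewrite (lt_le_trans de)// (le_trans _ (ler_norm _))// !mxE.
  by have := AB _ _ Ax By; lra.
have [->|Cfin] := eqVneq (hausdorff d (A `|` B)) +oo; first exact: leey.
have fin C : C `<=` A `|` B -> hausdorff d C \is a fin_num.
  move=> CAB; rewrite ge0_fin_numE ?hausdorff_ge0//.
  by rewrite (le_lt_trans (le_hausdorff d CAB))// ltey.
have finp C (delta : R) : (0 < delta)%R -> C `<=` A `|` B ->
    hausdorff_pre d delta C \is a fin_num.
  move=> d0 CAB; rewrite ge0_fin_numE; last first.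
    exact/cover_outer_ge0/hausdorff_gauge_ge0.
  apply: (le_lt_trans (hausdorff_pre_le d C d0)).
  by have := fin _ CAB; rewrite ge0_fin_numE ?hausdorff_ge0.
have finA := fin A (@subsetUl _ _ _); have finB := fin B (@subsetUr _ _ _).
rewrite -leeBrDr//; apply: ge_ereal_sup => _ [d1 /= d10 <-].
rewrite leeBrDr// -leeBrDl; last by apply: finp => //; exact: subsetUl.
apply: ge_ereal_sup => _ [d2 /= d20 <-].
rewrite leeBrDl; last by apply: finp => //; exact: subsetUl.
pose d0 : R := (Num.min (e / 2) (Num.min d1 d2))%R.
have d00 : (0 < d0)%R by rewrite !lt_min divr_gt0// d10 d20.
have d0e : (d0 < e)%R.
  by rewrite (@le_lt_trans _ _ (e / 2)%R) ?ge_min ?lexx// ltr_pdivrMr// ltr_pMr// ltr1n.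
apply: le_trans (pre _ d00 d0e); apply: leeD; apply: hausdorff_pre_anti;
  by rewrite /d0 !ge_min lexx ?orbT.
Qed.

Lemma hausdorff_half_space d i (c : R) :
  (hausdorff d).-caratheodory [set x : 'rV[R]_n | (x 0 i <= c)%R].
Proof.
apply: le_caratheodory_measurable => X.
apply: (@metric_caratheodory_le R _ (hausdorff d) (fun x : 'rV[R]_n => (x 0 i)%R)).
by move=> A B e e0; exact: hausdorff_separated.
Qed.

Lemma box_gauge_box (a b : 'rV[R]_n) :
  box_gauge (box a b) <= (\prod_(i < n) `|b 0 i - a 0 i|)%:E.
Proof.
rewrite /box_gauge; case: eqP => [_|/eqP/set0P[x abx]].
  by rewrite lee_fin prodr_ge0.
apply: ereal_inf_lbound; exists (a, b) => //=; congr EFin.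
apply: eq_bigr => i _; have /andP[ax xb] := abx i.
by rewrite ger0_norm// subr_ge0 (le_trans (ltW ax)).
Qed.

(** A half-space cuts a box into two boxes whose volumes add up. *)
Lemma box_gauge_split i (c : R) (F : set 'rV[R]_n) :
  box_gauge (F `&` [set x | (x 0 i <= c)%R]) +
  box_gauge (F `&` ~` [set x | (x 0 i <= c)%R]) <= box_gauge F.
Proof.
set H := [set x : 'rV[R]_n | (x 0 i <= c)%R].
have [F1|/set0P[x [Fx xc]]] := eqVneq (F `&` H) set0.
  rewrite F1 box_gauge0 add0e (_ : F `&` _ = F)//; apply/setIidPl => x Fx Hx.
  by have : (F `&` H) x by []; rewrite F1.
have [F2|/set0P[y [Fy yc]]] := eqVneq (F `&` ~` H) set0.
  rewrite F2 box_gauge0 adde0 (_ : F `&` _ = F)//; apply/setIidPl => y Fy.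
  by apply: contrapT => Hy; have : (F `&` ~` H) y by []; rewrite F2.
rewrite [leRHS]/box_gauge; case: eqP => [F0|_]; first by move: Fx; rewrite F0.
apply: le_ereal_inf_tmp => _ [[a b] /= Fab <-].
move: yc; rewrite /H /= => /negP; rewrite -ltNge => yc.
have abx := Fx; have aby := Fy; rewrite Fab in abx aby.
have ac : (a 0 i < c)%R by have /andP[h _] := abx i; exact: lt_le_trans h xc.
have cb : (c < b 0 i)%R by have /andP[_ h] := aby i; exact: lt_le_trans yc h.
have ab j : (a 0 j <= b 0 j)%R by have /andP[h1 h2] := abx j; exact: le_trans (ltW h1) h2.
pose b' : 'rV[R]_n := (\row_j (if j == i then c else b 0 j))%R.
pose a' : 'rV[R]_n := (\row_j (if j == i then c else a 0 j))%R.
have E1 : F `&` H = box a b'.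
  rewrite Fab; apply/seteqP; split=> z /=.
    by move=> [abz zc] j; rewrite mxE; case: eqP => [->|_]//; rewrite zc andbT; have /andP[] := abz i.
  move=> abz; have := abz i; rewrite mxE eqxx => /andP[az zc]; split=> // j.
  have := abz j; rewrite mxE; case: eqP => // -> /andP[-> h].
  by rewrite (le_trans h)// ltW.
have E2 : F `&` ~` H = box a' b.
  rewrite Fab; apply/seteqP; split=> z /=.
    move=> [abz /negP]; rewrite -ltNge => zc j; rewrite mxE; case: eqP => [->|_]//.
    by rewrite zc; have /andP[] := abz i.
  move=> abz; have := abz i; rewrite mxE eqxx => /andP[az zc]; split=> [j|].
    have := abz j; rewrite mxE; case: eqP => // -> /andP[h ->].
    by rewrite andbT (lt_trans ac).
  by apply/negP; rewrite -ltNge.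
rewrite E1 E2; apply: le_trans (leeD (box_gauge_box _ _) (box_gauge_box _ _)) _.
have prod_i (g : 'I_n -> R) : (\prod_j g j = g i * \prod_(j < n | j != i) g j)%R.
  by rewrite (bigD1 i).
rewrite lee_fin !prod_i !mxE eqxx le_eqVlt; apply/orP; left; apply/eqP.
rewrite !ger0_norm ?subr_ge0 ?ltW//.
set P := (\prod_(j < n | j != i) (b 0 j - a 0 j))%R.
have -> : (\prod_(j < n | j != i) `|b' 0%R j - a 0%R j|)%R = P.
  by apply: eq_bigr => j ji; rewrite mxE (negbTE ji) ger0_norm// subr_ge0.
have -> : (\prod_(j < n | j != i) `|b 0 j - a' 0 j|)%R = P.
  by apply: eq_bigr => j ji; rewrite mxE (negbTE ji) ger0_norm// subr_ge0.
by ring.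
Qed.

Lemma lebesgue_half_space i (c : R) :
  (@lebesgue_outer R n).-caratheodory [set x : 'rV[R]_n | (x 0 i <= c)%R].
Proof.
apply: le_caratheodory_measurable => X.
set H := [set x : 'rV[R]_n | (x 0 i <= c)%R].
have XE : X = (X `&` H) `|` (X `&` ~` H) by rewrite -setIUr setUCr setIT.
rewrite {3}XE.
apply: cover_outer_split => F; first exact: box_gauge_ge0.
exists (F `&` H, F `&` ~` H) => /=; split; last exact: box_gauge_split.
  by move=> x [[_ Hx] Fx].
by move=> x [[_ Hx] Fx].
Qed.

End half_spaces.

Section borel.
Context (R : realType) (n : nat) (mu : {outer_measure set 'rV[R]_n -> \bar R}).
Hypothesis half_space_measurable : forall i (c : R),
  mu.-caratheodory [set x : 'rV[R]_n | x 0 i <= c].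

Let T := caratheodory_type mu.

(** Every open set is the union of the cubes with rational center that it
    contains. *)
Lemma open_caratheodory (U : set 'rV[R]_n) : open U -> measurable (U : set T).
Proof.
move=> /open_distP oU.
pose cube (q : {ffun 'I_n -> rat} * nat) : set T :=
  \bigcap_(i : 'I_n) (~` [set x : 'rV[R]_n | x 0 i <= ratr (q.1 i) - q.2.+1%:R^-1]
    `&` [set x : 'rV[R]_n | x 0 i <= ratr (q.1 i) + q.2.+1%:R^-1]).
pose F q : set T := if pselect (cube q `<=` U) then cube q else set0.
have -> : U = \bigcup_q F q.
  apply/seteqP; split=> [x Ux|x [q _]]; last first.
    by rewrite /F; case: pselect => // h /h.
  have [d d0 hd] := oU x Ux.
  have [N hN] : exists N : nat, N.+1%:R^-1 + N.+1%:R^-1 < d.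
    exists (Num.truncn (d / 2)^-1); rewrite [ltRHS]splitr.
    by rewrite ltrD// -[ltRHS]invrK ltf_pV2 ?posrE ?invr_gt0 ?divr_gt0// truncnS_gt.
  have /choice[q hq] (i : 'I_n) : exists q : rat,
      x 0 i - N.+1%:R^-1 < ratr q < x 0 i + N.+1%:R^-1.
    have [|q] := @rat_in_itvoo R (x 0 i - N.+1%:R^-1) (x 0 i + N.+1%:R^-1).
      by rewrite ltrBlDr -addrA ltrDl addr_gt0.
    by rewrite in_itv/=; exists q.
  have cU : cube ([ffun i => q i], N) `<=` U.
    move=> y hy; apply: hd; apply: (le_lt_trans _ hN).
    rewrite norm_le_coord ?addr_ge0//; apply/forallP => i.
    have [/= /negP] := hy i I; rewrite -ltNge /= !ffunE => h1 h2.
    have /andP[h3 h4] := hq i; rewrite !mxE ler_norml.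
    have key (s t u v : R) : u - v < s -> s <= u + v -> t - v < u -> u < t + v ->
      - (v + v) <= s - t <= v + v by move=> *; apply/andP; split; lra.
    exact: key h1 h2 h3 h4.
  exists ([ffun i => q i], N) => //; rewrite /F; case: pselect => // _ i _ /=.
  rewrite !ffunE; have /andP[h1 h2] := hq i; split; last by rewrite -lerBlDr ltW.
  by apply/negP; rewrite -ltNge ltrBlDr.
apply: countable_bigcupT_measurable => [|q]; first exact: countableP.
rewrite /F; case: pselect => [h|_] /=; last exact: measurable0.
apply: fin_bigcap_measurable => [|i _]; first exact: finite_finset.
by apply: measurableI; [apply: measurableC|]; exact: half_space_measurable.
Qed.

Lemma closed_caratheodory (C : set 'rV[R]_n) : closed C -> measurable (C : set T).
Proof.
by move=> /closed_openC/open_caratheodory/measurableC; rewrite setCK.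
Qed.

Lemma continuous_caratheodory (C : set 'rV[R]_n) (f : 'rV[R]_n -> R) : closed C ->
  (forall x, C x -> f @ within C (nbhs x) --> f x) ->
  measurable_fun (C : set T) (f : T -> R).
Proof.
move=> cC /subspace_continuousP cf.
have mC := closed_caratheodory cC.
apply: (measurability _ (measurable_realfun.RGenOInfty.measurableE R)).
move=> _ [_ [a ->] <-].
have oC : open ((f : subspace C -> R) @^-1` `]a, +oo[%classic).
  by move/continuousP : cf; apply; exact: rray_open.
have [V oV VD] := (open_subspaceP _ _).1 oC.
rewrite setIC -VD; apply: measurableI => //; exact: open_caratheodory.
Qed.

End borel.

(** * Covering a cube by boxes *)

Section nat_cover.
Import finmap.

Lemma compact_nat_cover (T : ptopologicalType) (A : set T) (O : nat -> set T) :
  compact A -> (forall k, open (O k)) -> A `<=` \bigcup_k O k ->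
  exists N, forall x, A x -> exists2 k, (k < N)%N & O k x.
Proof.
move=> cA oO AO.
have [D' _ covD] : finite_subset_cover setT O A.
  by move: cA; rewrite compact_cover; apply.
exists (\max_(l <- D') l).+1 => x /covD[k kD Ok]; exists k => //.
by rewrite ltnS (big_rem k)//= leq_maxl.
Qed.

End nat_cover.

Section cube_cover.
Context {R : realType}.

Lemma card_nat_interval M (P : pred 'I_M) (u w : R) : 0 <= w ->
  (forall j, P j -> u < j%:R < u + w) -> #|P|%:R <= w + 1.
Proof.
move=> w0 hP; have [j0 Pj0|P0] := pickP P; last by rewrite eq_card0// addr_ge0.
have [m Pm mmin] := arg_minnP (fun j : 'I_M => j : nat) Pj0.
pose t := Num.truncn w.
have jt j : P j -> (j - m <= t)%N.
  move=> Pj; rewrite truncn_ge_nat// natrB ?mmin//.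
  by have /andP[_ h1] := hP _ Pj; have /andP[h2 _] := hP _ Pm; lra.
have inj : {in [set j | P j]%SET &, injective (fun j : 'I_M => inord (j - m) : 'I_t.+1)}.
  move=> j k; rewrite !inE => Pj Pk /(congr1 val); rewrite /= !inordK ?ltnS ?jt//.
  by move=> /(congr1 (addn^~ m)); rewrite !subnK ?mmin// => /val_inj.
have := card_in_imset inj; rewrite cardsE => <-.
apply: (@le_trans _ _ (t.+1)%:R).
  by rewrite ler_nat -[leqRHS]card_ord max_card.
by rewrite -natr1 lerD2r truncn_le.
Qed.

(** Counting the points of the lattice of mesh 1/M.+1 box by box: a box with sides
    w_i contains at most the product of the M.+1 w_i + 1. *)
Lemma lattice_count d N M (a b : 'I_N -> 'rV[R]_d) :
  (forall k i, a k 0 i <= b k 0 i) ->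
  (forall x : 'rV[R]_d, (forall i, 0 <= x 0 i <= 1) ->
     exists k, forall i, a k 0 i < x 0 i < b k 0 i) ->
  1 <= \sum_k \prod_i (b k 0 i - a k 0 i + M.+1%:R^-1).
Proof.
move=> ab cov; set m : R := M.+1%:R; have m0 : 0 < m by [].
pose g k i (j : 'I_M.+1) := (a k 0 i * m < j%:R < b k 0 i * m).
suff h : m ^+ d <= \sum_k \prod_i (m * (b k 0 i - a k 0 i) + 1).
  rewrite -(ler_pM2l (exprn_gt0 d m0)) mulr1 (le_trans h)// mulr_sumr.
  apply: ler_sum => k _; rewrite le_eqVlt; apply/orP; left; apply/eqP.
  rewrite -[X in m ^+ X](card_ord d) -prodr_const -big_split /=.
  by apply: eq_bigr => i _; rewrite [RHS]mulrDr mulfV// lt0r_neq0.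
have -> : m ^+ d = \sum_(f : {ffun 'I_d -> 'I_M.+1}) 1.
  by rewrite sumr_const card_ffun !card_ord natrX.
apply: (@le_trans _ _ (\sum_(f : {ffun 'I_d -> 'I_M.+1}) \sum_k
    \prod_i (g k i (f i))%:R)).
  apply: ler_sum => f _; have [|k hk] := cov (\row_i ((f i)%:R / m)).
    move=> i; rewrite mxE; apply/andP; split; first by rewrite divr_ge0// ltW.
    by rewrite ler_pdivrMr// mul1r ler_nat ltnW.
  rewrite (bigD1 k)//= [X in X + _]big1 => [|i _].
    by rewrite lerDl sumr_ge0// => l _; rewrite prodr_ge0.
  by have := hk i; rewrite mxE ltr_pdivlMr// ltr_pdivrMr// /g => ->.
rewrite exchange_big /=; apply: ler_sum => k _.
rewrite -(bigA_distr_bigA (fun i (j : 'I_M.+1) => (g k i j)%:R : R)).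
apply: ler_prod => i _; rewrite sumr_ge0//= -natr_sum.
have -> : (\sum_(j < M.+1) g k i j = #|g k i|)%N.
  by rewrite -sum1_card [RHS]big_mkcond; apply: eq_bigr => j _;
    rewrite -[j \in _]/(g k i j); case: (g k i j).
apply: (card_nat_interval (u := a k 0 i * m)).
  by rewrite mulr_ge0 ?subr_ge0// ltW.
by move=> j /andP[h1 h2]; rewrite h1 /=; move: h2; lra.
Qed.

(** Let the mesh of the lattice tend to 0. *)
Lemma unit_cube_cover d N (a b : 'I_N -> 'rV[R]_d) :
  (forall k i, a k 0 i <= b k 0 i) ->
  (forall x : 'rV[R]_d, (forall i, 0 <= x 0 i <= 1) ->
     exists k, forall i, a k 0 i < x 0 i < b k 0 i) ->
  1 <= \sum_k \prod_i (b k 0 i - a k 0 i).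
Proof.
move=> ab cov.
have h : (fun M => \sum_k \prod_i (b k 0 i - a k 0 i + @harmonic R M)) @ \oo -->
    \sum_k \prod_i (b k 0 i - a k 0 i).
  apply: cvg_bigsum => k _; apply: cvg_bigprod => i _.
  rewrite -[X in _ --> X]addr0.
  by apply: cvgD; [exact: cvg_cst|exact: cvg_harmonic].
apply: (@closed_cvg _ _ _ _ _ [set z : R | 1 <= z] _ _ _ h); first exact: closed_ge.
by apply: nearW => M; exact: lattice_count.
Qed.

Definition cube d (c : 'rV[R]_d) (r : R) : set 'rV[R]_d :=
  [set x | forall i, c 0 i <= x 0 i <= c 0 i + r].

Lemma cube_closed d (c : 'rV[R]_d) (r : R) : closed (cube c r).
Proof.
rewrite (_ : cube c r = \bigcap_(i : 'I_d) ((fun x : 'rV[R]_d => x 0 i) @^-1`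
    `[c 0 i, c 0 i + r]%classic)).
  apply: closed_bigI => i _; apply: preimage_closed; last exact: itv_closed.
  by move=> y _; exact: coord_continuous.
apply/seteqP; split=> x hx i; first by move=> _ /=; rewrite in_itv/=; exact: hx.
by have := hx i I; rewrite /= in_itv.
Qed.

Lemma cube_cover_finite d N (a b : 'I_N -> 'rV[R]_d) c (r : R) : 0 < r ->
  (forall k i, a k 0 i <= b k 0 i) ->
  (forall x, cube c r x -> exists k, forall i, a k 0 i < x 0 i < b k 0 i) ->
  r ^+ d <= \sum_k \prod_i (b k 0 i - a k 0 i).
Proof.
move=> r0 ab cov.
have := @unit_cube_cover d N (fun k => r^-1 *: (a k - c)) (fun k => r^-1 *: (b k - c)).
have -> : \sum_k \prod_i ((r^-1 *: (b k - c)) 0 i - (r^-1 *: (a k - c)) 0 i) =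
    (r ^+ d)^-1 * \sum_k \prod_i (b k 0 i - a k 0 i).
  rewrite mulr_sumr; apply: eq_bigr => k _.
  rewrite -exprVn -[X in _ ^+ X](card_ord d) -prodr_const -big_split /=.
  by apply: eq_bigr => i _; rewrite !mxE; ring.
rewrite ler_pdivlMl ?exprn_gt0// mulr1; apply => [k i|x hx].
  by rewrite !mxE ler_pM2l ?invr_gt0// lerD2r.
have [|k hk] := cov (c + r *: x).
  move=> i; have /andP[x0 x1] := hx i; rewrite !mxE lerDl mulr_ge0 ?(ltW r0)//=.
  by rewrite lerD2l ler_piMr// ltW.
exists k => i; have /andP[h1 h2] := hk i; move: h1 h2; rewrite !mxE => h1 h2.
by rewrite ltr_pdivrMl// ltr_pdivlMl// ltrBlDl ltrBrDl h1.
Qed.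

Lemma prod_enlarge d (s : 'I_d -> R) (e : R) : 0 < e ->
  exists2 h : R, 0 < h & \prod_i (s i + (h + h)) <= \prod_i s i + e.
Proof.
move=> e0.
have h : (fun M => \prod_i (s i + (@harmonic R M + @harmonic R M))) @ \oo -->
    \prod_i s i.
  apply: cvg_bigprod => i _; rewrite -[X in _ --> X]addr0 -[X in _ --> _ + X]addr0.
  by apply: cvgD; [exact: cvg_cst|apply: cvgD; exact: cvg_harmonic].
have /cvgrPdist_le/(_ _ e0)[M _ /(_ M (leqnn M)) /= hM] := h.
exists (@harmonic R M); first by rewrite /harmonic invr_gt0.
by rewrite -lerBlDl (le_trans (ler_norm _))// distrC.
Qed.

(** v k stands for the gauge of F k: whenever it is finite, F k lies in a closed box
    of almost that volume. Slightly larger open boxes still cover the cube, and by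
    compactness finitely many of them do. *)
Lemma cube_cover_sum d c (r : R) (F : nat -> set 'rV[R]_d) (v : nat -> \bar R) :
  0 < r -> (forall k, 0 <= v k)%E ->
  (forall k (e : R), 0 < e -> (v k < +oo)%E -> exists a b : 'rV[R]_d,
    [/\ forall i, a 0 i <= b 0 i,
        forall x, F k x -> forall i, a 0 i <= x 0 i <= b 0 i &
        ((\prod_i (b 0 i - a 0 i))%:E <= v k + e%:E)%E]) ->
  cube c r `<=` \bigcup_k F k ->
  ((r ^+ d)%:E <= \sum_(k <oo) v k)%E.
Proof.
move=> r0 v0 hF cov.
have [->|vfin] := eqVneq (\sum_(k <oo) v k)%E +oo%E; first exact: leey.
have {}vfin : (\sum_(k <oo) v k < +oo)%E by rewrite ltey.
have vk k : (v k < +oo)%E.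
  apply: le_lt_trans vfin; apply: le_trans (nneseries_lim_ge k.+1 _) => //.
  by rewrite big_nat_recr//= leeDr// sume_ge0.
apply/lee_addgt0Pr => e e0.
have ek k : 0 < e / (2 ^ k.+1)%:R by rewrite divr_gt0// ltr0n expn_gt0.
have /choice[ab hab] k : exists ab : 'rV[R]_d * 'rV[R]_d,
  [/\ forall i, ab.1 0 i <= ab.2 0 i,
      forall x, F k x -> forall i, ab.1 0 i < x 0 i < ab.2 0 i &
      ((\prod_i (ab.2 0 i - ab.1 0 i))%:E <= v k + (e / (2 ^ k.+1)%:R)%:E)%E].
  have e2 : 0 < e / (2 ^ k.+1)%:R / 2 by rewrite divr_gt0.
  have [a [b [hab hF' hv]]] := hF k _ e2 (vk k).
  have [h h0 hh] := prod_enlarge (fun i => b 0 i - a 0 i) e2.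
  exists (a - const_mx h, b + const_mx h) => /=; split.
  - by move=> i; rewrite !mxE lerD// lerNl (le_trans _ (ltW h0))// lerNl oppr0 ltW.
  - move=> x Fx i; have /andP[h1 h2] := hF' x Fx i; rewrite !mxE.
    by rewrite ltrBlDr (le_lt_trans h1) ?ltrDl// (le_lt_trans h2) ?ltrDl.
  - apply: (@le_trans _ _ (\prod_i (b 0 i - a 0 i) + e / (2 ^ k.+1)%:R / 2)%:E).
      rewrite lee_fin; apply: le_trans hh; rewrite le_eqVlt; apply/orP; left.
      by apply/eqP; apply: eq_bigr => i _; rewrite !mxE; ring.
    rewrite EFinD; apply: le_trans (leeD2r _ hv) _.
    by rewrite -addeA -EFinD -splitr.
pose O k : set 'rV[R]_d := [set x | forall i, (ab k).1 0 i < x 0 i < (ab k).2 0 i].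
have oO k : open (O k).
  rewrite openE => x hx.
  have hi (i : 'I_d) :
      nbhs x (fun y : 'rV[R]_d => (ab k).1 0 i < y 0 i < (ab k).2 0 i).
    have : nbhs (x 0 i) `](ab k).1 0 i, (ab k).2 0 i[%classic.
      by apply: open_nbhs_nbhs; split; [exact: itv_open|rewrite /= in_itv/=; exact: hx].
    move=> /(@coord_continuous R 1 d 0 i x) h.
    by apply: (@filterS _ (nbhs x) _ _ _ _ h) => y /=; rewrite in_itv.
  exact: filter_forall hi.
have cC : compact (cube c r).
  apply: (@bounded_closed_compact).
    apply/bounded_normP; exists (`|c| + r); first by rewrite ltr_wpDl.
    move=> x hx; rewrite norm_le_coord ?addr_ge0 ?(ltW r0)//; apply/forallP => i.
    have := hx i; have := coord_le_norm c i; rewrite !ler_norml => /andP[h1 h2] /andP[h3 h4].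
    by apply/andP; split; lra.
  exact: cube_closed.
have [N covN] : exists N, forall x, cube c r x -> exists2 k, (k < N)%N & O k x.
  apply: compact_nat_cover => // x /cov[k _ Fx].
  by exists k => //; have [_ h _] := hab k; exact: h.
have := @cube_cover_finite d N (fun k => (ab k).1) (fun k => (ab k).2) c r r0.
have h1 (k : 'I_N) i : (ab k).1 0 i <= (ab k).2 0 i by have [h _ _] := hab k.
move=> /(_ h1) h2.
have {h2} : r ^+ d <= \sum_(k < N) \prod_i ((ab k).2 0 i - (ab k).1 0 i).
  by apply: h2 => x /covN[k kN Ok]; exists (Ordinal kN).
rewrite -lee_fin => h2; apply: (le_trans h2); rewrite -sumEFin.
apply: (le_trans _ (epsilon_trick xpredT v0 (ltW e0))).
apply: (@le_trans _ _ (\sum_(k < N) (v k + (e / (2 ^ k.+1)%:R)%:E))%E).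
  by apply: lee_sum => k _; have [_ _] := hab k.
rewrite -(big_mkord xpredT (fun k => v k + (e / (2 ^ k.+1)%:R)%:E)%E).
apply: nneseries_lim_ge => k _ _.
by rewrite adde_ge0// lee_fin ltW.
Qed.

End cube_cover.

(** * Volume of a body and area of its boundary *)

Section lebesgue_bounds.
Local Open Scope ereal_scope.
Context (R : realType) (n : nat).

Lemma cover_outer_finType (T : Type) (gauge : set T -> \bar R) (I : finType)
    (P : I -> set T) (A : set T) :
  (forall F, 0 <= gauge F) -> gauge set0 = 0 -> A `<=` \bigcup_i P i ->
  cover_outer gauge A <= \sum_i gauge (P i).
Proof.
move=> g0 g00 AP.
pose F k : set T := oapp (P \o enum_val) set0 (insub k : option 'I_#|I|).
have AF : A `<=` \bigcup_k F k.
  move=> x /AP[i _ Pix]; exists (enum_rank i) => //.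
  by rewrite /F valK /= enum_rankK.
apply: (le_trans (le_cover_outer_series _ AF)).
apply: lime_le; first by apply: is_cvg_nneseries.
exists #|I| => // N /= IN.
have -> : \sum_i gauge (P i) = \sum_(k < #|I|) gauge (F k).
  rewrite (reindex (@enum_val I predT)) /=; last first.
    by apply: onW_bij; exact: enum_val_bij.
  by apply: eq_bigr => k _; rewrite /F valK.
rewrite -(big_mkord xpredT (fun k => gauge (F k))) (big_cat_nat (leq0n _) IN) /=.
rewrite [X in _ + X]big_nat_cond [X in _ + X]big1 ?adde0// => k /andP[/andP[Ik _] _].
by rewrite /F insubF//= ltnNge Ik.
Qed.

Lemma lebesgue_bounded (A : set 'rV[R]_n) (M : R) : (0 < M)%R ->
  (forall x, A x -> (`|x| <= M)%R) -> lebesgue_outer A < +oo.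
Proof.
move=> M0 AM; pose B := box (const_mx (- (M + 1)) : 'rV[R]_n)%R (const_mx M)%R.
have AB : A `<=` \bigcup_(_ : unit) B.
  move=> x Ax; exists tt => // i; rewrite !mxE.
  have := le_trans (coord_le_norm x i) (AM _ Ax); rewrite ler_norml => /andP[h1 h2].
  by rewrite h2 andbT (lt_le_trans _ h1)// ltrN2 ltrDl.
apply: (le_lt_trans (cover_outer_finType (@box_gauge_ge0 R n) (@box_gauge0 R n) AB)).
rewrite big_const card_unit /= adde0.
exact: (le_lt_trans (box_gauge_box _ _) (ltry _)).
Qed.

Lemma lebesgue_cube_ge (c : 'rV[R]_n) (r : R) : (0 < n)%N -> (0 < r)%R ->
  (r ^+ n)%:E <= lebesgue_outer (cube c r).
Proof.
move=> n0 r0; apply: le_ereal_inf_tmp => _ [F /= cF <-].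
apply: cube_cover_sum cF => // k; first exact: box_gauge_ge0.
move=> e e0 gk; have g0 := @box_gauge_ge0 R n (F k).
have [F0|/set0P[x Fx]] := eqVneq (F k) set0.
  exists 0%R, 0%R; split=> // [x|]; first by rewrite F0.
  rewrite (_ : (\prod_i _)%R = 0%R); last first.
    by rewrite (bigD1 (Ordinal n0))//= !mxE subrr mul0r.
  by rewrite adde_ge0// lee_fin ltW.
move: gk g0; rewrite /box_gauge; case: eqP => [F0|_]; first by move: Fx; rewrite F0.
set S := [set _ | _ in _] => gk g0.
have Sfin : ereal_inf S \is a fin_num by rewrite ge0_fin_numE.
have [_ [[a b] /= Fab <-] hab] := lb_ereal_inf_adherent e0 Sfin.
exists a, b; split=> [i|y|]; last exact: ltW.
  have := Fx; rewrite Fab => /(_ i)/andP[h1 h2].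
  exact: le_trans (ltW h1) h2.
by rewrite Fab => hy i; have /andP[h1 ->] := hy i; rewrite ltW.
Qed.

End lebesgue_bounds.

Section area_bounds.
Local Open Scope ereal_scope.
Context (R : realType).

Lemma ball_volume_gt0 d : (0 < ball_volume R d)%R.
Proof.
have [m dm] := ubnP d; elim: m d dm => // m IH [|[|d]] dm //.
change (0 < 2 * pi / d.+2%:R * ball_volume R d)%R.
by rewrite !mulr_gt0 ?pi_gt0 ?invr_gt0 ?ltr0n// IH// -ltnS (ltn_trans _ dm).
Qed.

(** A set of diameter D projects into a cube of side 2 D. *)
Lemma hausdorff_projection_ge d (A : set 'rV[R]_d.+1) (c : 'rV[R]_d) (r : R) :
  (0 < d)%N -> (0 < r)%R ->
  (forall z, cube c r z -> exists2 x, A x & forall l, x 0%R (lift ord0 l) = z 0%R l) ->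
  (r ^+ d * ball_volume R d / 4 ^+ d)%:E <= hausdorff d A.
Proof.
move=> d0 r0 hA; have v0 := ball_volume_gt0 d.
set v := ball_volume R d in v0 *; pose q : R := (4 ^+ d / v)%R.
have q0 : (0 < q)%R by rewrite divr_gt0// exprn_gt0.
apply: le_trans (hausdorff_pre_le d A ltr01).
apply: le_ereal_inf_tmp => _ [F /= AF <-].
have g0 k : 0 <= hausdorff_gauge d 1 (F k) by exact: hausdorff_gauge_ge0.
pose pr (x : 'rV[R]_d.+1) : 'rV[R]_d := (\row_l x 0 (lift ord0 l))%R.
have := @cube_cover_sum R d c r (fun k => pr @` F k)
  (fun k => q%:E * hausdorff_gauge d 1 (F k)) r0.
rewrite nneseriesZl => [|*]; last exact: g0.
have -> : (r ^+ d * v / 4 ^+ d)%R = (q^-1 * r ^+ d)%R.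
  by rewrite /q invf_div; ring.
move=> H; rewrite EFinM lee_pdivrMl//; apply: H.
- by move=> k; rewrite mule_ge0// lee_fin ltW.
- move=> k e e0 gk.
  have [F0|/set0P[x Fx]] := eqVneq (F k) set0.
    exists 0%R, 0%R; split=> // [x|]; first by rewrite F0 image_set0.
    rewrite (_ : (\prod_i _)%R = 0%R); last first.
      by rewrite (bigD1 (Ordinal d0))//= !mxE subrr mul0r.
    by rewrite adde_ge0// ?mule_ge0// lee_fin ltW.
  move: gk; rewrite /hausdorff_gauge; case: eqP => [F0|_]; first by move: Fx; rewrite F0.
  case: ifP => [diamF _|_]; last by rewrite gt0_muley// lte_fin.
  set D := fine (ediam (F k)).
  have D0 : (0 <= D)%R.
    by rewrite fine_ge0// (le_trans _ (ediam_ge Fx Fx))// lee_fin enorm_ge0.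
  have DE : ediam (F k) = D%:E.
    rewrite fineK// ge0_fin_numE; first exact: le_lt_trans diamF (ltry _).
    by rewrite (le_trans _ (ediam_ge Fx Fx))// lee_fin enorm_ge0.
  exists (pr x - const_mx D)%R, (pr x + const_mx D)%R; split.
  - by move=> i; rewrite !mxE; lra.
  - move=> _ [y Fy <-] i; rewrite !mxE.
    have := le_trans (coord_le_norm (y - x)%R (lift ord0 i)) (norm_le_enorm _).
    have := ediam_ge Fy Fx; rewrite DE lee_fin => h1 h2.
    have := le_trans h2 h1; rewrite !mxE ler_norml => /andP[h3 h4].
    have key (s t u : R) : (- u <= s - t -> s - t <= u -> t - u <= s <= t + u)%R.
      by move=> *; apply/andP; split; lra.
    exact: key h3 h4.
  - rewrite -EFinM -EFinD lee_fin -[leLHS]addr0 lerD ?(ltW e0)//.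
    rewrite le_eqVlt; apply/orP; left; apply/eqP.
    rewrite (eq_bigr (fun=> 4 * (D / 2))%R) => [|i _]; last by rewrite !mxE; field.
    rewrite prodr_const card_ord exprMn /q mulrA; congr (_ * _)%R.
    by rewrite divfK// lt0r_neq0.
- move=> z /hA[x Ax xz]; have [k _ Fx] := AF _ Ax; exists k => //.
  by exists x => //; apply/rowP => l; rewrite mxE xz.
Qed.

End area_bounds.

Section boundary_area.
Context {R : realType}.

(** Every line orthogonal to a coordinate hyperplane that meets a small cube around
    the origin of that hyperplane leaves L at a boundary point, so that the boundary
    projects onto the cube. *)
Lemma boundary_area_gt0 n (L : set 'rV[R]_n) : (2 <= n)%N -> body0 L ->
  (0 < hausdorff n.-1 (boundary L))%E.
Proof.
case: n L => [//|d] L n2 bL /=; have [cL _ _] := bL.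
have [r r0 hr] := body0_ball bL.
have d0 : (0 < d)%N by [].
have rr : 0 < r + r by rewrite addr_gt0.
apply: lt_le_trans (hausdorff_projection_ge (c := const_mx (- r)) d0 rr _).
  by rewrite lte_fin divr_gt0 ?mulr_gt0 ?exprn_gt0 ?ball_volume_gt0.
move=> z hz.
pose p : 'rV[R]_d.+1 := \row_i (if unlift ord0 i is Some l then z 0 l else 0).
have Lp : L p.
  apply: hr; rewrite norm_le_coord ?(ltW r0)//; apply/forallP => i; rewrite mxE.
  case: unliftP => [l _|_]; last by rewrite normr0 ltW.
  have /andP[] := hz l; rewrite mxE => h1 h2; rewrite ler_norml h1 /=.
  by rewrite (le_trans h2)// addKr.
have e0 : delta_mx 0 ord0 != 0 :> 'rV[R]_d.+1.
  by apply/eqP => /rowP/(_ ord0); rewrite !mxE !eqxx => /eqP; rewrite oner_eq0.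
have [t _ Lt] := line_boundary cL Lp e0.
exists (p + t *: delta_mx 0 ord0); first exact: ((body0P _ bL).2 Lt).
by move=> l; rewrite !mxE liftK eqxx /= mulr0 addr0.
Qed.

(** 1/|z| is the value at the direction z/|z| of the linear form phi z, and on the
    other directions phi z is at most the corresponding inverse radius: 1/|z| is a
    maximum of uniformly Lipschitz functions of the direction. *)
Lemma radial_lipschitz n (L : set 'rV[R]_n) phi : body0 L -> polar_map L phi ->
  exists2 C : R, 0 < C & forall x y, boundary L x -> boundary L y ->
    `|x - y| <= C * `| `|x|^-1 *: x - `|y|^-1 *: y|.
Proof.
move=> bL pL; have [cL _ _] := bL.
have [M M0 hM] := compact_norm_bound cL; have [P P0 hP] := polar_bounded bL.
pose k : R := n.+1%:R * P.
have k0 : 0 < k by rewrite mulr_gt0.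
exists (M + M * M * k); first by rewrite addr_gt0// !mulr_gt0.
move=> x y Lx Ly.
set w := fun z : 'rV[R]_n => `|z|^-1 *: z.
have n0 z : boundary L z -> 0 < `|z|.
  by move=> Lz; rewrite normr_gt0; exact: boundary_neq0 bL Lz.
have zM z : boundary L z -> `|z| <= M by move=> /(boundary_sub bL)/hM.
have w1 z : boundary L z -> `|w z| = 1.
  by move=> Lz; rewrite normrZ gtr0_norm ?invr_gt0 ?n0// mulVf// lt0r_neq0// n0.
have inv z z' : boundary L z -> boundary L z' ->
    `|z|^-1 - `|z'|^-1 <= k * `|w z - w z'|.
  move=> Lz Lz'.
  have h1 : dot (phi z) (w z) = `|z|^-1 by rewrite dotZr (polar_map1 pL Lz) mulr1.
  have h2 : dot (phi z) (w z') <= `|z'|^-1.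
    rewrite dotZr -[leRHS]mulr1 ler_wpM2l ?invr_ge0//.
    exact: (polar_map_le pL Lz (boundary_sub bL Lz')).
  apply: (@le_trans _ _ (dot (phi z) (w z - w z'))); first by rewrite dotBr h1 lerD2l lerN2.
  rewrite (le_trans (ler_norm _))// (le_trans (normr_dot _ _))//.
  rewrite ler_wpM2r// ler_pM// ?ler_nat//; apply: hP.
  exact: (polar_map_in pL Lz).
have dif z z' : boundary L z -> boundary L z' ->
    `|z'| - `|z| <= M * M * k * `|w z - w z'|.
  move=> Lz Lz'; have := inv z z' Lz Lz'.
  have zp := n0 z Lz; have zp' := n0 z' Lz'.
  have -> : `|z'| - `|z| = `|z| * `|z'| * (`|z|^-1 - `|z'|^-1).
    by field; rewrite !lt0r_neq0.
  move=> h; have kw : 0 <= k * `|w z - w z'| by rewrite mulr_ge0 ?(ltW k0).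
  apply: (le_trans (ler_wpM2l _ h)); first by rewrite mulr_ge0// ltW.
  by rewrite -[leRHS]mulrA ler_wpM2r// ler_pM ?zM// ltW.
have -> : x - y = `|x| *: (w x - w y) + (`|x| - `|y|) *: w y.
  rewrite scalerBr scalerBl addrA subrK /w !scalerA !mulfV ?scale1r//;
    by rewrite lt0r_neq0// n0.
rewrite (le_trans (ler_normD _ _))// mulrDl lerD//.
  by rewrite normrZ normr_id ler_wpM2r// zM.
rewrite normrZ w1// mulr1 ler_norml; apply/andP; split.
  by rewrite lerNl opprB; exact: dif.
by rewrite distrC; exact: dif.
Qed.

(** The radial image of a face of the cube [-1,1]^n, cut into (M+1)^(n-1) pieces
    of diameter at most c/M, covers part of the boundary; the resulting bound on
    the area does not depend on M. *)
Lemma boundary_area_lty n (L : set 'rV[R]_n) phi : body0 L -> polar_map L phi ->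
  (hausdorff n.-1 (boundary L) < +oo)%E.
Proof.
case: n L phi => [|d] L phi bL pL /=.
  rewrite (_ : boundary L = set0) ?hausdorff_empty ?ltry//.
  apply/seteqP; split=> // x /(boundary_neq0 bL) /eqP; apply.
  by apply/rowP => -[].
have [C C0 hC] := radial_lipschitz bL pL.
pose c : R := d.+1%:R * C * 2.
have c0 : 0 < c by rewrite !mulr_gt0.
have bv0 := ball_volume_gt0 R d.
pose B : R := (d.+1 * 2)%:R * (ball_volume R d * c ^+ d).
apply: (@le_lt_trans _ _ B%:E); last exact: ltry.
apply: ge_ereal_sup => _ [delta /= delta0 <-].
pose M := (Num.truncn (c / delta)).+1.
have M0 : 0 < M%:R :> R by [].
have cM : c / M%:R <= delta.
  by rewrite ler_pdivrMr// mulrC -ler_pdivrMr// ltW// truncnS_gt.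
pose cell (t : R) : 'I_M.+1 := inord (Num.truncn ((t + 1) * (M%:R / 2))).
have cellP (s t : R) : `|s| <= 1 -> `|t| <= 1 -> cell s = cell t -> `|s - t| <= 2 / M%:R.
  have tr (u : R) : `|u| <= 1 ->
      0 <= (u + 1) * (M%:R / 2) /\ (Num.truncn ((u + 1) * (M%:R / 2)) < M.+1)%N.
    rewrite ler_norml => /andP[u1 u2].
    have u0 : 0 <= (u + 1) * (M%:R / 2).
      by rewrite mulr_ge0 ?divr_ge0 ?(ltW M0)//; lra.
    split=> //; rewrite -(ltr_nat R) (le_lt_trans (y := M%:R)) ?ltr_nat//.
    apply: (@le_trans _ _ ((u + 1) * (M%:R / 2))); first by rewrite truncn_le.
    by rewrite mulrCA ler_piMr ?(ltW M0)// ler_pdivrMr// mul1r; lra.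
  move=> /tr[s0 sM] /tr[t0 tM] /(congr1 val); rewrite /cell /= !inordK// => E.
  have := truncn_itv s0; have := truncn_itv t0; rewrite E => /andP[h1 h2] /andP[h3 h4].
  rewrite ler_pdivlMr// -[M%:R]ger0_norm ?(ltW M0)// -normrM.
  rewrite -[(Num.truncn _).+1%:R]natr1 in h2 h4; rewrite ler_norml; apply/andP.
  move: h1 h2 h3 h4; move: (M%:R : R) => m.
  by move: (_%:R) => z *; split; lra.
pose w (x : 'rV[R]_d.+1) := `|x|^-1 *: x.
pose P (j : 'I_d.+1 * bool * {ffun 'I_d -> 'I_M.+1}) : set 'rV[R]_d.+1 :=
  [set x | [/\ boundary L x, x 0 j.1.1 = (-1) ^+ j.1.2 * `|x| &
               forall l, cell (w x 0 (lift j.1.1 l)) = j.2 l]].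
have w_le x i : boundary L x -> `|w x 0 i| <= 1.
  move=> Lx; apply: le_trans (coord_le_norm _ _) _.
  rewrite normrZ gtr0_norm ?invr_gt0 ?normr_gt0 ?(boundary_neq0 bL Lx)//.
  by rewrite mulVf// normr_eq0 (boundary_neq0 bL Lx).
have LP : boundary L `<=` \bigcup_j P j.
  move=> x Lx; have x0 := boundary_neq0 bL Lx.
  have [|[i' i] xi] := @mx_norm_neq0 R 1 d.+1 x.
    by rewrite -[mx_norm x]/`|x| normr_eq0.
  have {}xi : `|x| = `|x 0 i| by rewrite -(ord1 i').
  exists (i, x 0 i < 0, [ffun l => cell (w x 0 (lift i l))]) => //; split=> //=.
    by rewrite xi mulr_sign; case: ltrP => h; [rewrite ltr0_norm// opprK|rewrite ger0_norm].
  by move=> l; rewrite ffunE.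
have diamP j x y : P j x -> P j y -> enorm (x - y) <= c / M%:R.
  move=> [Lx xi xc] [Ly yi yc].
  apply: (le_trans (enorm_le_norm _)).
  rewrite /c -mulrA -mulrA; rewrite ler_wpM2l// (le_trans (hC _ _ Lx Ly))// ler_wpM2l ?(ltW C0)//.
  rewrite norm_le_coord ?divr_ge0 ?(ltW M0)//; apply/forallP => i.
  rewrite [_ 0 i](_ : _ = w x 0 i - w y 0 i); last by rewrite !mxE.
  case: (unliftP j.1.1 i) => [l|] ->; last first.
    rewrite /w !mxE xi yi mulrCA [X in _ - X]mulrCA !mulVf ?normr_eq0
      ?(boundary_neq0 bL Lx) ?(boundary_neq0 bL Ly)//.
    by rewrite subrr normr0 divr_ge0// ltW.
  by apply: cellP; [exact: w_le|exact: w_le|rewrite xc yc].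
have gP j : (hausdorff_gauge d delta (P j) <=
    (ball_volume R d * (c / M%:R / 2) ^+ d)%:E)%E.
  have [P0|/set0P[x Px]] := eqVneq (P j) set0.
    rewrite P0 hausdorff_gauge0 lee_fin mulr_ge0 ?(ltW bv0)// exprn_ge0//.
    by rewrite !divr_ge0// ltW.
  have dP : (ediam (P j) <= (c / M%:R)%:E)%E.
    by apply: ge_ereal_sup => _ [[y z] /= [Py Pz] <-]; rewrite lee_fin; exact: diamP Py Pz.
  have d0 : (0 <= ediam (P j))%E.
    by apply: le_trans (ediam_ge Px Px); rewrite lee_fin enorm_ge0.
  rewrite /hausdorff_gauge; case: eqP => [P0|_]; first by move: Px; rewrite P0.
  rewrite (le_trans dP) ?lee_fin// ler_wpM2l ?(ltW bv0)//.
  rewrite lerXn2r ?nnegrE ?divr_ge0 ?fine_ge0 ?(ltW c0)//.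
  rewrite ler_pM2r ?invr_gt0// -lee_fin fineK//.
  by rewrite ge0_fin_numE// (le_lt_trans dP)// ltry.
apply: (le_trans (cover_outer_finType (hausdorff_gauge_ge0 d delta)
  (hausdorff_gauge0 _ d delta) LP)).
apply: (le_trans (lee_sum _ (fun j _ => gP j))).
rewrite sumEFin lee_fin sumr_const card_prod card_prod card_ffun !card_ord card_bool.
rewrite -[_ *+ _]mulr_natl natrM /B -mulrA ler_wpM2l//.
rewrite mulrCA ler_wpM2l ?(ltW bv0)// natrX -exprMn.
have cM0 : 0 <= c / M%:R / 2 by rewrite !divr_ge0// ltW.
apply: lerXn2r; rewrite ?nnegrE; [by rewrite mulr_ge0|exact: ltW|].
have key (s t u : R) : 0 < t -> s * (u / t / 2) = u * (s / (2 * t)).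
  by move=> t0; field; rewrite lt0r_neq0.
rewrite key//.
rewrite ler_piMr ?(ltW c0)// ler_pdivrMr ?mulr_gt0// mul1r -natrM ler_nat.
by rewrite mul2n -addnn -(addn1 M) leq_add2l.
Qed.

End boundary_area.

(** * The centroid is an interior point *)

Section integral_bounds.
Context d (T : measurableType d) (R : realType) (mu : {measure set T -> \bar R}).
Local Open Scope ereal_scope.

Lemma integrable_bounded (D : set T) (f : T -> R) (M : R) : measurable D ->
  mu D < +oo -> measurable_fun D f -> (forall x, D x -> (`|f x| <= M)%R) ->
  mu.-integrable D (EFin \o f).
Proof.
move=> mD Doo mf fM; apply: measurable_bounded_integrable => //.
exists M; split; first exact: num_real.
by move=> c Mc x Dx /=; exact: le_trans (fM _ Dx) (ltW Mc).
Qed.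

Lemma integral_gt0 (B D : set T) (f : T -> R) (c : R) : measurable D ->
  measurable B -> B `<=` D -> measurable_fun D f -> (0 < c)%R ->
  (forall x, D x -> (0 <= f x)%R) -> (forall x, B x -> (c <= f x)%R) ->
  0 < mu B -> 0 < \int[mu]_(x in D) (f x)%:E.
Proof.
move=> mD mB BD mf c0 f0 cf B0.
have mfD : measurable_fun D (EFin \o f) by exact/measurable_EFinP.
apply: (@lt_le_trans _ _ (c%:E * mu B)); first by rewrite mule_gt0// lte_fin.
rewrite -integral_cst//.
apply: (@le_trans _ _ (\int[mu]_(x in B) (f x)%:E)).
  apply: ge0_le_integral => //.
  - by move=> x _; rewrite lee_fin ltW.
  - exact: measurable_funS mfD.
by apply: ge0_subset_integral => // x Dx; rewrite lee_fin f0.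
Qed.

End integral_bounds.

Section centroid.
Context {R : realType} {n : nat}.
Variable K : set 'rV[R]_n.
Hypotheses (n0 : (0 < n)%N) (cK : compact K) (vK : convex_set K).
Hypothesis iK : interior K !=set0.

Let mu := lebesgueV R n.
Let T := caratheodory_type (@lebesgue_outer R n).

Let measurable_closed (C : set 'rV[R]_n) : closed C -> measurable (C : set T).
Proof. by apply: closed_caratheodory; exact: lebesgue_half_space. Qed.

Let mK : measurable (K : set T).
Proof. exact: (measurable_closed (compact_closed_rV cK)). Qed.

Let Koo : (mu K < +oo)%E.
Proof. by have [M M0 hM] := compact_norm_bound cK; exact: (lebesgue_bounded M0 hM). Qed.

Lemma cube_measure_gt0 (c : 'rV[R]_n) (r : R) : 0 < r -> (0 < mu (cube c r))%E.
Proof.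
move=> r0; apply: lt_le_trans (lebesgue_cube_ge c n0 r0).
by rewrite lte_fin exprn_gt0.
Qed.

Let continuous_mfun (f : 'rV[R]_n -> R) : continuous f ->
  measurable_fun (K : set T) (f : T -> R).
Proof.
move=> cf; apply: continuous_caratheodory.
- exact: lebesgue_half_space.
- exact: compact_closed_rV.
- by move=> x Kx; apply: cvg_trans (cf x); apply: cvg_app; exact: cvg_within.
Qed.

Lemma near_cube (x : 'rV[R]_n) (P : set 'rV[R]_n) : nbhs x P ->
  exists c r, [/\ 0 < r & cube c r `<=` P].
Proof.
move=> /nbhs_distP[d d0 hd]; exists x, (d / 2); split; first by rewrite divr_gt0.
move=> y hy; apply: hd; apply: (@le_lt_trans _ _ (d / 2)).
  rewrite norm_le_coord ?divr_ge0 ?(ltW d0)//; apply/forallP => i.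
  rewrite !mxE ler_norml; have /andP[h1 h2] := hy i.
  by rewrite (le_trans _ (y := 0)) ?oppr_le0 ?divr_ge0 ?(ltW d0)//= ?subr_ge0// lerBlDl.
by rewrite ltr_pdivrMr// ltr_pMr// ltr1n.
Qed.

Let K_gt0 : (0 < mu K)%E.
Proof.
have [x Kx] := iK; have [c [r [r0 hc]]] := near_cube Kx.
apply: lt_le_trans (cube_measure_gt0 c r0) _.
by apply: le_measure; rewrite ?inE//; exact/measurable_closed/cube_closed.
Qed.

(** Otherwise a linear form u, nonpositive on K, has integral 0 over K although it
    is negative around any interior point of K. *)
Lemma centroid_interior : centroid K = 0 -> interior K 0.
Proof.
move=> hc; apply: contrapT => nK0.
have K0 : K !=set0 by have [x /interior_subset Kx] := iK; exists x.
have [u u0 hu] := supporting_hyperplane cK vK K0 nK0.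
have {}hu x : K x -> dot u x <= 0 by move=> /hu; rewrite dot0r.
have [M M0 hM] := compact_norm_bound cK.
have int_coord i : mu.-integrable (K : set T) (fun x : T => ((x : 'rV[R]_n) 0 i)%:E).
  apply: (integrable_bounded mK Koo _ (M := M)) => [|x /hM xM].
    by apply: continuous_mfun; exact: coord_continuous.
  exact: le_trans (coord_le_norm _ _) xM.
have coord0 i : (\int[mu]_(x in (K : set T)) ((x : 'rV[R]_n) 0 i)%:E = 0)%E.
  have := congr1 (fun c : 'rV[R]_n => c 0 i) hc; rewrite !mxE => /eqP.
  rewrite mulf_eq0 invr_eq0 => /orP[/eqP|/eqP].
    move=> /(congr1 (@EFin R)); rewrite fineK ?ge0_fin_numE// => V0.
    by have := K_gt0; rewrite V0 ltxx.
  by rewrite /Rintegral => /(congr1 (@EFin R)); rewrite fineK// integrable_fin_num.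
have dotE : (\int[mu]_(x in (K : set T)) (dot u x)%:E = 0)%E.
  transitivity (\int[mu]_(x in (K : set T))
      (\sum_(i < n) (u 0%R i)%:E * ((x : 'rV[R]_n) 0%R i)%:E))%E.
    by apply: eq_integral => x _; rewrite /dot -sumEFin.
  rewrite integral_sum//; last by move=> i; exact: integrableZl.
  by rewrite big1// => i _; rewrite integralZl// coord0 mule0.
have [y0 Ky0] := iK.
have uy0 : dot u y0 < 0.
  have [d d0 hd] := (nbhs_distP _ _).1 Ky0.
  have nu : 0 < `|u| by rewrite normr_gt0.
  have /hu : K (y0 + (d / 2 / `|u|) *: u).
    apply: hd; rewrite addrAC subrr add0r normrZ gtr0_norm ?divr_gt0//.
    by rewrite divfK ?lt0r_neq0// ltr_pdivrMr// ltr_pMr// ltr1n.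
  rewrite dotDr dotZr -lerBrDr sub0r => h; apply: (le_lt_trans h).
  by rewrite oppr_lt0 mulr_gt0 ?divr_gt0// dot_gt0.
have : nbhs y0 (K `&` [set y | dot u y <= dot u y0 / 2]).
  apply: filterI Ky0 _ => /=.
  have h : 0 < - dot u y0 / 2 by rewrite divr_gt0// oppr_gt0.
  have /cvgrPdist_le/(_ _ h) := @dot_continuous R n u y0.
  apply: filterS => y; rewrite ler_norml => /andP[+ _] /=.
  by move: (dot u y0) (dot u y) => a b; lra.
move=> /near_cube[c [r [r0 hcr]]].
have h : (0 < \int[mu]_(x in (K : set T)) (- dot u x)%:E)%E.
  have mQ : measurable (cube c r : set T) by exact/measurable_closed/cube_closed.
  have QK : cube c r `<=` K by move=> x /hcr[].
  have mu0 : measurable_fun (K : set T) (fun x : T => - dot u x).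
    by apply: measurable_funN; apply: continuous_mfun; exact: dot_continuous.
  have e0 : 0 < - dot u y0 / 2 by rewrite divr_gt0// oppr_gt0.
  have f0 x : K x -> 0 <= - dot u x by move=> /hu; rewrite oppr_ge0.
  have fQ x : cube c r x -> - dot u y0 / 2 <= - dot u x.
    by move=> /hcr[_ /=]; rewrite mulNr lerN2.
  exact: (@integral_gt0 _ T R mu (cube c r) K (fun x : T => - dot u x)
    (- dot u y0 / 2) mK mQ QK mu0 e0 f0 fQ (cube_measure_gt0 c r0)).
have : (\int[mu]_(x in (K : set T)) (- dot u x)%:E = 0)%E.
  under eq_integral do rewrite EFinN -mulN1e.
  rewrite integralZl//; last first.
    apply: (integrable_bounded mK Koo _ (M := n%:R * `|u| * M)) => [|x /hM xM].
      by apply: continuous_mfun; exact: dot_continuous.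
    by rewrite (le_trans (normr_dot _ _))// ler_wpM2l.
  by rewrite dotE mule0.
by move=> h0; rewrite h0 ltxx in h.
Qed.

End centroid.

(** * Limits of weighted geometric means of two densities *)

Section exp_estimate.
Context {R : realType}.

Lemma expR_taylor1 (u : R) : `|expR u - 1 - u| <= u ^+ 2 * expR `|u|.
Proof.
have h1 := expR_ge1Dx u.
have h2 : expR u * (1 - u) <= 1.
  by rewrite -[leRHS](expRxMexpNx_1 u) ler_wpM2l ?expR_ge0// expR_ge1Dx.
rewrite ger0_norm; last by move: h1; lra.
apply: (@le_trans _ _ (u * (expR u - 1))); first by move: h2; lra.
rewrite expr2 -mulrA; have [u0|u0] := ger0P u.
  by rewrite ler_wpM2l//; have := expR_ge0 u; nra.
have : 1 <= expR (- u) by rewrite -[leLHS]expR0 ler_expR oppr_ge0 ltW.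
by move=> h3; nra.
Qed.

(** The limit that differentiates a quotient of integrals at t = 0. *)
Lemma powR_quotient_limit (Z : R -> R) (Z0 D B a : R) : 0 < Z0 ->
  (forall t, `|t| <= 1 -> `|Z t - Z0 + t * D| <= B * t ^+ 2) ->
  (Z t / Z0) `^ (a / t) @[t --> 0^'] --> expR (- (a * D / Z0)).
Proof.
move=> Z0p hZ.
have Z00 : Z 0 = Z0.
  have := hZ 0; rewrite normr0 ler01 => /(_ isT).
  by rewrite mul0r addr0 expr0n mulr0 normr_le0 subr_eq0 => /eqP.
pose h t := Z t / Z0.
have h0 : h 0 = 1 by rewrite /h Z00 mulfV// lt0r_neq0.
have dh : is_derive (0 : R) (1 : R) h (- D / Z0).
  have lim : (fun t : R => t^-1 *: ((h \o shift 0) (t *: (1 : R)) - h 0)) @ 0^' --> - D / Z0.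
    apply/cvgrPdist_le => e e0.
    pose d := Num.min 1 (e * Z0 / (`|B| + 1)).
    have B1 : 0 < `|B| + 1 by rewrite ltr_wpDl.
    have d0 : 0 < d by rewrite lt_min ltr01 divr_gt0// mulr_gt0.
    rewrite near_withinE; apply/nbhs_ballP; exists d => //= t.
    rewrite -ball_normE /= sub0r normrN lt_min => /andP[t1 te] t0.
    rewrite [_ *: 1]mulr1 addr0 h0 /h.
    have -> : - D / Z0 - t^-1 *: (Z t / Z0 - 1) = - ((Z t - Z0 + t * D) / (t * Z0)).
      rewrite -[_ *: _]/(_ * _); field; rewrite t0 lt0r_neq0//.
    rewrite normrN normrM normfV normrM (gtr0_norm Z0p).
    have tp : 0 < `|t| by rewrite normr_gt0.
    rewrite ler_pdivrMr ?mulr_gt0// (le_trans (hZ t (ltW t1)))//.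
    rewrite -(real_normK (num_real t)) expr2.
    rewrite ltr_pdivlMr// in te; move: tp te; move: `|t| => s sp se.
    rewrite [leRHS](_ : _ = e * Z0 * s); last by ring.
    apply: le_trans (ler_wpM2r (ltW sp) (ltW se)).
    rewrite [leRHS](_ : _ = (`|B| + 1) * (s * s)); last by ring.
    by rewrite ler_wpM2r ?mulr_ge0 ?(ltW sp)// (le_trans (ler_norm B))// lerDl.
  split; first by apply/cvg_ex; exists (- D / Z0).
  exact: cvg_lim lim.
have hd : derivable h 0 1 by [].
have lnd : derivable (@ln R) (h 0) 1.
  by rewrite h0; apply: ex_derive; exact: is_derive1_ln.
have ch : h @ (0 : R) --> (1 : R).
  have H : h @ (0 : R) --> h 0.
    exact: (differentiable_continuous ((derivable1_diffP _ _).1 hd)).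
  by rewrite h0 in H.
have lnhd : derivable (@ln R \o h) 0 1.
  apply/(derivable1_diffP _ _).2/differentiable_comp.
    exact: ((derivable1_diffP _ _).1 hd).
  exact: ((derivable1_diffP _ _).1 lnd).
have lnhE : 'D_1 (@ln R \o h) 0 = - D / Z0.
  rewrite -derive1E (derive1_comp hd lnd) !derive1E h0.
  have [_ ->] := dh; have [_ ->] := is_derive1_ln (ltr01 : 0 < 1 :> R).
  by rewrite invr1 mul1r.
have lim : (fun t : R => a * (t^-1 * ln (h t))) @ 0^' --> a * (- D / Z0).
  apply: cvgM; first exact: cvg_cst.
  rewrite -lnhE; have := lnhd; rewrite /derivable /derive.
  have -> : (fun t : R => t^-1 *: ((@ln R \o h \o shift 0) (t *: (1 : R)) - (@ln R \o h) 0))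
      = (fun t => t^-1 * ln (h t)).
    by apply/funext => t /=; rewrite [_ *: 1]mulr1 addr0 h0 ln1 subr0.
  exact.
have -> : - (a * D / Z0) = a * (- D / Z0) by rewrite mulrA mulrN mulNr.
have lime := @cvg_comp _ _ _ _ (@expR R) _ _ _ lim (@continuous_expR R _).
apply: cvg_trans lime; apply: near_eq_cvg.
have hpos : \forall t \near 0^', 0 < h t.
  have /cvgrPdist_lt/(_ _ ltr01)/nbhs_dnbhs := ch.
  by apply: filterS => t; rewrite ltr_norml => /andP[_]; lra.
apply: filterS hpos => t ht.
by rewrite /= /powR gt_eqF//= mulrA.
Qed.

End exp_estimate.

Section geometric_mean.
Context d (T : measurableType d) (R : realType) (mu : {measure set T -> \bar R}).
Variables (X : set T) (p q : T -> R) (c C : R).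
Hypotheses (mX : measurable X) (muX : (0 < mu X < +oo)%E).
Hypotheses (mp : measurable_fun X p) (mq : measurable_fun X q) (c0 : 0 < c).
Hypotheses (pb : forall x, X x -> c <= p x <= C) (qb : forall x, X x -> c <= q x <= C).

Let W x := ln (p x / q x).
Let Z t := \int[mu]_(x in X) (p x * expR (- t * W x)).

Let p0 x : X x -> 0 < p x. Proof. by move=> /pb/andP[+ _]; exact: lt_le_trans. Qed.
Let q0 x : X x -> 0 < q x. Proof. by move=> /qb/andP[+ _]; exact: lt_le_trans. Qed.

Let L := `|ln (C / c)|.

Let W_le x : X x -> `|W x| <= L.
Proof.
move=> Xx; have /andP[p1 p2] := pb Xx; have /andP[q1 q2] := qb Xx.
have [p00 q00] := (p0 Xx, q0 Xx); have C0 : 0 < C by rewrite (lt_le_trans p00).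
rewrite (le_trans _ (ler_norm _))// ler_norml; apply/andP; split.
  rewrite lerNl -lnV ?posrE ?divr_gt0// ler_ln ?posrE ?invr_gt0 ?divr_gt0//.
  by rewrite invf_div ler_pM ?invr_ge0 ?(ltW q00) ?(ltW p00)// lef_pV2.
rewrite ler_ln ?posrE ?divr_gt0//.
by rewrite ler_pM ?invr_ge0 ?(ltW q00) ?(ltW p00)// lef_pV2.
Qed.

Let mW : measurable_fun X W.
Proof.
apply: (eq_measurable_fun (fun x => ln (p x) - ln (q x))).
  by move=> x /[!inE] Xx; rewrite /W ln_div ?posrE ?p0 ?q0.
by apply: measurable_funB; exact: (measurableT_comp (@measurable_ln R)).
Qed.

Let integrableX (f : T -> R) M : measurable_fun X f ->
  (forall x, X x -> `|f x| <= M) -> mu.-integrable X (EFin \o f).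
Proof. by move=> mf; apply: integrable_bounded => //; case/andP: muX. Qed.

Let p_le x : X x -> `|p x| <= C.
Proof.
by move=> Xx; have /andP[_ pC] := pb Xx; rewrite gtr0_norm// p0.
Qed.

Let int_p : mu.-integrable X (EFin \o p).
Proof. exact: integrableX mp p_le. Qed.

Let int_pW : mu.-integrable X (EFin \o (fun x => p x * W x)).
Proof.
apply: (integrableX (M := C * L)); first exact: measurable_funM.
by move=> x Xx; rewrite normrM ler_pM// ?p_le ?W_le.
Qed.

Let int_Z t : mu.-integrable X (EFin \o (fun x => p x * expR (- t * W x))).
Proof.
apply: (integrableX (M := C * expR (`|t| * L))).
  apply: measurable_funM => //; apply: (measurableT_comp (@measurable_expR R)).
  by apply: measurable_funM.
move=> x Xx; rewrite normrM ler_pM// ?p_le// ger0_norm ?expR_ge0//.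
rewrite ler_expR (le_trans (ler_norm _))// normrM normrN.
by rewrite ler_wpM2l// W_le.
Qed.

(** Integrate the Taylor expansion of exp (- t W), W = ln (p / q) being bounded. *)
Lemma geometric_mean_limit a :
  let Z0 := \int[mu]_(x in X) p x in
  (Z t / Z0) `^ (a / t) @[t --> 0^'] -->
    expR (- (a * kullback_leibler mu X p q / Z0)).
Proof.
move=> Z0; pose D := \int[mu]_(x in X) (p x * W x).
rewrite -[kullback_leibler _ _ _ _]/D.
have Z0p : 0 < Z0.
  have h : (0 < \int[mu]_(x in X) (p x)%:E)%E.
    apply: (@integral_gt0 _ T R mu X X p c) => //.
    - by move=> x /p0/ltW.
    - by move=> x /pb/andP[].
    - by case/andP: muX.
  by rewrite fine_gt0// h /= -ge0_fin_numE ?(ltW h)// integrable_fin_num.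
pose B := C * (L ^+ 2 * expR L) * fine (mu X).
apply: (@powR_quotient_limit R Z Z0 D B a Z0p) => t t1.
have C0 : 0 <= C.
  have [x Xx] : X !=set0.
    by apply/set0P/negP => /eqP X0; case/andP: muX; rewrite X0 measure0 ltxx.
  by rewrite (le_trans _ (p_le Xx)).
have i1 : mu.-integrable X (EFin \o (fun x => p x * expR (- t * W x) - p x)).
  exact: (integrableB mX (int_Z t) int_p).
have i2 : mu.-integrable X (EFin \o (fun x => t * (p x * W x))).
  exact: (integrableZl mX t int_pW).
have i3 : mu.-integrable X
    (EFin \o (fun x => p x * expR (- t * W x) - p x + t * (p x * W x))).
  exact: (integrableD mX i1 i2).
have -> : Z t - Z0 + t * D =
    \int[mu]_(x in X) (p x * expR (- t * W x) - p x + t * (p x * W x)).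
  by rewrite RintegralD// RintegralB// RintegralZl.
apply: (le_trans (le_normr_Rintegral mX i3)).
have -> : B * t ^+ 2 = \int[mu]_(x in X) (C * (L ^+ 2 * expR L) * t ^+ 2).
  by rewrite Rintegral_cst// /B; ring.
apply: le_Rintegral => // [||x Xx].
- exact: (integrable_norm i3).
- apply: (integrableX (M := `|C * (L ^+ 2 * expR L) * t ^+ 2|)) => [|x _];
    [exact: measurable_cst|exact: lexx].
have -> : p x * expR (- t * W x) - p x + t * (p x * W x) =
    p x * (expR (- t * W x) - 1 - (- t * W x)) by ring.
rewrite normrM -mulrA ler_pM ?p_le// (le_trans (expR_taylor1 _))//.
have tL : `|- t * W x| <= L.
  by rewrite normrM normrN (le_trans _ (W_le Xx))// ler_piMl.
rewrite [leRHS]mulrAC ler_pM ?sqr_ge0 ?expR_ge0 ?ler_expR//.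
rewrite exprMn sqrrN mulrC ler_wpM2r ?sqr_ge0//.
by rewrite -(real_normK (num_real (W x))) lerXn2r ?nnegrE ?W_le// /L.
Qed.

End geometric_mean.

(** * Affine surface areas *)

Section measure_of_function.
Context d (T : measurableType d) (R : realType) (f : set T -> \bar R).
Hypotheses (f0 : f set0 = 0%E) (f_ge0 : forall A, (0 <= f A)%E).
Hypothesis f_sigma : semi_sigma_additive f.

HB.instance Definition _ := isMeasure.Build d T R f f0 f_ge0 f_sigma.

(** Allows the theorems on integrals against a measure to be applied to a set
    function that is not introduced as a measure. *)
Lemma measure_of_function :
  exists M : {measure set T -> \bar R}, (M : set T -> \bar R) = f.
Proof. by exists f. Qed.

End measure_of_function.

Lemma cvg_dnbhs (R : realType) (I : Type) (F : set_system I) (FF : Filter F)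
    (f : I -> R) (a : R) : f @ F --> a -> (\forall i \near F, f i != a) ->
  f @ F --> a^'.
Proof. by move=> fa na A hA; apply: filterS2 na (fa _ hA) => i ni; apply. Qed.

Section affine_integrand.
Context {R : realType}.
Variables (n : nat) (g s p : R).
Hypotheses (g0 : 0 < g) (s0 : 0 < s) (np : n%:R + p != 0).

Lemma affine_integrandE (c d : R) : g `^ c / s `^ d = expR (c * ln g - d * ln s).
Proof. by rewrite /powR !gt_eqF// expRD expRN. Qed.

Let ln_ratio : ln (g / s ^+ n / s) = ln g - n%:R * ln s - ln s.
Proof.
have sn : 0 < s ^+ n by rewrite exprn_gt0.
have gs0 : 0 < g / s ^+ n by rewrite divr_gt0.
by rewrite !ln_div ?posrE// lnXn// mulr_natl.
Qed.

(** P^(1-t) Q^t with P = g / s^n, Q = s and t = n / (n + p). *)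
Lemma affine_integrand_P :
  g `^ (p / (n%:R + p)) / s `^ (n%:R * (p - 1) / (n%:R + p)) =
  g / s ^+ n * expR (- (n%:R / (n%:R + p)) * ln (g / s ^+ n / s)).
Proof.
have gs0 : 0 < g / s ^+ n by rewrite divr_gt0// exprn_gt0.
rewrite affine_integrandE -{1}[g / s ^+ n]lnK ?posrE// -expRD ln_ratio.
rewrite ln_div ?posrE ?exprn_gt0// lnXn// -mulr_natl.
by congr expR; field.
Qed.

(** Q^(1-t) P^t with P = g / s^n, Q = s and t = p / (n + p). *)
Lemma affine_integrand_Q :
  g `^ (p / (n%:R + p)) / s `^ (n%:R * (p - 1) / (n%:R + p)) =
  s * expR (- (p / (n%:R + p)) * ln (s / (g / s ^+ n))).
Proof.
have sn : 0 < s ^+ n by rewrite exprn_gt0.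
have -> : ln (s / (g / s ^+ n)) = - ln (g / s ^+ n / s).
  by rewrite -lnV ?invf_div// posrE !divr_gt0.
rewrite affine_integrandE -{2}[s]lnK ?posrE// -expRD ln_ratio.
by congr expR; field.
Qed.

End affine_integrand.

Section affine_measure.
Context {R : realType} {n : nat} (m k : nat) (i_ : 'I_n -> nat).
Variables (L : set 'rV[R]_n) (phi : 'rV[R]_n -> 'rV[R]_n).
Variable D : 'rV[R]_n -> 'M[R]_n.
Hypotheses (n2 : (2 <= n)%N) (bL : body0 L) (dL : dual_map L phi D).

Let T : Type := @surface_space R n.
Let X : set T := boundary L.
Let nu := hausdorff_measure R n n.-1.

(** The boundary being compact, such functions are measurable and lie between two
    positive constants; they are closed under the operations that form the
    densities of the affine surface areas. *)
Definition continuous_pos (f : 'rV[R]_n -> R) : Prop :=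
  (forall x, boundary L x -> 0 < f x) /\
  (forall x, boundary L x -> f @ within (boundary L) (nbhs x) --> f x).

Lemma continuous_posM f g : continuous_pos f -> continuous_pos g ->
  continuous_pos (fun x => f x * g x).
Proof.
move=> [f0 cf] [g0 cg]; split=> x Lx; first by rewrite mulr_gt0 ?f0 ?g0.
by apply: cvgM; [exact: cf|exact: cg].
Qed.

Lemma continuous_posV f : continuous_pos f -> continuous_pos (fun x => (f x)^-1).
Proof.
move=> [f0 cf]; split=> x Lx; first by rewrite invr_gt0 f0.
by apply: cvgV; [rewrite lt0r_neq0// f0|exact: cf].
Qed.

Lemma continuous_posX f j : continuous_pos f -> continuous_pos (fun x => f x ^+ j).
Proof.
move=> [f0 cf]; split=> x Lx; first by rewrite exprn_gt0 ?f0.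
exact: (@cvg_comp _ _ _ f (@GRing.exp R ^~ j) _ _ _ (cf x Lx)
  (@exprn_continuous R j (f x))).
Qed.

Lemma continuous_pos_cst c : 0 < c -> continuous_pos (fun=> c).
Proof. by move=> c0; split=> x Lx //; exact: cvg_cst. Qed.

Lemma continuous_pos_prod (I : Type) (r : seq I) (P : pred I)
    (f : I -> 'rV[R]_n -> R) : (forall i, P i -> continuous_pos (f i)) ->
  continuous_pos (fun x => \prod_(i <- r | P i) f i x).
Proof.
move=> hf; split=> x Lx; first by apply: prodr_gt0 => i /hf[f0 _]; exact: f0.
by apply: cvg_bigprod => i /hf[_ cf]; exact: cf.
Qed.

Lemma support_at_pos : continuous_pos (support_at L).
Proof.
by split=> x Lx; [exact: (support_at_gt0 bL dL)|exact: (support_at_cvg bL dL)].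
Qed.

Lemma mean_curvature_pos j : (j <= n.-1)%N -> continuous_pos (mean_curvature j L).
Proof.
move=> jn; split=> x Lx; first exact: (mean_curvature_gt0 bL dL).
exact: (mean_curvature_cvg bL dL).
Qed.

Lemma mu_density_pos : continuous_pos (mu_density m k i_ L).
Proof.
have h : continuous_pos (fun x => support_at L x ^+ m * (support_at L x ^+ k)^-1 *
  \prod_(j < n | (0 < j)%N)
     ('C(n.-1, j)%:R ^+ i_ j * mean_curvature j L x ^+ i_ j)).
  apply: continuous_posM.
    apply: continuous_posM; first exact: continuous_posX support_at_pos.
    by apply: continuous_posV; exact: continuous_posX support_at_pos.
  apply: continuous_pos_prod => j _.
  have jn : (j <= n.-1)%N by rewrite -ltnS prednK ?ltn_ord// ltnW.
  apply: continuous_posM; apply: continuous_posX.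
    by apply: continuous_pos_cst; rewrite ltr0n bin_gt0.
  exact: mean_curvature_pos.
(* The integer exponent m - k splits because the support function is nonzero. *)
have E x : boundary L x -> mu_density m k i_ L x =
    support_at L x ^+ m * (support_at L x ^+ k)^-1 *
    \prod_(j < n | (0 < j)%N)
     ('C(n.-1, j)%:R ^+ i_ j * mean_curvature j L x ^+ i_ j).
  move=> Lx; rewrite /mu_density expfzDr ?exprnN//.
  by rewrite lt0r_neq0// (support_at_pos.1 x Lx).
split=> x Lx; first by rewrite E//; exact: h.1.
rewrite E//; apply: cvg_trans (h.2 x Lx); apply: near_eq_cvg.
by apply: (filterS _ (@withinT _ (nbhs x) (boundary L) _)) => y Ly; rewrite E.
Qed.

Lemma density_P_pos : continuous_pos (density_P L).
Proof.
apply: continuous_posM; first exact: mean_curvature_pos.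
by apply: continuous_posV; exact: continuous_posX support_at_pos.
Qed.

Let mX : measurable X.
Proof.
apply: closed_caratheodory; first exact: hausdorff_half_space.
exact: (compact_closed_rV (boundary_compact bL)).
Qed.

Let nuX : (0 < nu X < +oo)%E.
Proof.
by rewrite (boundary_area_gt0 n2 bL) (boundary_area_lty bL (dual_map_polar dL)).
Qed.

Lemma continuous_pos_measurable f : continuous_pos f -> measurable_fun X (f : T -> R).
Proof.
move=> [_ cf]; apply: continuous_caratheodory cf; first exact: hausdorff_half_space.
exact: (compact_closed_rV (boundary_compact bL)).
Qed.

Let X0 : X !=set0.
Proof.
by apply/set0P/negP => /eqP h; move: nuX; rewrite h measure0 ltxx.
Qed.

Lemma continuous_pos_bounds f : continuous_pos f ->
  exists c C : R, 0 < c /\ forall x, boundary L x -> c <= f x <= C.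
Proof.
move=> [f0 cf]; have cX := boundary_compact bL.
have cf' : {within boundary L, continuous f} by apply/subspace_continuousP.
have [a /[!inE] La ha] := compact_EVT_min X0 cX cf'.
have [b /[!inE] Lb hb] := compact_EVT_max X0 cX cf'.
exists (f a), (f b); split=> [|x Lx]; first exact: f0.
by rewrite ha ?hb ?inE.
Qed.

Let dens := mu_density m k i_ L.

Let mdens : measurable_fun X (EFin \o (dens : T -> R)).
Proof. by apply/measurable_EFinP; exact: continuous_pos_measurable mu_density_pos. Qed.

Let dens0 (x : T) : X x -> (0 <= (dens x)%:E)%E.
Proof. by move=> Lx; rewrite lee_fin ltW// mu_density_pos.1. Qed.

Lemma mu_i_measure :
  exists M : {measure set T -> \bar R}, (M : set T -> \bar R) = mu_i m k i_ L.
Proof.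
apply: measure_of_function.
- by rewrite /mu_i set0I integral_set0.
- by move=> A; apply: integral_ge0 => x [_ Xx]; exact: dens0.
move=> F mF tF mUF.
have FX (x : T) : (\bigcup_j (F j `&` X)) x -> X x by move=> [j _ []].
have -> : mu_i m k i_ L (\bigcup_j F j) = (\sum_(j <oo) mu_i m k i_ L (F j))%E.
  rewrite /mu_i setI_bigcupl.
  apply: (@ge0_integral_bigcup _ T R nu (fun j => F j `&` X)
    (EFin \o (dens : T -> R))).
  - by move=> j; exact: measurableI.
  - exact: measurable_funS mX FX mdens.
  - by move=> x /FX; exact: dens0.
  - exact: trivIset_setIr.
apply: is_cvg_nneseries => j _ _; apply: integral_ge0 => x [_ Xx]; exact: dens0.
Qed.

Lemma affine_mean_limit p q a : continuous_pos p -> continuous_pos q ->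
  let Z t := fine (\int[mu_i m k i_ L]_(x in X) (p x * expR (- t * ln (p x / q x)))%:E) in
  let Z0 := fine (\int[mu_i m k i_ L]_(x in X) (p x)%:E) in
  (Z t / Z0) `^ (a / t) @[t --> 0^'] -->
    expR (- (a * kullback_leibler (mu_i m k i_ L) X p q / Z0)).
Proof.
move=> hp hq; have [M ME] := mu_i_measure.
have [c1 [C1 [c10 h1]]] := continuous_pos_bounds hp.
have [c2 [C2 [c20 h2]]] := continuous_pos_bounds hq.
have [c3 [C3 [c30 h3]]] := continuous_pos_bounds mu_density_pos.
have MX : (0 < M X < +oo)%E.
  have -> : M X = (\int[nu]_(x in X) (dens x)%:E)%E by rewrite ME /mu_i setIid.
  have [nu0 nuoo] := andP nuX.
  have id : nu.-integrable X (EFin \o (dens : T -> R)).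
    apply: (integrable_bounded mX nuoo _ (M := C3)) => [|x Xx].
      exact: (continuous_pos_measurable mu_density_pos).
    by have /andP[g1 g2] := h3 x Xx; rewrite gtr0_norm// (lt_le_trans c30).
  apply/andP; split.
    apply: (@integral_gt0 _ T R nu X X dens c3 mX mX (@subset_refl _ X)
      (continuous_pos_measurable mu_density_pos) c30 _ _ nu0).
      by move=> x Xx; rewrite ltW// mu_density_pos.1.
    by move=> x /h3/andP[].
  by have := integrable_fin_num mX id; rewrite ge0_fin_numE// integral_ge0.
rewrite -ME; have c0 : 0 < Num.min c1 c2 by rewrite lt_min c10.
apply: (@geometric_mean_limit _ T R M X p q (Num.min c1 c2) (Num.max C1 C2) mX MX
  (continuous_pos_measurable hp) (continuous_pos_measurable hq) c0) => x Xx.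
  by have /andP[g1 g2] := h1 x Xx; rewrite ge_min g1 le_max g2.
by have /andP[g1 g2] := h2 x Xx; rewrite ge_min g1 le_max g2 !orbT.
Qed.

Lemma omega_P p : n%:R + p != 0 ->
  omega m k i_ p L = fine (\int[mu_i m k i_ L]_(x in X)
    (density_P L x *
     expR (- (n%:R / (n%:R + p)) * ln (density_P L x / density_Q L x)))%:E).
Proof.
move=> np; have [M ME] := mu_i_measure; rewrite /omega -ME; congr fine.
apply: eq_integral => x /[!inE] Lx; rewrite affine_integrand_P//.
  exact: ((mean_curvature_pos (leqnn _)).1 x Lx).
exact: (support_at_pos.1 x Lx).
Qed.

Lemma omega_Q p : n%:R + p != 0 ->
  omega m k i_ p L = fine (\int[mu_i m k i_ L]_(x in X)
    (density_Q L x *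
     expR (- (p / (n%:R + p)) * ln (density_Q L x / density_P L x)))%:E).
Proof.
move=> np; have [M ME] := mu_i_measure; rewrite /omega -ME; congr fine.
apply: eq_integral => x /[!inE] Lx; rewrite affine_integrand_Q//.
  exact: ((mean_curvature_pos (leqnn _)).1 x Lx).
exact: (support_at_pos.1 x Lx).
Qed.

Lemma omega0E : omega m k i_ 0 L =
  fine (\int[mu_i m k i_ L]_(x in X) (density_Q L x)%:E).
Proof.
have n0 : (n%:R + 0 : R) != 0 by rewrite addr0 pnatr_eq0 -lt0n ltnW.
rewrite omega_Q//; have [M ME] := mu_i_measure; rewrite -ME; congr fine.
by apply: eq_integral => x _; rewrite mul0r oppr0 mul0r expR0 mulr1.
Qed.

Lemma omega_limit_infty :
  (omega m k i_ p L / omega_infty m k i_ L) `^ (n%:R + p) @[p --> +oo] -->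
    expR (- (n%:R * KL_PQ m k i_ L / omega_infty m k i_ L)).
Proof.
have lim := affine_mean_limit (a := n%:R) density_P_pos support_at_pos.
have n0 : (0 < n%:R :> R) by rewrite ltr0n ltnW.
have np : \forall p \near +oo, 0 < n%:R + p :> R.
  by apply: filterS (nbhs_pinfty_gt (num_real (0 : R))) => p; exact: addr_gt0.
have tlim : (n%:R / (n%:R + p)) @[p --> +oo] --> (0 : R)^'.
  apply: cvg_dnbhs.
    apply/cvgr0Pnorm_lt => e e0; near=> p.
    have p0 : 0 < n%:R + p by near: p.
    rewrite gtr0_norm ?divr_gt0// ltr_pdivrMr// mulrDr -ltrBlDl.
    rewrite -ltr_pdivrMl//; near: p; apply: nbhs_pinfty_gt; exact: num_real.
  by apply: filterS np => p np; rewrite gt_eqF// divr_gt0.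
apply: cvg_trans (cvg_comp _ _ tlim lim).
apply: near_eq_cvg; near=> p.
have p0 : 0 < n%:R + p by near: p.
rewrite /= omega_P ?gt_eqF//; congr (_ `^ _).
by rewrite invf_div mulrCA divff ?mulr1// gt_eqF.
Unshelve. all: by end_near. Qed.

Lemma omega_limit_0 :
  (omega m k i_ p L / omega m k i_ 0 L)
    `^ (n%:R * (n%:R + p) / p) @[p --> 0^'] -->
    expR (- (n%:R * KL_QP m k i_ L / omega m k i_ 0 L)).
Proof.
have lim := affine_mean_limit (a := n%:R) support_at_pos density_P_pos.
have n0 : (0 < n%:R :> R) by rewrite ltr0n ltnW.
have np : \forall p \near (0 : R), 0 < n%:R + p.
  near=> p; rewrite -ltrBlDl sub0r; near: p.
  by apply: lt_nbhsr; rewrite oppr_lt0.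
have tlim : (p / (n%:R + p)) @[p --> (0 : R)^'] --> (0 : R)^'.
  apply: cvg_dnbhs.
    have h : p / (n%:R + p) @[p --> (0 : R)^'] --> (0 / (n%:R + 0) : R).
      have c0 : p @[p --> (0 : R)^'] --> (0 : R) by exact: nbhs_dnbhs.
      apply: cvgM => //; apply: cvgV; first by rewrite addr0 gt_eqF.
      by apply: cvgD => //; exact: cvg_cst.
    by rewrite mul0r in h.
  near=> p; have p0 : p != 0 by near: p; exact: nbhs_dnbhs_neq.
  rewrite mulf_neq0// invr_eq0 gt_eqF//.
  by near: p; exact: nbhs_dnbhs.
rewrite omega0E; apply: cvg_trans (cvg_comp _ _ tlim lim).
apply: near_eq_cvg; near=> p.
have p0 : 0 < n%:R + p by near: p; exact: nbhs_dnbhs.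
rewrite /= omega_Q ?gt_eqF//; congr (_ `^ _).
by rewrite invf_div mulrA.
Unshelve. all: by end_near. Qed.

End affine_measure.

Theorem theorem3p8 (R : realType) (n : nat) (hn : (2 <= n)%N) (k m : nat)
    (i_ : 'I_n -> nat)
    (hi : (\sum_(j < n | 0 < j) j * i_ j = m)%N)
    (K : set 'rV[R]_n) (hK : convex_body K) (hC : C2_plus K)
    (hc : centroid K = 0) :
  ((omega m k i_ p K / omega_infty m k i_ K) `^ (n%:R + p) @[p --> +oo] -->
     expR (- (n%:R * KL_PQ m k i_ K / omega_infty m k i_ K)))
  /\
  ((omega m k i_ p (polar K) / omega m k i_ 0 (polar K))
       `^ (n%:R * (n%:R + p) / p) @[p --> 0^'] -->
     expR (- (n%:R * KL_QP m k i_ (polar K) / omega m k i_ 0 (polar K)))).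
Proof.
have [cK vK iK] := hK.
have bK : body0 K by split=> //; exact: (centroid_interior (ltnW hn)).
have dK := C2_plus_dual_map bK hC hn.
split; first exact: (omega_limit_infty hn bK dK).
exact: (omega_limit_0 hn (polar_body0 bK) (dual_map_of_polar bK dK)).
Qed.
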